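(* Let $d\ge 3$ and $m\ge 1$ be integers and let $\beta>2$ be real. The chain activation and transport (CAT) Markov chain $(\mathcal C_t)_{t\ge 0}$ with parameters $(d,m,\beta)$ has a critical numerosity of $n_c=2m+2$ with respect to the event $\{\mathrm{diam}(\mathcal C_t)\to\infty \text{ as } t\to\infty\}$. That is, for every finite $C\subset\mathbb Z^d$ with $|C|\ge m+1$, $$\mathbf P_C\big(\mathrm{diam}(\mathcal C_t)\to\infty\big)=\begin{cases}0 & \text{if } |C|<2m+2,\\ 1 & \text{if } |C|\ge 2m+2.\end{cases}$$
   Context: $\|\cdot\|$ is the Euclidean norm; $\mathrm{diam}(A)=\sup_{x,y\in A}\|x-y\|$. For $A\subset\mathbb Z^d$, $\partial A=\{x\in\mathbb Z^d\setminus A:\ \|x-y\|=1\text{ for some }y\in A\}$. Let $\phi(u,v)=\max\{\|u-v\|,1\}^{-\beta}$ for $u,v\in\mathbb Z^d$. CAT is the Markov chain $(\mathcal C_t)_{t\ge0}$ on $\mathcal S=\{S\subset\mathbb Z^d: m+1\le|S|<\infty\}$ with the following step. Given $\mathcal C_t$, choose $x_1$ uniformly at random in $\mathcal C_t$; for $l=1,\dots,m-1$, given $x_1,\dots,x_l$, choose $x_{l+1}\in\mathcal C_t\setminus\{x_1,\dots,x_l\}$ with probability proportional to $\phi(x_l,x_{l+1})$ (''activation''); then for $l=m,\dots,2m-1$, given $x_1,\dots,x_l$, choose $x_{l+1}\in\partial\big((\mathcal C_t\setminus\{x_1,\dots,x_m\})\cup\{x_{m+1},\dots,x_l\}\big)$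 with probability proportional to $\phi(x_l,x_{l+1})$ (''transport''). Set $\mathcal C_{t+1}=(\mathcal C_t\setminus\{x_1,\dots,x_m\})\cup\{x_{m+1},\dots,x_{2m}\}$. Note $|\mathcal C_{t+1}|=|\mathcal C_t|$. $\mathbf P_C$ is the law of the chain started from $\mathcal C_0=C$. A random process $\mathcal X$ on a collection of finite subsets of $\mathbb Z^d$ that a.s. conserves the number of elements has critical numerosity $n_c\in\mathbb Z_{\ge2}$ with respect to an event $B\in\sigma(\mathcal X)$ if, for every state $X$, $\mathbf P_X(B)=0$ when $|X|<n_c$ and $\mathbf P_X(B)=1$ when $|X|\ge n_c$. *)

(* Defs.v *)
From HB Require Import structures.
From mathcomp Require Import all_boot all_order all_algebra finmap.
From mathcomp Require Import all_classical all_reals all_analysis.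

Set Implicit Arguments.
Unset Strict Implicit.
Unset Printing Implicit Defensive.
Import Order.TTheory GRing.Theory Num.Theory.
Import numFieldNormedType.Exports.
Local Open Scope classical_set_scope.
Local Open Scope ring_scope.

Notation lattice d := 'rV[int]_d.
Notation config d := {fset 'rV[int]_d}.

Section Lattice.
Variables (R : realType) (d : nat).
Implicit Types (u v x y : lattice d) (A : config d).

Definition enorm u : R := Num.sqrt (\sum_(i < d) (u ord0 i)%:~R ^+ 2).

Definition diam A : R :=
  sup [set r | exists x y, [/\ x \in A, y \in A & r = enorm (x - y)]].

Definition boundary_set A : set (lattice d) :=
  [set x | x \notin A /\ exists2 y, y \in A & enorm (x - y) = 1].

(* [fset_set] returns the empty set on infinite sets, but boundaries are
   finite: see [in_boundary]. *)
Definition boundary A : config d := fset_set (boundary_set A).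

Lemma finite_boundary_set A : finite_set (boundary_set A).
Proof.
pose f (p : A * {ffun 'I_d -> 'I_3}) : lattice d :=
  fsval p.1 + \row_i ((p.2 i)%:Z - 1).
apply: (@sub_finite_set _ _ (range f)); last first.
  by apply: finite_image; exact: finite_finset.
move=> x [_ [y yA xy1]].
have bnd i : (`|x ord0 i - y ord0 i| <= 1)%R.
  have s0 (j : 'I_d) : 0 <= ((x - y) ord0 j)%:~R ^+ 2 :> R by exact: sqr_ge0.
  have : \sum_(j < d) ((x - y) ord0 j)%:~R ^+ 2 = 1 :> R.
    have /(congr1 (fun r => r ^+ 2)) := xy1.
    by rewrite /enorm sqr_sqrtr ?expr1n // sumr_ge0.
  rewrite (bigD1 i) //= => e.
  have : ((x - y) ord0 i)%:~R ^+ 2 <= 1 :> R.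
    by rewrite -[leRHS]e lerDl sumr_ge0.
  rewrite -[_ ^+ 2]real_normK ?num_real // expr_le1 // !mxE.
  by rewrite -intr_norm -[1]/(1%:~R) ler_int.
have key i : (absz (x ord0 i - y ord0 i + 1)%R < 3)%N.
  have := bnd i; rewrite ler_norml; move: (_ - _) => z /andP[z1 z2].
  have z0 : 0 <= z + 1 by rewrite -lerBlDr sub0r.
  rewrite -ltz_nat gez0_abs //.
  by rewrite (le_lt_trans (_ : _ <= 1 + 1)) // lerD2r.
exists ([` yA]%fset, [ffun i => Ordinal (key i)]) => //.
apply/rowP => i; rewrite /f !mxE ffunE /= gez0_abs.
  by rewrite addrK addrC subrK.
by have := bnd i; rewrite ler_norml => /andP[z1 _]; rewrite -lerBlDr sub0r.
Qed.

Lemma in_boundary A x :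
  x \in boundary A <->
  (x \notin A /\ exists2 y, y \in A & enorm (x - y) = 1).
Proof.
by rewrite /boundary in_fset_set ?inE //; exact: finite_boundary_set.
Qed.

End Lattice.

Section CAT.
Variables (R : realType) (d m : nat) (beta : R).
Implicit Types (C B : config d) (h : seq (lattice d)).

Definition phi (u v : lattice d) : R :=
  (Num.max (enorm R (u - v)) 1) `^ (- beta).

(* Throughout, h = [:: x_1; ...; x_l] lists the sites chosen so far during a
   step from C: the first m are activated, the next ones are deposited. *)

Definition current C h : config d :=
  ((C `\` [fset x in take m h]) `|` [fset x in drop m h])%fset.

Definition candidates C h : config d :=
  if (size h < m)%N then (C `\` [fset x in h])%fset
  else boundary R (current C h).

(* x_1 is uniform, whence the constant weight when h is empty. *)
Definition weight h (y : lattice d) : R :=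
  if h is x :: h' then phi (last x h') y else 1.

Definition choice_prob C h (y : lattice d) : R :=
  weight h y / \sum_(z <- candidates C h) weight h z.

(* The probability that, given the choices h, making k further choices leads
   to the configuration B. *)
Fixpoint outcome_prob C (k : nat) h B : R :=
  if k is k'.+1 then
    \sum_(y <- candidates C h)
      choice_prob C h y * outcome_prob C k' (rcons h y) B
  else (current C h == B)%:R.

Definition cat_step C B : R := outcome_prob C (2 * m) [::] B.

Definition cat_state : set (config d) :=
  [set C | (m.+1 <= #|` C|)%N].

End CAT.

Section Process.
Variables (R : realType) (d : nat).

Definition cylinders : set (set (nat -> config d)) :=
  [set F | exists t A, F = [set w | w t = A]].

HB.instance Definition _ := isPointed.Build (config d) fset0.

(* Trajectories, with the sigma-algebra generated by the coordinates. *)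
Definition trajectory := g_sigma_algebraType cylinders.

HB.instance Definition _ := Measurable.on trajectory.

(* P is the law of the time-homogeneous Markov chain with transition
   probabilities p started from C. *)
Definition markov_law (p : config d -> config d -> R) (C : config d)
    (P : probability trajectory R) : Prop :=
  P [set w : trajectory | w 0%N = C] = 1%E /\
  forall (t : nat) (w0 : trajectory),
    P [set w : trajectory | forall s, (s <= t.+1)%N -> w s = w0 s] =
    (P [set w : trajectory | forall s, (s <= t)%N -> w s = w0 s]
       * (p (w0 t) (w0 t.+1))%:E)%E.

(* The process with state space S and laws P_C. *)
Definition conserves_cardinality (S : set (config d))
    (P : config d -> probability trajectory R) : Prop :=
  forall C, S C -> {ae P C, forall w, forall t, #|` w t| = #|` C|}.

Definition critical_numerosity (S : set (config d))
    (P : config d -> probability trajectory R) (B : set trajectory)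
    (nc : nat) : Prop :=
  [/\ (2 <= nc)%N, conserves_cardinality S P, measurable B &
      forall C, S C ->
        ((#|` C| < nc)%N -> P C B = 0%E) /\
        ((nc <= #|` C|)%N -> P C B = 1%E)].

Definition diam_to_infinity : set trajectory :=
  [set w : trajectory | diam R (w t) @[t --> \oo] --> +oo].

End Process.

(* Main.v *)
(** At most 2m+1 particles.  Cut the configuration into pieces each connected by
    unit steps.  If there are at least two, one has at most m sites, and with
    probability bounded below, however far apart the pieces are, it is activated
    entirely and the activation goes on in a nearest piece.  A redeposited site
    touches the sites already present, so one piece has been lost.  Hence (1 + diam)^beta,
    corrected by a factor depending on the number of pieces, is a Lyapunov
    function; its mean stays bounded, and diam cannot tend to infinity.

    At least 2m+2 particles.  From any configuration of diameter at most r, a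
    bounded number of moves of non-vanishing probability leads to far apart
    clusters of m+1 sites, except for the last which has between m+1 and 2m+1.
    Compare CAT with the chain in which the clusters ignore each other.  The two
    differ in one step by at most a multiple of the total interaction
    (1 + diam A)^beta (1 + diam B)^beta sum phi(a, b) over pairs of clusters.  A
    cluster of m+1 sites keeps a diameter of at most 2m, and each of its steps
    can be coupled to an independent lazy unit shift in any of three coordinate
    directions.  As phi is at most a product of three one-dimensional kernels
    with exponent beta/3 and beta > 2, a central binomial estimate makes the
    interaction summable in time, with small sum if the clusters start far apart.
    So the configurations of diameter at most r receive a bounded expected number
    of visits, and Borel-Cantelli concludes. *)
Require Import Defs.
From mathcomp Require Import all_boot all_order all_algebra finmap.
From mathcomp Require Import all_classical all_reals all_analysis.
From mathcomp Require Import ring lra zify.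
Import Order.TTheory GRing.Theory Num.Theory.
Local Open Scope ring_scope.
Set Implicit Arguments.
Unset Strict Implicit.
Unset Printing Implicit Defensive.

(** * The Euclidean norm and the kernel *)

(** All estimates concern the transition operator [Pop] acting on functions; the measure on
    trajectories enters only at the end, through an upper bound on its one-time marginals. The
    exponent [beta] of [spread] comes from the normalisation: inside a set of diameter [D] the
    candidates weigh at least of order [(1 + D)^(-beta)], so a foreign cluster disturbs a choice by
    at most [spread] times the kernel between them. The last cluster, of up to 2m+1 sites, has no
    bounded diameter; the Lyapunov bound of the recurrent half controls its [spread] in the
    transient half. After [n] lazy steps a one-dimensional kernel of exponent [beta / 3] is of order
    at most [n^(-1/(2p))], for any [p > 1] with [p beta / 3 > 1]. Its cube is summable when
    [p < 3/2], and such a [p] exists exactly when [beta > 2]. The error of the decoupling is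
    proportional to the bound [kappa] on the expected number of visits, which is what is sought. The
    circle is broken by making the interaction small before [kappa] is chosen. *)

Section EuclideanNorm.
Variables (R : realType) (d : nat).
Implicit Types x y z : lattice d.

Lemma sum_CauchySchwarz (I : finType) (a b : I -> R) :
  (\sum_i a i * b i) ^+ 2 <= (\sum_i a i ^+ 2) * (\sum_i b i ^+ 2).
Proof.
set S := \sum_i _ * _; set A := \sum_i a i ^+ 2; set B := \sum_i b i ^+ 2.
have B0 : 0 <= B by apply: sumr_ge0 => i _; exact: sqr_ge0.
have : 0 <= \sum_i (B * a i - S * b i) ^+ 2.
  by apply: sumr_ge0 => i _; exact: sqr_ge0.
have -> : \sum_i (B * a i - S * b i) ^+ 2 = B * (A * B - S ^+ 2).
  transitivity (\sum_i (B ^+ 2 * a i ^+ 2 - 2 * B * S * (a i * b i)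
                        + S ^+ 2 * b i ^+ 2)).
    by apply: eq_bigr => i _; ring.
  by rewrite !big_split/= sumrN -!mulr_sumr -/A -/B -/S; ring.
have [B00 _|Bn0] := eqVneq B 0.
  rewrite B00 mulr0 /S big1 ?expr0n// => i _.
  have /eqP := B00; rewrite psumr_eq0; last by move=> j _; exact: sqr_ge0.
  by move=> /allP/(_ i (mem_index_enum _)); rewrite sqrf_eq0 => /eqP ->; rewrite mulr0.
by rewrite pmulr_rge0 ?lt_neqAle ?B0 ?andbT 1?eq_sym// subr_ge0.
Qed.

Lemma enorm_ge0 x : 0 <= enorm R x.
Proof. exact: sqrtr_ge0. Qed.

Lemma sumsq_ge0 x : 0 <= \sum_(i < d) (x ord0 i)%:~R ^+ 2 :> R.
Proof. by apply: sumr_ge0 => i _; exact: sqr_ge0. Qed.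

Lemma enorm_sqr x : enorm R x ^+ 2 = \sum_(i < d) (x ord0 i)%:~R ^+ 2.
Proof. by rewrite sqr_sqrtr// sumsq_ge0. Qed.

Lemma enormN x : enorm R (- x) = enorm R x.
Proof.
by congr Num.sqrt; apply: eq_bigr => i _; rewrite !mxE rmorphN sqrrN.
Qed.

Lemma enormB x y : enorm R (x - y) = enorm R (y - x).
Proof. by rewrite -enormN opprB. Qed.

Lemma enorm0 : enorm R (0 : lattice d) = 0.
Proof.
by rewrite /enorm big1 ?sqrtr0// => i _; rewrite mxE expr0n.
Qed.

Lemma enormD x y : enorm R (x + y) <= enorm R x + enorm R y.
Proof.
have s0 : 0 <= enorm R x + enorm R y by rewrite addr_ge0// enorm_ge0.
rewrite -(@ler_pXn2r _ 2)// ?nnegrE ?enorm_ge0//.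
rewrite sqrrD !enorm_sqr.
under eq_bigr do rewrite mxE rmorphD sqrrD.
rewrite !big_split/= lerD2r lerD2l -mulr2n lerMn2r/=.
rewrite (le_trans (ler_norm _))// -(@ler_pXn2r _ 2)// ?nnegrE ?mulr_ge0 ?enorm_ge0//.
by rewrite real_normK ?num_real// exprMn !enorm_sqr sum_CauchySchwarz.
Qed.

Lemma enorm_triangle y x z :
  enorm R (x - z) <= enorm R (x - y) + enorm R (y - z).
Proof. by rewrite -[x - z](subrKA y) enormD. Qed.

Lemma coord_le_enorm x i : `|(x ord0 i)%:~R| <= enorm R x.
Proof.
rewrite -(@ler_pXn2r _ 2)// ?nnegrE ?enorm_ge0// real_normK ?num_real//.
by rewrite enorm_sqr (bigD1 i)//= lerDl sumr_ge0// => j _; exact: sqr_ge0.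
Qed.

Definition axis (i : 'I_d) : lattice d := delta_mx ord0 i.

Lemma axisE i j : axis i ord0 j = (j == i)%:R.
Proof. by rewrite mxE eqxx. Qed.

Lemma enorm_axis i (k : int) : enorm R (k *: axis i) = `|k%:~R|.
Proof.
rewrite /enorm (bigD1 i)//= big1 => [|j ji]; last first.
  by rewrite mxE axisE (negbTE ji) mulr0 expr0n.
by rewrite addr0 mxE axisE eqxx mulr1 sqrtr_sqr.
Qed.

End EuclideanNorm.

Section Kernel.
Variables (R : realType) (d : nat) (beta : R).
Implicit Types x y z : lattice d.
Hypothesis beta0 : 0 <= beta.

Definition far x y : R := Num.max (enorm R (x - y)) 1.

Lemma far_ge1 x y : 1 <= far x y.
Proof. by rewrite le_max lexx orbT. Qed.

Lemma far_gt0 x y : 0 < far x y.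
Proof. exact: lt_le_trans (far_ge1 _ _). Qed.

Lemma phiE x y : phi beta x y = far x y `^ (- beta).
Proof. by []. Qed.

Lemma phiC x y : phi beta x y = phi beta y x.
Proof. by rewrite /phi enormB. Qed.

Lemma phi_gt0 x y : 0 < phi beta x y.
Proof. by rewrite phiE powR_gt0// far_gt0. Qed.

Lemma phi_ge0 x y : 0 <= phi beta x y.
Proof. exact/ltW/phi_gt0. Qed.

Lemma phi_le1 x y : phi beta x y <= 1.
Proof. by rewrite phiE powRN invf_le1 ?powR_gt0 ?far_gt0// -(powRr0 (far x y)) ler_powR ?far_ge1. Qed.

Lemma phi_translate x y u : phi beta (x + u) (y + u) = phi beta x y.
Proof. by rewrite /phi opprD addrACA subrr addr0. Qed.

Lemma phi_lb x y c : 1 <= c -> enorm R (x - y) <= c -> c `^ (- beta) <= phi beta x y.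
Proof.
move=> c1 xyc; have c0 : 0 < c by exact: lt_le_trans c1.
rewrite phiE !powRN lef_pV2 ?posrE ?powR_gt0 ?far_gt0//.
by rewrite ge0_ler_powR ?nnegrE ?(ltW (far_gt0 _ _))// ?(ltW c0)// ge_max xyc.
Qed.

(** Since [far] is at least 1, moving an endpoint by [c] multiplies it by at most [1 + c]. The
    cut-off at 1 thus makes the loss multiplicative, whatever the distance. *)
Lemma phi_near c x y z : 0 <= c -> enorm R (y - z) <= c ->
  phi beta x y <= (1 + c) `^ beta * phi beta x z.
Proof.
move=> c0 yzc.
have c1 : 0 < 1 + c by rewrite ltr_pwDl.
rewrite !phiE !powRN -ler_pdivrMl ?powR_gt0//.
rewrite -invfM lef_pV2 ?posrE ?mulr_gt0 ?powR_gt0 ?far_gt0//.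
rewrite -powRM ?(ltW c1) ?(ltW (far_gt0 _ _))//.
rewrite ge0_ler_powR ?nnegrE ?mulr_ge0 ?(ltW c1) ?(ltW (far_gt0 _ _))//.
have f1 := far_ge1 x y.
rewrite ge_max; apply/andP; split; last first.
  by rewrite (le_trans f1)// ler_peMl ?lerDl// (le_trans _ f1).
rewrite (le_trans (enorm_triangle R y x z))// mulrDl mul1r lerD//.
  by rewrite le_max lexx.
by rewrite (le_trans yzc)// ler_peMr.
Qed.

End Kernel.

Section FiniteSets.

Lemma seq_argmax (T : eqType) (disp : Order.disp_t) (S : orderType disp)
    (s : seq T) (f : T -> S) : s != [::] ->
  exists2 a, a \in s & forall b, b \in s -> (f b <= f a)%O.
Proof.
elim: s => // x [|y s] IH _.
  by exists x; rewrite ?inE// => b; rewrite inE => /eqP ->.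
have [a a_s amax] := IH isT.
have [fax|fxa] := leP (f a) (f x).
  exists x; rewrite ?mem_head// => b; rewrite inE => /predU1P[->//|bs].
  exact: le_trans (amax b bs) fax.
exists a; rewrite ?(inE, a_s, orbT)//.
  by move: a_s; rewrite inE => ->; rewrite orbT.
by move=> b; rewrite inE => /predU1P[->|/amax//]; exact: ltW.
Qed.

End FiniteSets.

Section Diameter.
Variables (R : realType) (d : nat).
Implicit Types A : config d.

Lemma diam_set_ub A : exists r : R, forall x y, x \in A -> y \in A ->
  enorm R (x - y) <= r.
Proof.
exists (\sum_(x <- A) \sum_(y <- A) enorm R (x - y)) => x y xA yA.
rewrite (big_fsetD1 x)//= (big_fsetD1 y)//= -addrA lerDl addr_ge0//.
  by apply: sumr_ge0 => z _; exact: enorm_ge0.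
by apply: sumr_ge0 => z _; apply: sumr_ge0 => w _; exact: enorm_ge0.
Qed.

Lemma enorm_le_diam A x y : x \in A -> y \in A -> enorm R (x - y) <= diam R A.
Proof.
move=> xA yA; apply: ub_le_sup; last by exists x, y.
have [r Ar] := diam_set_ub A.
by exists r => _ [u [v [uA vA ->]]]; exact: Ar.
Qed.

Lemma diam_le A r : 0 <= r ->
  (forall x y, x \in A -> y \in A -> enorm R (x - y) <= r) -> diam R A <= r.
Proof.
move=> r0 Ar; rewrite /diam.
set S := (X in sup X); have [->|/set0P S0] := eqVneq S set0; first by rewrite sup0.
by apply: ge_sup => // _ [u [v [uA vA ->]]]; exact: Ar.
Qed.

Lemma diam_ge0 A : 0 <= diam R A.
Proof.
have [->|/fset0Pn[x xA]] := eqVneq A fset0.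
  rewrite /diam; set S := (X in sup X); suff -> : S = set0 by rewrite sup0.
  by rewrite -subset0 => r [u [v [+ _ _]]]; rewrite in_fset0.
by rewrite (le_trans (enorm_ge0 R (x - x)))// enorm_le_diam.
Qed.

End Diameter.

Section Boundary.
Variables (R : realType) (d : nat).
Implicit Types A : config d.

(** A neighbour differs from its site by -1, 0 or 1 in each coordinate, whence the crude [3 ^ d]. *)
Lemma card_boundary A : (#|` boundary R A| <= #|` A| * 3 ^ d)%N.
Proof.
pose D := [seq \row_i ((g i : nat)%:Z - 1) | g : {ffun 'I_d -> 'I_3}] : seq (lattice d).
have <- : size D = (3 ^ d)%N by rewrite size_map -cardE card_ffun !card_ord.
rewrite -(size_allpairs +%R).
apply: uniq_leq_size; first exact: fset_uniq.
move=> x /in_boundary[_ [y yA xy1]].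
apply/allpairsP => /=.
have bnd i : (`|x ord0 i - y ord0 i| <= 1)%R.
  have := coord_le_enorm R (x - y) i.
  by rewrite xy1 !mxE -intr_norm -[1]/(1%:~R) ler_int.
have key i : (absz (x ord0 i - y ord0 i + 1)%R < 3)%N by have := bnd i; lia.
exists (y, \row_i ((absz (x ord0 i - y ord0 i + 1))%:Z - 1)); split => //=.
  apply/mapP; exists [ffun i => Ordinal (key i)]; first by rewrite mem_enum.
  by apply/rowP => i; rewrite !mxE ffunE.
apply/rowP => i; rewrite !mxE; have := bnd i.
set a := x _ _; set b := y _ _. lia.
Qed.

Lemma boundary_neq0 A : (0 < d)%N -> A != fset0 -> boundary R A != fset0.
Proof.
case: d A => // d' A _ A0.
(* A site of largest first coordinate has a free neighbour beyond it. *)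
have [a aA amax] : exists2 a, a \in A & forall b, b \in A -> (b ord0 ord0 <= a ord0 ord0)%O.
  apply: seq_argmax; apply: contra_neq A0 => A0.
  by apply/fsetP => z; rewrite in_fset0 -[z \in A]/(z \in enum_fset A) A0.
apply/fset0Pn; exists (a + 1 *: axis ord0); apply/in_boundary; split.
  apply/negP => /amax. rewrite mxE [X in _ + X]mxE axisE eqxx mulr1.
  by rewrite gerDl.
by exists a => //; rewrite addrC addKr enorm_axis normr1.
Qed.

End Boundary.

(** * One step of the chain *)

Section Operator.
Variables (R : realType) (d m : nat) (beta : R).
Implicit Types (C B A : config d) (h : seq (lattice d)) (f g : config d -> R).

Local Notation cand := (candidates R m).
Local Notation cur := (current m).
Local Notation cprob := (choice_prob m beta).

(* The expectation of f at the next configuration, when the choices h have been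
   made and k more are to come. *)
Fixpoint op C (k : nat) h f : R :=
  if k is k'.+1 then \sum_(y <- cand C h) cprob C h y * op C k' (rcons h y) f
  else f (cur C h).

Definition Pop f C : R := op C (2 * m) [::] f.

Lemma cat_stepE C B : cat_step m beta C B = Pop (fun X => (X == B)%:R) C.
Proof.
rewrite /cat_step /Pop; elim: (2 * m)%N [::] => //= k IH h.
by apply: eq_bigr => y _; rewrite IH.
Qed.

(** The histories that the chain can produce; comparisons of functions under [op] are made along
    them only. *)
Inductive legal C : seq (lattice d) -> Prop :=
| legal_nil : legal C [::]
| legal_rcons h y : legal C h -> y \in cand C h -> legal C (rcons h y).

Definition step_rel C B :=
  exists h, [/\ legal C h, size h = (2 * m)%N & B = cur C h].

Lemma weight_gt0 h y : 0 < weight beta h y.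
Proof. by case: h => //= x h; exact: phi_gt0. Qed.

Lemma sum_weight_ge0 h A : 0 <= \sum_(z <- A) weight beta h z.
Proof. by apply: sumr_ge0 => z _; exact/ltW/weight_gt0. Qed.

Lemma sum_weight_gt0 h A : A != fset0 -> 0 < \sum_(z <- A) weight beta h z.
Proof.
move=> /fset0Pn[y yA]; rewrite (big_fsetD1 y)//= ltr_pwDl ?weight_gt0//.
exact: sum_weight_ge0.
Qed.

Lemma cprob_ge0 C h y : 0 <= cprob C h y.
Proof.
by rewrite divr_ge0// ?sum_weight_ge0//; exact/ltW/weight_gt0.
Qed.

Lemma sum_cprob C h : cand C h != fset0 -> \sum_(y <- cand C h) cprob C h y = 1.
Proof.
by move=> c0; rewrite -mulr_suml divff// gt_eqF// sum_weight_gt0.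
Qed.

Lemma sum_cprob_le1 C h : \sum_(y <- cand C h) cprob C h y <= 1.
Proof.
have [c0|/sum_cprob->//] := eqVneq (cand C h) fset0.
by rewrite c0 big_seq_fset0.
Qed.

Lemma op_le C k h f g : legal C h ->
  (forall h', legal C h' -> size h' = (size h + k)%N -> f (cur C h') <= g (cur C h')) ->
  op C k h f <= op C k h g.
Proof.
elim: k h => [|k IH] h hl fg /=; first by apply: fg; rewrite ?addn0.
rewrite big_seq [leRHS]big_seq; apply: ler_sum => y yc.
rewrite ler_wpM2l ?cprob_ge0// IH//; first exact: legal_rcons.
by move=> h' h'l; rewrite size_rcons addSnnS; exact: fg.
Qed.

Lemma op_ge0 C k h f : (forall B, 0 <= f B) -> 0 <= op C k h f.
Proof.
move=> f0; elim: k h => [|k IH] h //=.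
by apply: sumr_ge0 => y _; rewrite mulr_ge0 ?cprob_ge0.
Qed.

Lemma opD C k h f g : op C k h (fun B => f B + g B) = op C k h f + op C k h g.
Proof.
elim: k h => //= k IH h; rewrite -big_split/=; apply: eq_bigr => y _.
by rewrite IH mulrDr.
Qed.

Lemma opZ C k h c f : op C k h (fun B => c * f B) = c * op C k h f.
Proof.
elim: k h => //= k IH h; rewrite mulr_sumr; apply: eq_bigr => y _.
by rewrite IH mulrCA.
Qed.

Lemma eq_op_ext C k h f g : f =1 g -> op C k h f = op C k h g.
Proof. by move=> /funext ->. Qed.

Lemma op0 C k h : op C k h (fun=> 0) = 0.
Proof. by rewrite (eq_op_ext _ _ _ (g := fun=> 0 * 0)) ?opZ ?mul0r// => B; rewrite mul0r. Qed.

Lemma opB C k h f g : op C k h (fun B => f B - g B) = op C k h f - op C k h g.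
Proof.
rewrite (eq_op_ext _ _ _ (g := fun B => f B + (-1) * g B)).
  by rewrite opD opZ mulN1r.
by move=> B; rewrite mulN1r.
Qed.

Lemma op_sum C k h (I : Type) (r : seq I) (F : I -> config d -> R) :
  op C k h (fun B => \sum_(i <- r) F i B) = \sum_(i <- r) op C k h (F i).
Proof.
elim: r => [|i r IH].
  by under eq_op_ext do rewrite big_nil; rewrite op0 big_nil.
by under eq_op_ext do rewrite big_cons; rewrite opD IH big_cons.
Qed.

(** For an arbitrary history the candidates may be empty, and then the probabilities sum to 0: in
    general [op] is only sub-Markov. Equality is [op_cst]. *)
Lemma op_cst_le C k h c : 0 <= c -> op C k h (fun=> c) <= c.
Proof.
move=> c0; elim: k h => //= k IH h.
apply: (@le_trans _ _ (\sum_(y <- cand C h) cprob C h y * c)).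
  by apply: ler_sum => y _; rewrite ler_wpM2l ?cprob_ge0.
by rewrite -mulr_suml ler_piMl ?sum_cprob_le1.
Qed.

Lemma op_choice C k h y f : y \in cand C h -> (forall B, 0 <= f B) ->
  cprob C h y * op C k (rcons h y) f <= op C k.+1 h f.
Proof.
move=> yc f0 /=; rewrite (big_fsetD1 y)//= lerDl sumr_ge0// => z _.
by rewrite mulr_ge0 ?cprob_ge0 ?op_ge0.
Qed.

(** Fubini for two independent runs. It lets the moves of two decoupled clusters be reordered. *)
Lemma op_comm C k h A k' h' (G : config d -> config d -> R) :
  op C k h (fun X => op A k' h' (G X)) = op A k' h' (fun Y => op C k h (G^~ Y)).
Proof.
elim: k h => //= k IH h; rewrite op_sum; apply: eq_bigr => y _.
by rewrite IH -opZ.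
Qed.

Lemma Pop_le C f g : (forall B, step_rel C B -> f B <= g B) -> Pop f C <= Pop g C.
Proof.
move=> fg; apply: op_le; first exact: legal_nil.
by move=> h' h'l h's; apply: fg; exists h'.
Qed.

Lemma Pop_ge0 C f : (forall B, 0 <= f B) -> 0 <= Pop f C.
Proof. exact: op_ge0. Qed.

Lemma eq_Pop C f g : (forall B, step_rel C B -> f B = g B) -> Pop f C = Pop g C.
Proof.
by move=> fg; apply/eqP; rewrite eq_le !Pop_le// => B /fg ->.
Qed.

Lemma Pop_le_cst C f c : 0 <= c -> (forall B, step_rel C B -> f B <= c) ->
  Pop f C <= c.
Proof. by move=> c0 fc; rewrite (le_trans (Pop_le fc))// op_cst_le. Qed.

Lemma PopD C f g : Pop (fun B => f B + g B) C = Pop f C + Pop g C.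
Proof. exact: opD. Qed.
Lemma PopB C f g : Pop (fun B => f B - g B) C = Pop f C - Pop g C.
Proof. exact: opB. Qed.
Lemma PopZ C c f : Pop (fun B => c * f B) C = c * Pop f C.
Proof. exact: opZ. Qed.
Lemma Pop_sum C (I : Type) (r : seq I) (F : I -> config d -> R) :
  Pop (fun B => \sum_(i <- r) F i B) C = \sum_(i <- r) Pop (F i) C.
Proof. exact: op_sum. Qed.
Lemma Pop_comm C A (G : config d -> config d -> R) :
  Pop (fun X => Pop (G X) A) C = Pop (fun Y => Pop (G^~ Y) C) A.
Proof. exact: op_comm. Qed.

Lemma candidates_act C h : (size h < m)%N -> cand C h = (C `\` [fset x in h])%fset.
Proof. by rewrite /candidates => ->. Qed.

Lemma candidates_dep C h : (m <= size h)%N -> cand C h = boundary R (cur C h).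
Proof. by rewrite /candidates ltnNge => ->. Qed.

Lemma current_act C h : (size h <= m)%N -> cur C h = (C `\` [fset x in h])%fset.
Proof.
move=> hm; rewrite /current take_oversize// drop_oversize//.
by apply/fsetP => z; rewrite !inE orbF.
Qed.

Lemma current_rcons C h y : (m <= size h)%N -> cur C (rcons h y) = (y |` cur C h)%fset.
Proof.
move=> hm; rewrite /current -cats1 takel_cat// drop_cat.
have [hlt|hge] := ltnP m (size h).
  by apply/fsetP => z; rewrite !inE orbF; case: (z == y); rewrite ?orbT ?orbF.
have -> : m = size h by apply/eqP; rewrite eqn_leq hm hge.
by rewrite subnn drop0 drop_size; apply/fsetP => z; rewrite !inE; case: (z == y); rewrite ?orbT ?orbF.
Qed.

Lemma legal_act C h : legal C h -> (size h <= m)%N -> uniq h /\ {subset h <= C}.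
Proof.
elim=> // {}h y hl IH yc; rewrite size_rcons => hm.
have [hu hC] := IH (ltnW hm); move: yc; rewrite candidates_act// !inE => /andP[yh yC].
split; first by rewrite rcons_uniq yh.
by move=> z; rewrite mem_rcons inE => /predU1P[->|/hC].
Qed.

Lemma card_current_act C h : legal C h -> (size h <= m)%N ->
  (#|` cur C h| = #|` C| - size h)%N.
Proof.
move=> hl hm; have [hu hC] := legal_act hl hm.
rewrite current_act// cardfsDS; last by apply/fsubsetP => z; rewrite inE => /hC.
congr (_ - _)%N; rewrite -[in RHS](undup_id hu).
exact: card_fseq.
Qed.

Lemma card_current_dep C h : (m < #|` C|)%N -> legal C h -> (m <= size h)%N ->
  (#|` cur C h| = #|` C| - m + (size h - m))%N.
Proof.
move=> Cm; elim=> [|{}h y hl IH yc hm].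
  rewrite leqn0 => /eqP m0; rewrite card_current_act//; last exact: legal_nil.
  by rewrite m0 addn0.
have [/eqP hm'|hm'] := boolP (size (rcons h y) == m).
  by rewrite card_current_act ?hm' ?subnn ?addn0//; exact: legal_rcons.
have {hm hm'} hm : (m <= size h)%N.
  by move: hm hm'; rewrite size_rcons leq_eqVlt ltnS => /predU1P[->|//]; rewrite eqxx.
move: yc; rewrite candidates_dep// => /in_boundary[yn _].
by rewrite current_rcons// cardfsU1 yn IH// size_rcons subSn// addnS.
Qed.

Lemma current_neq0 C h : (m < #|` C|)%N -> legal C h -> cur C h != fset0.
Proof.
move=> Cm hl; rewrite -cardfs_gt0.
have [hm|/ltnW hm] := leqP (size h) m.
  by rewrite card_current_act// subn_gt0 (leq_ltn_trans hm).
by rewrite card_current_dep// addn_gt0 subn_gt0 Cm.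
Qed.

Lemma candidates_neq0 C h : (0 < d)%N -> (m < #|` C|)%N -> legal C h -> cand C h != fset0.
Proof.
move=> d0 Cm hl; have [hm|hm] := ltnP (size h) m.
  by rewrite candidates_act// -current_act 1?ltnW// current_neq0.
by rewrite candidates_dep// boundary_neq0// current_neq0.
Qed.

Lemma op_cst C k h c : (0 < d)%N -> (m < #|` C|)%N -> legal C h -> op C k h (fun=> c) = c.
Proof.
move=> d0 Cm; elim: k h => //= k IH h hl.
transitivity (\sum_(y <- cand C h) cprob C h y * c).
  by rewrite big_seq [RHS]big_seq; apply: eq_bigr => y yc; rewrite IH//; exact: legal_rcons.
by rewrite -mulr_suml sum_cprob ?mul1r// candidates_neq0.
Qed.

Lemma Pop_cst C c : (0 < d)%N -> (m < #|` C|)%N -> Pop (fun=> c) C = c.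
Proof. by move=> d0 Cm; apply: op_cst => //; exact: legal_nil. Qed.

Lemma card_candidates C h : (m < #|` C|)%N -> legal C h -> (size h <= 2 * m)%N ->
  (#|` cand C h| <= #|` C| * 3 ^ d)%N.
Proof.
move=> Cm hl h2m; have [hm|hm] := ltnP (size h) m.
  rewrite candidates_act// (leq_trans (fsubset_leq_card (fsubsetDl _ _)))//.
  by rewrite leq_pmulr// expn_gt0.
rewrite candidates_dep// (leq_trans (card_boundary _ _))// leq_mul2r.
rewrite card_current_dep//; apply/orP; right.
by move: hm h2m Cm; rewrite mul2n -addnn; lia.
Qed.

(** Every deposited site is adjacent to one already present, so each deposit adds at most 1 to the
    distance from the sites that were not activated. *)
Lemma current_near C h : legal C h -> (m <= size h)%N -> forall b, b \in cur C h ->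
  exists2 a, a \in (C `\` [fset x in take m h])%fset & enorm R (b - a) <= (size h - m)%N%:R.
Proof.
elim=> [_ b|{}h y hl IH yc hm b].
  rewrite current_act// => bC; exists b; first by move: bC; rewrite !inE.
  by rewrite subrr enorm0.
have [/eqP hm'|hm'] := boolP (size (rcons h y) == m).
  rewrite current_act ?hm'// => bC; exists b; last by rewrite subrr enorm0.
  by rewrite take_oversize ?hm'.
have {hm hm'} hm : (m <= size h)%N.
  by move: hm hm'; rewrite size_rcons leq_eqVlt ltnS => /predU1P[->|//]; rewrite eqxx.
move: yc; rewrite candidates_dep// => /in_boundary[yn [z zc yz]].
rewrite current_rcons// in_fset1U size_rcons subSn// -cats1 takel_cat//.
move=> /predU1P[->|/(IH hm)[a aC ba]]; last first.
  by exists a => //; rewrite (le_trans ba)// ler_nat.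
have [a aC za] := IH hm _ zc; exists a => //.
by rewrite (le_trans (enorm_triangle R z _ _))// yz -[leRHS]natr1 addrC lerD.
Qed.

Lemma card_step C B : (m < #|` C|)%N -> step_rel C B -> #|` B| = #|` C|.
Proof.
move=> Cm [h [hl hs ->]]; rewrite card_current_dep// hs ?mul2n -?addnn ?leq_addr//.
by rewrite addnK subnK// ltnW.
Qed.

Lemma step_near C B : step_rel C B -> forall b, b \in B ->
  exists2 a, a \in C & enorm R (b - a) <= m%:R.
Proof.
move=> [h [hl hs ->]] b /(current_near hl); rewrite hs mul2n -addnn leq_addr addnK.
by case=> // a; rewrite !inE => /andP[_ aC] ba; exists a.
Qed.

Lemma diam_step C B : step_rel C B -> diam R B <= diam R C + 2 * m%:R.
Proof.
move=> CB; apply: diam_le; first by rewrite addr_ge0 ?diam_ge0.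
move=> x y /(step_near CB)[a aC xa] /(step_near CB)[b bC yb].
rewrite (le_trans (enorm_triangle R a _ _))//.
rewrite (le_trans (lerD xa (enorm_triangle R b _ _)))//.
rewrite -enormB in yb.
by have := enorm_le_diam R aC bC; lra.
Qed.

Lemma cprob_ge C h y (c n : R) : 0 <= c -> y \in cand C h ->
  (forall z, z \in cand C h -> c * weight beta h z <= weight beta h y) ->
  0 < n -> #|` cand C h|%:R <= n ->
  c / n <= cprob C h y.
Proof.
move=> c0 yc cw n0 cn; rewrite /choice_prob.
have S0 : 0 < \sum_(z <- cand C h) weight beta h z.
  by apply: sum_weight_gt0; apply/fset0Pn; exists y.
rewrite ler_pdivlMr// mulrAC ler_pdivrMr// mulr_sumr.
rewrite big_seq (le_trans (ler_sum _ cw))// -big_seq big_const_seq count_predT.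
rewrite iter_addr_0 -[leLHS]mulr_natr ler_wpM2l//; exact/ltW/weight_gt0.
Qed.

End Operator.

(** * Iterates of the transition operator *)

Section Iterates.
Variables (R : realType) (d m : nat) (beta : R).
Implicit Types (C B A : config d) (f g : config d -> R).

Local Notation Pop := (@Pop R d m beta).
Local Notation step := (@step_rel R d m).

Lemma iter_Pop_le (Q : config d -> Prop) n C f g :
  (forall A B, Q A -> step A B -> Q B) -> (forall B, Q B -> f B <= g B) -> Q C ->
  iter n Pop f C <= iter n Pop g C.
Proof.
move=> Qs fg; elim: n C => [|n IH] C QC; first exact: fg.
by apply: Pop_le => B CB; apply: IH; exact: Qs CB.
Qed.

Lemma iter_Pop_ge0 n C f : (forall B, 0 <= f B) -> 0 <= iter n Pop f C.
Proof. by move=> f0; elim: n C => //= n IH C; exact: Pop_ge0. Qed.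

Lemma iter_PopD n C f g :
  iter n Pop (fun B => f B + g B) C = iter n Pop f C + iter n Pop g C.
Proof.
by elim: n C => //= n IH C; rewrite -PopD; congr (Pop _ _); apply/funext.
Qed.

Lemma iter_PopB n C f g :
  iter n Pop (fun B => f B - g B) C = iter n Pop f C - iter n Pop g C.
Proof.
by elim: n C => //= n IH C; rewrite -PopB; congr (Pop _ _); apply/funext.
Qed.

Lemma iter_PopZ n C c f : iter n Pop (fun B => c * f B) C = c * iter n Pop f C.
Proof.
by elim: n C => //= n IH C; rewrite -PopZ; congr (Pop _ _); apply/funext.
Qed.

Lemma iter_Pop_sum n C (I : Type) (r : seq I) (F : I -> config d -> R) :
  iter n Pop (fun B => \sum_(i <- r) F i B) C = \sum_(i <- r) iter n Pop (F i) C.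
Proof.
by elim: n C => //= n IH C; rewrite -Pop_sum; congr (Pop _ _); apply/funext.
Qed.

Lemma Pop_iter_comm n C A (G : config d -> config d -> R) :
  Pop (fun X => iter n Pop (G X) A) C = iter n Pop (fun Y => Pop (G^~ Y) C) A.
Proof.
elim: n A => //= n IH A; rewrite Pop_comm; congr (Pop _ _).
by apply/funext => Y; exact: IH.
Qed.

Lemma iter_Pop_comm k n C A (G : config d -> config d -> R) :
  iter k Pop (fun X => iter n Pop (G X) A) C =
  iter n Pop (fun Y => iter k Pop (G^~ Y) C) A.
Proof.
elim: k C => //= k IH C.
rewrite -Pop_iter_comm; congr (Pop _ _).
by apply/funext => X; exact: IH.
Qed.

Lemma iter_Pop_cst_le n C c : 0 <= c -> iter n Pop (fun=> c) C <= c.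
Proof.
by move=> c0; elim: n C => //= n IH C; exact: Pop_le_cst.
Qed.

Lemma iter_Pop_le_cst (Q : config d -> Prop) n C f c : 0 <= c ->
  (forall A B, Q A -> step A B -> Q B) -> (forall B, Q B -> f B <= c) -> Q C ->
  iter n Pop f C <= c.
Proof.
by move=> c0 Qs fc QC; rewrite (le_trans (iter_Pop_le n Qs fc QC))// iter_Pop_cst_le.
Qed.

End Iterates.

(** * Lower bounds for one step *)

Section StepBounds.
Variables (R : realType) (d m : nat) (beta : R).
Implicit Types (C B A : config d) (f g : config d -> R).
Hypothesis beta0 : 0 <= beta.
Local Notation Pop := (@Pop R d m beta).
Local Notation step := (@step_rel R d m).
Local Notation cand := (candidates R m).

Lemma candidates_near C h y : legal R m C h -> (size h < 2 * m)%N -> y \in cand C h ->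
  exists2 a, a \in C & enorm R (y - a) <= m%:R.
Proof.
move=> hl h2; have [hm|hm] := ltnP (size h) m.
  rewrite candidates_act// !inE => /andP[_ yC]; exists y => //.
  by rewrite subrr enorm0.
rewrite candidates_dep// => /in_boundary[_ [z /(current_near hl hm)[a aC za] yz]].
exists a; first by move: aC; rewrite !inE => /andP[].
rewrite (le_trans (enorm_triangle R z _ _))// yz addrC.
rewrite (le_trans (lerD za (lexx 1)))// natr1 ler_nat.
by move: h2; rewrite mul2n -addnn; clear -hm; lia.
Qed.

Lemma legal_mem_near C h : legal R m C h -> (size h <= 2 * m)%N ->
  forall x, x \in h -> exists2 a, a \in C & enorm R (x - a) <= m%:R.
Proof.
elim=> // {}h y hl IH yc; rewrite size_rcons => h2 x.
rewrite mem_rcons inE => /predU1P[->|]; last exact/IH/ltnW.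
exact: candidates_near yc.
Qed.

(** The last chosen site and any candidate lie within [m] of [C], hence at distance at most [D + 2m]
    from each other; the extra 1 keeps the value above the cut-off of the kernel. *)
Definition reach (D : R) := 1 + D + 2 * m%:R.

Lemma reach_ge1 D : 0 <= D -> 1 <= reach D.
Proof. by move=> D0; rewrite /reach -addrA lerDl addr_ge0. Qed.

Lemma weight_lb C h y D : legal R m C h -> (size h < 2 * m)%N -> y \in cand C h ->
  diam R C <= D -> reach D `^ (- beta) <= weight beta h y.
Proof.
move=> hl h2 yc CD; have D0 : 0 <= D by apply: le_trans CD; exact: diam_ge0.
case: h hl h2 yc => [|x h] hl h2 yc /=.
  by rewrite powRN invf_le1 ?powR_gt0 ?(lt_le_trans _ (reach_ge1 D0))//
    -(powRr0 (reach D)) ler_powR ?reach_ge1.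
apply: phi_lb => //; first exact: reach_ge1.
have [a aC ya] := candidates_near hl h2 yc.
have [b bC xb] := legal_mem_near hl (ltnW h2) (mem_last x h).
rewrite (le_trans (enorm_triangle R b _ _))//.
rewrite (le_trans (lerD xb (enorm_triangle R a _ _)))//.
rewrite -enormB in ya.
by have := enorm_le_diam R bC aC; rewrite /reach; lra.
Qed.

Lemma weight_le1 (h : seq (lattice d)) (y : lattice d) : weight beta h y <= 1.
Proof. by case: h => //= x h; exact: phi_le1. Qed.

Definition choice_lb (N : nat) (D : R) := reach D `^ (- beta) / (N * 3 ^ d)%:R.

Lemma cprob_lb C h y N D : (m < N)%N -> #|` C| = N -> diam R C <= D ->
  legal R m C h -> (size h < 2 * m)%N -> y \in cand C h ->
  choice_lb N D <= choice_prob m beta C h y.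
Proof.
move=> mN CN CD hl h2 yc; apply: cprob_ge => //; first exact: powR_ge0.
- move=> z zc; apply: (@le_trans _ _ (reach D `^ (- beta))).
    by rewrite ler_piMr ?powR_ge0 ?weight_le1.
  exact: weight_lb yc CD.
- by rewrite ltr0n muln_gt0 (leq_trans _ mN)// expn_gt0.
- rewrite ler_nat -CN; apply: card_candidates => //; first by rewrite CN.
  exact: ltnW.
Qed.

Definition step_lb N D := choice_lb N D ^+ (2 * m).

Lemma choice_lb_gt0 N D : (0 < N)%N -> 0 <= D -> 0 < choice_lb N D.
Proof.
move=> N0 D0; rewrite divr_gt0 ?powR_gt0 ?(lt_le_trans _ (reach_ge1 D0))//.
by rewrite ltr0n muln_gt0 N0 expn_gt0.
Qed.

Lemma step_lb_gt0 N D : (0 < N)%N -> 0 <= D -> 0 < step_lb N D.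
Proof. by move=> N0 D0; rewrite exprn_gt0// choice_lb_gt0. Qed.

Lemma legal_rconsP C h y : legal R m C (rcons h y) -> legal R m C h /\ y \in cand C h.
Proof.
move=> H; inversion H as [e|h' y' hl yc e]; first by case: (h) e.
by move/rcons_inj: e => [<- <-].
Qed.

Lemma legal_catl C h1 h2 : legal R m C (h1 ++ h2) -> legal R m C h1.
Proof.
elim/last_ind: h2 => [|h2 y IH]; first by rewrite cats0.
by rewrite -rcons_cat => /legal_rconsP[/IH].
Qed.

Lemma op_lb C h h' N D f : (m < N)%N -> #|` C| = N -> diam R C <= D ->
  legal R m C (h ++ h') -> (size (h ++ h') <= 2 * m)%N -> (forall B, 0 <= f B) ->
  choice_lb N D ^+ size h' * f (current m C (h ++ h')) <= op m beta C (size h') h f.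
Proof.
move=> mN CN CD + + f0; have D0 : 0 <= D by apply: le_trans CD; exact: diam_ge0.
have c0 : 0 <= choice_lb N D by apply/ltW/choice_lb_gt0 => //; exact: leq_trans mN.
elim: h' h => [|y h' IH] h hl hs; first by rewrite cats0 expr0 mul1r.
rewrite -cat_rcons in hl hs *.
have [h1 yc] := legal_rconsP (legal_catl hl).
rewrite [size (y :: h')]/= (le_trans _ (op_choice _ _ yc f0))//.
rewrite exprS -mulrA ler_pM// ?mulr_ge0 ?exprn_ge0 ?f0//; last exact: IH.
apply: cprob_lb yc => //; apply: leq_trans hs.
by rewrite size_cat size_rcons addSn ltnS leq_addr.
Qed.

Lemma Pop_lb C B N D f : (m < N)%N -> #|` C| = N -> diam R C <= D ->
  step C B -> (forall B, 0 <= f B) -> step_lb N D * f B <= Pop f C.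
Proof.
move=> mN CN CD [h [hl hs ->]] f0.
by have := op_lb (h := [::]) mN CN CD hl; rewrite hs; apply.
Qed.

Fixpoint attachable (Y : config d) (s : seq (lattice d)) : Prop :=
  if s is x :: s' then x \in boundary R Y /\ attachable (x |` Y)%fset s' else True.

Lemma legal_take C t : uniq t -> {subset t <= C} -> (size t <= m)%N -> legal R m C t.
Proof.
elim/last_ind: t => [|t y IH]; first by move=> *; exact: legal_nil.
rewrite rcons_uniq size_rcons => /andP[yt ut] tC tm.
apply: legal_rcons.
  by apply: IH => //; [move=> z zt; apply: tC; rewrite mem_rcons inE zt orbT|exact: ltnW].
by rewrite candidates_act// !inE yt tC// mem_rcons mem_head.
Qed.

Lemma legal_attach C h s : legal R m C h -> (m <= size h)%N ->
  attachable (current m C h) s ->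
  legal R m C (h ++ s) /\ current m C (h ++ s) = (current m C h `|` [fset x in s])%fset.
Proof.
elim: s h => [|y s IH] h hl hm /=.
  by move=> _; rewrite cats0; split=> //; apply/fsetP => z; rewrite !inE orbF.
move=> [yb ys]; rewrite -cat_rcons.
have yl : legal R m C (rcons h y) by apply: legal_rcons => //; rewrite candidates_dep.
have [||lh ch] := IH _ yl; first by rewrite size_rcons leqW.
  by rewrite current_rcons.
by split=> //; rewrite ch current_rcons//; apply/fsetP => z; rewrite !inE orbA; case: (z == y); rewrite ?orbT.
Qed.

(** Activation has no geometric constraint: any [m] sites, in any order, can be removed with
    positive probability. So an admissible move is given by the part kept and a list that can be
    attached to it. *)
Lemma step_rebuild C Y s : (Y `<=` C)%fset -> #|` C| = (#|` Y| + m)%N ->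
  size s = m -> attachable Y s -> step C (Y `|` [fset x in s])%fset.
Proof.
move=> YC CY sm Ys; pose t : seq (lattice d) := enum_fset (C `\` Y)%fset.
have st : size t = m by rewrite -[size t]/(#|` (C `\` Y)%fset|) cardfsDS// CY addKn.
have tl : legal R m C t.
  apply: legal_take; [exact: fset_uniq| |by rewrite st].
  by move=> z; rewrite -[z \in t]/(z \in (C `\` Y)%fset) inE => /andP[].
have ct : current m C t = Y.
  rewrite current_act ?st//; apply/fsetP => z; rewrite in_fsetD.
  have -> : (z \in [fset x in t]%fset) = (z \in C) && (z \notin Y).
    by rewrite inE -[LHS]/(z \in (C `\` Y)%fset) inE andbC.
  have [zY|zY] := boolP (z \in Y); first by rewrite (fsubsetP YC _ zY).
  by case: (z \in C).
have [||hl hc] := legal_attach tl (s := s); rewrite ?st ?ct//.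
exists (t ++ s); split=> //; first by rewrite size_cat st sm mul2n addnn.
by rewrite hc ct.
Qed.

End StepBounds.

(** * Invariance under translations *)

Section Shift.
Variables (R : realType) (d m : nat) (beta : R).
Implicit Types (C B A : config d) (f g : config d -> R).
Implicit Types (u x y z : lattice d) (h : seq (lattice d)).
Local Notation Pop := (@Pop R d m beta).

Definition translate (u : lattice d) A : config d := [fset (x + u)%R | x in A]%fset.

Lemma mem_translate u A x : (x + u \in translate u A) = (x \in A).
Proof. exact: (mem_imfset _ _ (@addIr _ u)). Qed.

Lemma translateP u A x : (x \in translate u A) = (x - u \in A).
Proof. by rewrite -[in LHS](subrK u x) mem_translate. Qed.

Lemma boundary_translate u A : boundary R (translate u A) = translate u (boundary R A).
Proof.
apply/fsetP => x; rewrite translateP; apply/idP/idP => /in_boundary[xA [y yA xy]];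
  apply/in_boundary.
- rewrite translateP in xA; rewrite translateP in yA; split=> //; exists (y - u) => //.
  by rewrite -xy opprB addrA subrK.
- rewrite translateP; split=> //; exists (y + u); first by rewrite mem_translate.
  by rewrite -xy opprD addrA addrAC.
Qed.

Let mapD (u : lattice d) (h : seq (lattice d)) := [seq x + u | x <- h].

Lemma mem_mapD (u : lattice d) (h : seq (lattice d)) (x : lattice d) :
  (x \in [seq y + u | y <- h]) = (x - u \in h).
Proof. by rewrite -[in LHS](subrK u x) (mem_map (@addIr _ u)). Qed.

Lemma current_translate u C h : current m (translate u C) (mapD u h) = translate u (current m C h).
Proof.
apply/fsetP => x; rewrite translateP /current -map_take -map_drop !inE.
by rewrite !mem_mapD translateP.
Qed.

Lemma candidates_translate u C h :
  candidates R m (translate u C) (mapD u h) = translate u (candidates R m C h).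
Proof.
rewrite /candidates size_map current_translate boundary_translate.
case: ifP => // _; apply/fsetP => x; rewrite translateP !inE mem_mapD translateP//.
Qed.

Lemma weight_translate u h x : weight beta (mapD u h) (x + u) = weight beta h x.
Proof.
case: h => [|y h]; first by [].
rewrite /weight /mapD map_cons (last_map (fun z => z + u)).
exact: phi_translate.
Qed.

Lemma op_translate u C k h f :
  op m beta (translate u C) k (mapD u h) f = op m beta C k h (fun B => f (translate u B)).
Proof.
elim: k h => [|k IH] h /=; first by rewrite current_translate.
rewrite candidates_translate big_imfset/=; last by move=> x y _ _; exact: addIr.
apply: eq_bigr => y _.
rewrite -IH /mapD map_rcons; congr (_ * _).
rewrite /choice_prob candidates_translate weight_translate big_imfset/=; last by move=> x z _ _; exact: addIr.
by congr (_ / _); apply: eq_bigr => z _; rewrite weight_translate.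
Qed.

Lemma Pop_translate u C f : Pop f (translate u C) = Pop (fun B => f (translate u B)) C.
Proof. exact: (op_translate u C (2 * m) [::]). Qed.

Lemma iter_Pop_translate u n C f :
  iter n Pop f (translate u C) = iter n Pop (fun B => f (translate u B)) C.
Proof.
elim: n C => //= n IH C; rewrite Pop_translate; congr (Pop _ _).
by apply/funext.
Qed.

End Shift.

(** * Decay of a lazy walk in three directions *)

Lemma bin_half n k : ('C(n, k) <= 'C(n, n./2))%N.
Proof.
have low j : (j <= n./2 -> 'C(n, n./2 - j) <= 'C(n, n./2))%N.
  elim: j => [|j IH] jn; first by rewrite subn0.
  rewrite (leq_trans _ (IH (ltnW jn)))//.
  have -> : (n./2 - j = (n./2 - j.+1).+1)%N by lia.
  set i := (_ - _)%N.
  have := mul_bin_left n i; have : (i.+1 <= n - i)%N by rewrite /i; lia.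
  move=> le1 e; rewrite -(leq_pmul2l (ltn0Sn i)) e leq_mul2r le1 orbT//.
have [kn|nk] := leqP k n./2.
  by have := low (n./2 - k)%N (leq_subr _ _); rewrite subKn.
have [kn|/bin_small->//] := leqP k n.
rewrite -(bin_sub kn); have := low (n./2 - (n - k))%N (leq_subr _ _).
by rewrite subKn//; lia.
Qed.

(** An integer form of [C(2p, p) <= 4^p / sqrt (2p + 1)]. The induction closes because consecutive
    central coefficients have ratio [2 (2p + 1) / (p + 1)] and [(2p + 1) (2p + 3) <= (2p + 2)^2]. *)
Lemma central_bin p : ('C(p.*2, p) ^ 2 * (p.*2).+1 <= 16 ^ p)%N.
Proof.
elim: p => [|p IH]; first by [].
have e : (p.+1 * 'C((p.+1).*2, p.+1) = (p.*2).+1 * 'C(p.*2, p) * 2)%N.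
  have e1 := mul_bin_diag (p.*2).+2 p.
  have e2 : (p.+1 * 'C((p.*2).+1, p) = (p.*2).+1 * 'C(p.*2, p))%N.
    by have /= -> := mul_bin_down (p.*2).+1 p; congr (_ * _)%N; lia.
  rewrite doubleS -e1 /= (_ : (p.*2).+2 = p.+1 * 2)%N; last lia.
  by rewrite -e2; lia.
have P0 : (0 < p.+1 ^ 2)%N by rewrite expn_gt0.
rewrite -(leq_pmul2l P0) mulnA -expnMn e !expnMn.
rewrite (expnS 16 p); set c := ('C(_, _) ^ 2)%N in IH *; set q := (16 ^ p)%N in IH *.
have H : (c * (p.*2).+1 * ((p.*2).+1 * (p.+1).*2.+1 * 2 ^ 2) <=
  q * (p.+1 ^ 2 * 16))%N.
  by apply: leq_mul => //; rewrite doubleS; nia.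
apply: (leq_trans (leq_trans (eq_leq _) H) (eq_leq _)); rewrite -?muln2; ring.
Qed.

Lemma bin_sqr n k : ('C(n, k) ^ 2 * n.+1 <= 4 ^ n)%N.
Proof.
apply: (@leq_trans ('C(n, n./2) ^ 2 * n.+1)).
  by rewrite leq_mul2r leq_sqr bin_half orbT.
have e16 p : (16 ^ p = 4 ^ p.*2)%N by rewrite -mul2n expnM.
have [n2|n2] := boolP (odd n); last first.
  have en : n = (n./2).*2 by rewrite even_halfK.
  by move: (n./2) en => p ->; rewrite -e16 central_bin.
have en : n = (n./2).*2.+1 by have := odd_double_half n; rewrite n2.
move: (n./2) en => p en.
(* For odd [n = 2p + 1] the middle coefficient is half of the central one of order [2p + 2]. *)
have e : ('C(p.+1.*2, p.+1) = 'C(n, p) * 2)%N.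
  rewrite doubleS binS -en muln2 -addnn; congr (_ + _)%N.
  by rewrite -bin_sub ?en; [congr ('C(_, _)); lia|lia].
have := central_bin p.+1; rewrite e e16 doubleS -en.
by rewrite [in X in (_ <= X)%N]expnS expnMn; lia.
Qed.

Section Sums.
Variable R : realType.

Definition powseq (s : R) (i : nat) : R := i.+1%:R `^ (- s).

Lemma powseq_ge0 s i : 0 <= powseq s i.
Proof. exact: powR_ge0. Qed.

Lemma powseq_le s i j : 0 <= s -> (i <= j)%N -> powseq s j <= powseq s i.
Proof.
move=> s0 ij; rewrite /powseq !powRN lef_pV2 ?posrE ?powR_gt0 ?ltr0n//.
by rewrite ge0_ler_powR ?nnegrE// ler_nat.
Qed.

Lemma sum_expr_le (r : R) k : 0 <= r < 1 -> \sum_(j < k) r ^+ j <= (1 - r)^-1.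
Proof.
move=> /andP[r0 r1]; rewrite -[leRHS]mul1r ler_pdivlMr ?subr_gt0// mulrC.
by rewrite -opprB mulNr -subrX1 opprB gerBl exprn_ge0.
Qed.

(* By Cauchy condensation. *)
Lemma powseq_sum s : 1 < s -> exists K : R, forall n, \sum_(i < n) powseq s i <= K.
Proof.
move=> s1; have s0 : 0 <= s by rewrite (le_trans _ (ltW s1)).
pose r : R := 2 `^ (1 - s).
have r0 : 0 < r by rewrite powR_gt0.
have r1 : r < 1.
  rewrite /r -opprB powRN invf_lt1 ?powR_gt0//.
  have e : (1 : R) `^ (s - 1) = 1 by rewrite powR1.
  by rewrite -[X in X < _]e gt0_ltr_powR ?subr_gt0 ?nnegrE// ltr1n.
have blk k : \sum_(i < 2 ^ k - 1) powseq s i <= \sum_(j < k) r ^+ j.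
  elim: k => [|k IH]; first by rewrite expn0 subnn !big_ord0.
  have k0 : (0 < 2 ^ k)%N by rewrite expn_gt0.
  rewrite big_ord_recr/= (_ : (2 ^ k.+1 - 1 = (2 ^ k - 1) + 2 ^ k)%N); last first.
    by rewrite expnS; lia.
  rewrite big_split_ord/= lerD//.
  apply: (@le_trans _ _ (\sum_(i < 2 ^ k) powseq s (2 ^ k - 1))).
    by apply: ler_sum => i _; apply: powseq_le => //; rewrite leq_addr.
  rewrite sumr_const card_ord /powseq -subSn// subSS subn0 -[leLHS]mulr_natl.
  have k0' : (2 ^ k)%:R != 0 :> R by rewrite pnatr_eq0 -lt0n.
  rewrite -[X in X * _](powRr1 (ler0n R _)) -powRD ?k0' ?implybT//.
  have -> : (2 ^ k)%:R = (2 : R) `^ k%:R by rewrite powR_mulrn// natrX.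
  by rewrite -powRrM mulrC powRrM powR_mulrn// ltW.
exists (1 - r)^-1 => n.
apply: le_trans (sum_expr_le n (_ : 0 <= r < 1)); last by rewrite ltW.
apply: le_trans (blk n).
have n2 : (n <= 2 ^ n - 1)%N by have := ltn_expl n (ltnSn 1); lia.
rewrite -(subnK n2) addnC big_split_ord/= lerDl.
by apply: sumr_ge0 => i _; exact: powseq_ge0.
Qed.

(** A window of consecutive integers takes each absolute value at most twice, once on each side of
    0. *)
Lemma sum_absz (psi : nat -> R) (K : R) : (forall i, 0 <= psi i) ->
  {homo psi : i j / (i <= j)%N >-> j <= i} ->
  (forall n, \sum_(i < n) psi i <= K) ->
  forall (t : int) n, \sum_(k < n) psi (absz (t + k%:Z)) <= 2 * K.
Proof.
move=> psi0 psid psiK.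
have K0 : 0 <= K by apply: le_trans (psiK 0%N); rewrite big_ord0.
have neg u n : \sum_(k < n) psi (absz (- (u%:Z) + k%:Z)) <=
   \sum_(i < u) psi i.+1 + \sum_(i < n) psi i.
  elim: u n => [|u IH] n.
    rewrite big_ord0 add0r; apply: ler_sum => i _; apply: psid; lia.
  case: n => [|n]; first by rewrite !big_ord0 addr0 sumr_ge0.
  have -> : \sum_(k < n.+1) psi (absz (- u.+1%:Z + k%:Z)) =
      psi u.+1 + \sum_(k < n) psi (absz (- u%:Z + k%:Z)).
    rewrite big_ord_recl; congr (psi _ + _); first by rewrite /=; lia.
    by apply: eq_bigr => i _; congr (psi _); rewrite lift0; lia.
  rewrite [X in _ <= X + _]big_ord_recr [X in _ <= _ + X]big_ord_recr/=.
  by have := IH n; have := psi0 n; lra.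
case=> u n; rewrite mulrDl mul1r.
  rewrite (@le_trans _ _ K)// ?lerDl// (le_trans _ (psiK n))//.
  by apply: ler_sum => i _; apply: psid; lia.
rewrite NegzE (le_trans (neg _ _))// lerD//.
by rewrite (le_trans _ (psiK u.+2))// [leRHS]big_ord_recl/= lerDr.
Qed.

(** The transition operator of the lazy walk on the integers that stays or moves up by 1, with
    probability one half each. *)
Definition ups (f : int -> R) (t : int) : R := (f t + f (t + 1)) / 2.

Lemma iter_ups n f t :
  iter n ups f t = \sum_(k < n.+1) 'C(n, k)%:R / 2 ^+ n * f (t + k%:Z).
Proof.
elim: n t => [|n IH] t; first by rewrite big_ord1 bin0 expr0 divr1 mul1r addr0.
have tS (i : nat) : t + i.+1%:Z = t + 1 + i%:Z by lia.
rewrite iterS {1}/ups !IH [RHS]big_ord_recl bin0 addr0.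
under [in RHS]eq_bigr => i _ do
  rewrite lift0 binS natrD 2!mulrDl exprS invfM tS.
rewrite big_split/= [X in _ = _ + (X + _)]big_ord_recr/= bin_small// !mul0r addr0.
rewrite [X in (X + _) / 2]big_ord_recl bin0 addr0 !mulrDl -addrA.
congr (_ + _); first by rewrite exprS invfM; ring.
rewrite !mulr_suml; congr (_ + _); apply: eq_bigr => i _; last by ring.
by rewrite lift0 tS; ring.
Qed.

End Sums.

Section Heat.
Variable R : realType.

Definition decay (a : R) (t : int) : R := (maxn (absz t) 1)%:R `^ (- a).

Lemma decay_ge0 a t : 0 <= decay a t.
Proof. exact: powR_ge0. Qed.

Lemma bin_le_powseq n k : 'C(n, k)%:R / 2 ^+ n <= powseq (2^-1 : R) n.
Proof.
have P2 : (0 : R) < 2 ^+ n by rewrite exprn_gt0.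
rewrite -(@ler_pXn2r _ 2)// ?nnegrE ?powseq_ge0 ?divr_ge0 ?(ltW P2)//.
rewrite /powseq powRN powR12_sqrt// exprVn sqr_sqrtr//.
rewrite expr_div_n ler_pdivrMr ?exprn_gt0// mulrC ler_pdivlMr ?ltr0n//.
by rewrite exprAC -natrX -natrX -natrX -natrM ler_nat; exact: bin_sqr.
Qed.

Lemma iter_ups_cst n (c : R) t : iter n (@ups R) (fun=> c) t = c.
Proof. by elim: n t => //= n IH t; rewrite /ups !IH; field. Qed.

Lemma iter_ups_ge0 n (f : int -> R) t : (forall s, 0 <= f s) -> 0 <= iter n (@ups R) f t.
Proof.
by move=> f0; elim: n t => //= n IH t; rewrite /ups divr_ge0// addr_ge0.
Qed.

(** Above the level [D], [f = f^(1-p) f^p <= D^(1-p) f^p]. A kernel that may fail to be summable is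
    thus replaced by a constant plus a summable power. *)
Lemma truncation (D f p : R) : 0 < D -> 0 <= f -> 1 <= p ->
  f <= D + D `^ (1 - p) * f `^ p.
Proof.
move=> D0 f0 p1; have [fD|fD] := leP f D.
  by rewrite (le_trans fD)// lerDl mulr_ge0 ?powR_ge0.
have fp : 0 < f by apply: lt_trans fD.
rewrite ler_wpDl ?(ltW D0)// -{1}(mulr_powRB1 f0 (lt_le_trans ltr01 p1)) mulrCA.
rewrite -[leLHS]mulr1 ler_wpM2l// -opprB powRN mulrC ler_pdivlMr ?powR_gt0//.
by rewrite mul1r ge0_ler_powR ?nnegrE ?subr_ge0 ?(ltW D0) ?(ltW fD).
Qed.

(** The kernel [decay a] need not be summable, but its power [p] is. Truncation at [D] costs [D],
    and the rest costs [D^(1-p)] times the largest binomial weight, of order [n^(-1/2)]; the two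
    balance at [D = (n + 1)^(-1/(2p))]. *)
Lemma heat1 (a p : R) : 0 <= a -> 1 < p -> 1 < a * p ->
  exists2 C : R, 0 <= C &
    forall n t, iter n (@ups R) (decay a) t <= C * powseq (p^-1 / 2) n.
Proof.
move=> a0 p1 ap1; have p0 : 0 < p by apply: lt_trans p1.
have [K HK] := powseq_sum ap1.
pose psi i : R := (maxn i 1)%:R `^ (- (a * p)).
have psi0 i : 0 <= psi i by exact: powR_ge0.
have max0 i : (0 : R) < (maxn i 1)%:R by rewrite ltr0n leq_max orbT.
have psid : {homo psi : i j / (i <= j)%N >-> j <= i}.
  move=> i j ij; rewrite /psi !powRN lef_pV2 ?posrE ?powR_gt0//.
  rewrite ge0_ler_powR ?nnegrE ?(ltW (max0 _)) ?mulr_ge0 ?(ltW p0)// ler_nat.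
  by rewrite geq_max !leq_max ij orbT.
have K0 : 0 <= K by apply: le_trans (HK 0%N); rewrite big_ord0.
have psiK n : \sum_(i < n) psi i <= 1 + K.
  case: n => [|k]; first by rewrite big_ord0 addr_ge0.
  rewrite big_ord_recl lerD//; first by rewrite /psi powR1.
have C0 : 0 <= 1 + 2 * (1 + K) by lra.
(* The 1 accounts for the level [D], and [2 (1 + K)] for the sum of [psi] over both half-lines. *)
exists (1 + 2 * (1 + K)) => // n t; set D := powseq _ n.
have N0 : (0 : R) < n.+1%:R by rewrite ltr0n.
have D0 : 0 < D by rewrite powR_gt0.
have fD s : decay a s <= D + D `^ (1 - p) * psi (absz s).
  rewrite (le_trans (truncation D0 (decay_ge0 a s) (ltW p1)))//.
  by rewrite /decay -powRrM mulNr.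
rewrite iter_ups.
have w0 k : (0 : R) <= 'C(n, k)%:R / 2 ^+ n by rewrite divr_ge0// exprn_ge0.
apply: (@le_trans _ _ (\sum_(k < n.+1) ('C(n, k)%:R / 2 ^+ n * D +
   D `^ (1 - p) * (powseq 2^-1 n * psi (absz (t + k%:Z)))))).
  apply: ler_sum => k _.
  rewrite (le_trans (ler_wpM2l (w0 k) (fD _)))// mulrDr lerD2l mulrCA.
  by rewrite ler_wpM2l ?powR_ge0// ler_wpM2r// bin_le_powseq.
rewrite big_split/= -(iter_ups n (fun=> D) t) iter_ups_cst -mulr_sumr -mulr_sumr.
rewrite mulrDl mul1r lerD2l.
have e : D `^ (1 - p) * powseq 2^-1 n = D.
  rewrite /D /powseq -powRrM -powRD; last by rewrite (gt_eqF N0) implybT.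
  by congr (_ `^ _); field; rewrite gt_eqF.
rewrite mulrA e mulrC ler_wpM2r ?(ltW D0)//.
exact: (sum_absz psi0 psid psiK).
Qed.

End Heat.

(** The powers [p] of a kernel of exponent [b / 3] must be summable, and [3 / (2p)] must exceed 1.
    The witness is the middle of the interval from [max 1 (3 / b)] to [3 / 2], which is not empty as
    [b > 2]. *)
Lemma exponent_choice (R : realType) (b : R) : 2 < b ->
  exists p : R, [/\ 1 < p, p < 3 / 2 & 1 < b / 3 * p].
Proof.
move=> b2; exists ((3 / 2 + Num.max 1 (3 / b)) / 2).
have b0 : 0 < b by lra.
have m1 : 1 <= Num.max 1 (3 / b) by rewrite le_max lexx.
have mb : 3 / b <= Num.max 1 (3 / b) by rewrite le_max lexx orbT.
have m2 : Num.max 1 (3 / b) < 3 / 2.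
  have h1 : (1 : R) < 3 / 2 by lra.
  by rewrite gt_max h1 ltr_pdivrMr//; lra.
set M := Num.max _ _ in m1 mb m2 *; split; [lra|lra|].
have : 3 / b < (3 / 2 + M) / 2 by lra.
by rewrite ltr_pdivrMr//; lra.
Qed.

Section Heat3.
Variables (R : realType) (d : nat) (beta : R).
Hypotheses (d3 : (3 <= d)%N) (beta2 : 2 < beta).
Implicit Types x y z : lattice d.

Definition ax3 (i : 'I_3) : 'I_d := widen_ord d3 i.

(* The number of k < j with k congruent to i modulo 3. *)
Definition cnt (j : nat) (i : 'I_3) : nat := ((j + 2 - i) %/ 3)%N.

Definition dir (j : nat) : 'I_3 := inord (j %% 3).

Lemma cntS j i : cnt j.+1 i = (cnt j i + (i == dir j))%N.
Proof.
rewrite /cnt /dir -val_eqE/= inordK ?ltn_mod//.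
by case: i => i /= i3; case: eqP => /=; lia.
Qed.

(** For [j = 0], a product that dominates [phi]; for larger [j], its mean after [x] has made [j]
    lazy unit steps, along the first three axes in turn. *)
Definition heat (j : nat) y x : R :=
  \prod_(i < 3) iter (cnt j i) (@ups R) (decay (beta / 3)) ((x - y) ord0 (ax3 i)).

Lemma heat_ge0 j y x : 0 <= heat j y x.
Proof.
by apply: prodr_ge0 => i _; apply: iter_ups_ge0 => s; exact: decay_ge0.
Qed.

Lemma heatS j y x :
  heat j.+1 y x = (heat j y x + heat j y (x + axis (ax3 (dir j)))) / 2.
Proof.
have hD k z : heat k y z = iter (cnt k (dir j)) (@ups R) (decay (beta / 3))
    ((z - y) ord0 (ax3 (dir j))) * \prod_(i < 3 | i != dir j)
    iter (cnt k i) (@ups R) (decay (beta / 3)) ((z - y) ord0 (ax3 i)).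
  by rewrite /heat (bigD1 (dir j)).
rewrite !hD cntS eqxx addn1 iterS {1}/ups.
set P := \prod_(i < 3 | i != dir j) iter (cnt j i) _ _ ((x - y) _ _).
have -> : \prod_(i < 3 | i != dir j) iter (cnt j.+1 i) (@ups R) (decay (beta / 3))
   ((x - y) ord0 (ax3 i)) = P.
  by apply: eq_bigr => i ij; rewrite cntS (negbTE ij) addn0.
have -> : \prod_(i < 3 | i != dir j) iter (cnt j i) (@ups R) (decay (beta / 3))
   ((x + axis (ax3 (dir j)) - y) ord0 (ax3 i)) = P.
  apply: eq_bigr => i ij; rewrite addrAC [in LHS]mxE axisE.
  have -> : (ax3 i == ax3 (dir j)) = (i == dir j) by [].
  by rewrite (negbTE ij) addr0.
rewrite addrAC [(_ + axis _) ord0 _]mxE axisE eqxx.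
by ring.
Qed.

(** Each of the three factors [far^(-beta / 3)] is compared with a different coordinate. *)
Lemma phi_le_heat y x : phi beta x y <= heat 0 y x.
Proof.
have e : phi beta x y = \prod_(i < 3) far R x y `^ (- (beta / 3)).
  rewrite prodr_const card_ord -powR_mulrn ?powR_ge0// -powRrM phiE.
  by congr (_ `^ _); field.
rewrite e /heat; apply: ler_prod => i _; rewrite powR_ge0/=.
rewrite (_ : cnt 0 i = 0%N); last by have := ltn_ord i; rewrite /cnt; lia.
rewrite /= /decay !powRN lef_pV2 ?posrE ?powR_gt0 ?far_gt0 ?ltr0n ?leq_max ?orbT//.
have b3 : 0 <= beta / 3 by rewrite divr_ge0// ltW// (lt_trans _ beta2).
rewrite ge0_ler_powR ?nnegrE ?(ltW (far_gt0 _ _ _))//.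
rewrite natr_max ge_max; apply/andP; split; last exact: far_ge1.
rewrite (le_trans _ (_ : enorm R (x - y) <= _)) ?le_max ?lexx//.
rewrite (le_trans _ (coord_le_enorm R (x - y) (ax3 i)))//.
by rewrite -[X in X <= _]/((Posz _)%:~R) abszE intr_norm.
Qed.

(** Each axis has received at least [j %/ 3] steps, and the three one-dimensional bounds multiply to
    the exponent [3 / (2p) > 1]. *)
Lemma heat_summable : exists2 e : nat -> R,
  (forall j y x, heat j y x <= e j) &
  exists K : R, forall n, \sum_(j < n) e j <= K.
Proof.
have b0 : 0 < beta by apply: lt_trans beta2.
have [p [p1 p3 bp]] := exponent_choice beta2.
have p0 : 0 < p by apply: lt_trans p1.
have [C C0 HC] := heat1 (divr_ge0 (ltW b0) (ler0n _ 3)) p1 bp.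
pose g := 3 * (p^-1 / 2).
have g1 : 1 < g.
  by rewrite /g mulrA ltr_pdivlMr// mul1r ltr_pdivlMr//; lra.
have [K HK] := powseq_sum g1.
have g0 : 0 <= p^-1 / 2 by rewrite divr_ge0// invr_ge0 ltW.
exists (fun j => C ^+ 3 * powseq g (j %/ 3)).
  move=> j y x; apply: (@le_trans _ _ (\prod_(i < 3) (C * powseq (p^-1 / 2) (j %/ 3)))).
    apply: ler_prod => i _; rewrite iter_ups_ge0/=; last by move=> s; exact: decay_ge0.
    rewrite (le_trans (HC _ _))// ler_wpM2l// powseq_le//.
    apply: leq_div2r; have := ltn_ord i; lia.
  rewrite prodr_const card_ord exprMn ler_wpM2l ?exprn_ge0//.
  by rewrite /powseq -powR_mulrn ?powR_ge0// -powRrM /g mulNr mulrC.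
exists (C ^+ 3 * (3 * K)) => n; rewrite -mulr_sumr ler_wpM2l ?exprn_ge0//.
have sum3 q : \sum_(j < q * 3) powseq g (j %/ 3) = 3 * \sum_(j < q) powseq g j.
  elim: q => [|q IH]; first by rewrite mul0n !big_ord0 mulr0.
  rewrite mulSn addnC big_split_ord/= IH [in RHS]big_ord_recr/= mulrDr; congr (_ + _).
  rewrite (eq_bigr (fun=> powseq g q)); first by rewrite sumr_const card_ord mulr_natl.
  by move=> i _; rewrite /= divnMDl// divn_small ?addn0.
apply: (@le_trans _ _ (\sum_(j < n * 3) powseq g (j %/ 3))).
  rewrite (_ : n * 3 = n + n * 2)%N; last lia.
  by rewrite big_split_ord/= lerDl sumr_ge0// => i _; exact: powseq_ge0.
by rewrite sum3 ler_wpM2l.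
Qed.

End Heat3.

(** * Clusters of m+1 sites *)

Section Delays.
Variable R : realType.

(** [T a] is the tail of the series from [a] on. Only its recurrence, sign and limit are kept, which
    is the form the inductions on [delay] use. *)
Lemma tails (e : nat -> R) (K : R) : (forall i, 0 <= e i) ->
  (forall n, \sum_(i < n) e i <= K) ->
  exists T : nat -> R, [/\ forall a, T a = e a + T a.+1, forall a, 0 <= T a &
    forall eps, 0 < eps -> exists a0, forall a, (a0 <= a)%N -> T a <= eps].
Proof.
move=> e0 eK; pose s n := \sum_(i < n) e i.
have sle n k : s n <= s (n + k)%N.
  by rewrite /s big_split_ord/= lerDl sumr_ge0.
have ub n : s n <= sup (range s).
  by apply: ub_le_sup; [exists K => _ [i _ <-]; exact: eK|exists n].
exists (fun a => sup (range s) - s a); split.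
- by move=> a; rewrite /s [in RHS]big_ord_recr/=; ring.
- by move=> a; rewrite subr_ge0.
- move=> eps eps0.
  have [_ [a0 _ <-] h] : exists2 x, range s x & sup (range s) - eps < x.
    apply: sup_adherent => //; split; first by exists (s 0%N), 0%N.
    by exists K => _ [i _ <-]; exact: eK.
  exists a0 => a a0a; have := sle a0 (a - a0)%N; rewrite subnKC//.
  by move=> h2; rewrite lerBlDr -lerBlDl (le_trans (ltW h)).
Qed.

(* The expectation of c at a counter started at a, n steps later, if each step
   increments it with probability alpha. *)
Fixpoint delay (alpha : R) (c : nat -> R) (n a : nat) : R :=
  if n is n'.+1 then alpha * delay alpha c n' a.+1 + (1 - alpha) * delay alpha c n' a
  else c a.

(** The counter stays at each value for a geometric time of mean [1 / alpha], so each term of [c] is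
    counted [1 / alpha] times on average. *)
Lemma delay_sum alpha c T n a : 0 < alpha <= 1 -> (forall a, T a = c a + T a.+1) ->
  (forall a, 0 <= T a) -> \sum_(i < n) delay alpha c i a <= T a / alpha.
Proof.
move=> /andP[al0 al1] Tc T0; elim: n a => [|n IH] a.
  by rewrite big_ord0 divr_ge0// ltW.
rewrite big_ord_recl/=.
under eq_bigr => i _ do rewrite add0n.
rewrite big_split/= -!mulr_sumr.
have al1' : 0 <= 1 - alpha by rewrite subr_ge0.
rewrite (le_trans (lerD (lexx _) (lerD (ler_wpM2l (ltW al0) (IH a.+1)) (ler_wpM2l al1' (IH a)))))//.
by rewrite (Tc a) le_eqVlt; apply/orP; left; apply/eqP; field; rewrite gt_eqF.
Qed.

Lemma delay_ge0 alpha c n a : 0 <= alpha <= 1 -> (forall a, 0 <= c a) -> 0 <= delay alpha c n a.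
Proof.
move=> /andP[al0 al1] c0; elim: n a => //= n IH a.
by rewrite addr_ge0// mulr_ge0// subr_ge0.
Qed.

(** [T a] is at most [eps / 2 + B / 2^a], and the mean of [2^(-a)] loses a factor [1 - alpha / 2] at
    each step. *)
Lemma delay_cvg0 alpha T eps : 0 < alpha <= 1 -> (forall a, 0 <= T a) ->
  (exists M, forall a, T a <= M) ->
  (forall eps, 0 < eps -> exists a0, forall a, (a0 <= a)%N -> T a <= eps) ->
  0 < eps -> exists n, delay alpha T n 0 <= eps.
Proof.
move=> /andP[al0 al1] T0 [M TM] Tcvg eps0.
have [a0 Ta0] := Tcvg _ (divr_gt0 eps0 (ltr0n R 2)).
have M0 : 0 <= M by apply: le_trans (TM 0%N).
pose B := M * 2 ^+ a0; pose r := 1 - alpha / 2.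
have B0 : 0 <= B by rewrite mulr_ge0// exprn_ge0.
have r0 : 0 < r by rewrite /r; lra.
have r1 : r < 1 by rewrite /r; lra.
have bnd n a : delay alpha T n a <= eps / 2 + B / 2 ^+ a * r ^+ n.
  elim: n a => [|n IH] a /=.
    rewrite mulr1; have [a0a|aa0] := leqP a0 a.
      by rewrite (le_trans (Ta0 _ a0a))// lerDl divr_ge0// exprn_ge0.
    rewrite (le_trans (TM a))// (@le_trans _ _ (B / 2 ^+ a))//; last first.
      by rewrite lerDr divr_ge0// ltW.
    by rewrite ler_pdivlMr ?exprn_gt0// ler_wpM2l// ler_weXn2l ?ler1n// ltnW.
  have al1' : 0 <= 1 - alpha by rewrite subr_ge0.
  rewrite (le_trans (lerD (ler_wpM2l (ltW al0) (IH a.+1)) (ler_wpM2l al1' (IH a))))//.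
  rewrite le_eqVlt; apply/orP; left; apply/eqP.
  by rewrite !exprS /r; field; rewrite expf_neq0.
have cv : ((eps / 2 + B * r ^+ n) @[n --> \oo] --> (eps / 2 + B * 0))%classic.
  apply: cvgD; first exact: cvg_cst.
  by apply: cvgMr; apply: cvg_expr; rewrite ger0_norm// ltW.
have : (\forall n \near \oo, eps / 2 + B * r ^+ n < eps)%classic.
  by apply: (cvgr_lt _ cv); rewrite mulr0 addr0; lra.
move=> [n _ /(_ n (leqnn n)) h]; exists n.
by rewrite (le_trans (bnd n 0%N))// expr0 divr1 ltW.
Qed.

End Delays.

Section Rays.
Variables (R : realType) (d : nat).
Implicit Types (i : 'I_d) (p x : lattice d) (Y : config d).

Fixpoint ray i p n : seq (lattice d) :=
  if n is n'.+1 then (p + axis i) :: ray i (p + axis i) n' else [::].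

Lemma size_ray i p n : size (ray i p n) = n.
Proof. by elim: n p => //= n IH p; rewrite IH. Qed.

Lemma rayP i p n x : reflect (exists2 k, (0 < k <= n)%N & x = p + k%:Z *: axis i)
  (x \in ray i p n).
Proof.
elim: n p x => [|n IH] p x /=; first by apply: (iffP idP) => // -[[]].
rewrite inE; apply: (iffP orP) => [[/eqP->|/IH[k kn ->]]|[[|[|k]] // kn ->]].
- by exists 1%N => //; rewrite scale1r.
- exists k.+1; first by lia.
  by rewrite -addrA intS scalerDl scale1r.
- by left; rewrite scale1r.
- right;apply/IH; exists k.+1; first by lia.
  by rewrite -addrA [in LHS]intS scalerDl scale1r.
Qed.

Lemma attachable_ray i p n Y : p \in Y -> (forall x, x \in ray i p n -> x \notin Y) ->
  attachable R Y (ray i p n).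
Proof.
elim: n p Y => //= n IH p Y pY dis; split.
  apply/in_boundary; split; first by apply: dis; rewrite mem_head.
  by exists p => //; rewrite addrC addKr -[axis i]scale1r enorm_axis normr1.
apply: IH; first by rewrite !inE eqxx.
move=> x xr; rewrite !inE negb_or dis ?inE ?xr ?orbT// andbT.
have /rayP[[//|k] _ ->] := xr.
rewrite -subr_eq0 addrAC subrr add0r; apply/eqP => /rowP/(_ i).
by rewrite !mxE !eqxx; lia.
Qed.

End Rays.

Section SmallCluster.
Variables (R : realType) (d m : nat) (beta : R).
Hypotheses (d3 : (3 <= d)%N) (m0 : (0 < m)%N) (beta2 : 2 < beta).
Implicit Types (A B : config d) (x y : lattice d).
Local Notation Pop := (@Pop R d m beta).
Local Notation step := (@step_rel R d m).

Definition small A := #|` A| = m.+1 /\ diam R A <= 2 * m%:R.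

(* Only one site survives the activation, and everything is redeposited near it. *)
Lemma small_step A B : #|` A| = m.+1 -> step A B -> small B.
Proof.
move=> Am AB; split; first by rewrite (card_step _ AB) ?Am.
case: AB => h [hl hs ->].
have hm : (m <= size h)%N by rewrite hs mul2n -addnn leq_addr.
have th : size (take m h) = m by rewrite size_takel.
have tl : legal R m A (take m h) by apply: legal_catl (_ : legal R m A (take m h ++ drop m h)); rewrite cat_take_drop.
have := card_current_act tl; rewrite th => /(_ (leqnn m)).
rewrite current_act ?th// Am subSnn => /eqP/cardfs1P[a Aa].
apply: diam_le => // x y.
move=> /(current_near hl hm)[b]; rewrite Aa inE => /eqP -> xa.
move=> /(current_near hl hm)[c]; rewrite Aa inE => /eqP -> ya.
rewrite -enormB in ya; move: xa ya; rewrite hs mul2n -addnn addnK => xa ya.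
by rewrite (le_trans (enorm_triangle R a _ _))//; lra.
Qed.

Lemma in_fseq (T : choiceType) (s : seq T) (x : T) :
  (x \in [fset y in s]%fset) = (x \in s).
Proof. by rewrite inE. Qed.

Lemma ray_translate i (p u : lattice d) n : ray i (p + u) n = [seq x + u | x <- ray i p n].
Proof. by elim: n p => //= n IH p; rewrite addrAC IH. Qed.

(** Keeping a single site [r] and attaching a segment to it produces either
    [r - e, ..., r + (m-1) e], for [e = axis i], or the same segment moved by [e]. Both are reached
    whatever the shape of [A], which yields the lazy unit shift. *)
Lemma small_minorization A i : small A ->
  exists S, [/\ small S, step A S & step A (translate (axis i) S)].
Proof.
move=> [Am _]; have [r rA] : exists r, r \in A by apply/fset0Pn; rewrite -cardfs_gt0 Am.
pose S := ([fset r] `|` [fset x in (r - axis i)%R :: ray i r m.-1])%fset.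
have rS : ([fset r] `<=` A)%fset by rewrite fsub1set.
have cA : #|` A| = (#|` [fset r]%fset| + m)%N by rewrite cardfs1 Am.
have AS : step A S.
  apply: step_rebuild => //=; first by rewrite size_ray prednK.
  split.
    apply/in_boundary; rewrite inE; split.
      rewrite -subr_eq0 addrAC subrr add0r oppr_eq0; apply/eqP => /rowP/(_ i).
      by rewrite axisE eqxx mxE.
    exists r; rewrite ?inE// addrAC subrr add0r enormN -[axis i]scale1r.
    by rewrite enorm_axis normr1.
  apply: attachable_ray; first by rewrite !inE eqxx orbT.
  move=> x /rayP[[//|k] _ ->]; rewrite !inE negb_or; apply/andP; split.
    apply/eqP => /addrI/rowP/(_ i); rewrite mxE axisE eqxx mulr1 mxE axisE eqxx.
    by lia.
  rewrite -subr_eq0 addrAC subrr add0r; apply/eqP => /rowP/(_ i).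
  by rewrite !mxE !eqxx; lia.
exists S; split=> //; first exact: small_step AS.
have -> : translate (axis i) S = ([fset r] `|` [fset x in ray i r m])%fset.
  have rm : ray i r m = (r + axis i) :: ray i (r + axis i) m.-1.
    by rewrite -{1}(prednK m0).
  apply/fsetP => x; rewrite translateP !in_fsetU !in_fset1 !in_fseq rm !inE.
  rewrite ray_translate mem_mapD (subr_eq x) (inj_eq (@addIr _ (- axis i))).
  by rewrite orbCA.
apply: step_rebuild => //; first by rewrite size_ray.
apply: attachable_ray; first by rewrite inE.
move=> x /rayP[[//|k] _ ->]; rewrite !inE.
rewrite -subr_eq0 addrAC subrr add0r; apply/eqP => /rowP/(_ i).
by rewrite !mxE !eqxx; lia.
Qed.

Lemma step_lb_le1 N (D : R) : (0 < N)%N -> 0 <= D -> step_lb d m beta N D <= 1.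
Proof.
move=> N0 D0; have b0 : 0 <= beta by rewrite ltW// (lt_trans _ beta2).
have r1 := reach_ge1 m D0; have r0 : 0 < reach m D by apply: lt_le_trans r1.
apply: exprn_ile1; first exact/ltW/choice_lb_gt0.
have n1 : (1 : R) <= (N * 3 ^ d)%:R by rewrite ler1n muln_gt0 N0 expn_gt0.
rewrite ler_pdivrMr ?(lt_le_trans ltr01 n1)// mul1r (le_trans _ n1)//.
by rewrite powRN invf_le1 ?powR_gt0// -(powRr0 (reach m D)) ler_powR.
Qed.

Let eta := step_lb d m beta m.+1 (2 * m%:R).

Definition heat_sum j y A : R := \sum_(x <- A) heat beta d3 j y x.

Lemma heat_sum_translate j y A :
  heat_sum j.+1 y A = (heat_sum j y A + heat_sum j y (translate (axis (ax3 d3 (dir j))) A)) / 2.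
Proof.
rewrite /heat_sum big_imfset/=; last by move=> ? ? _ _; exact: addIr.
rewrite -big_split/= mulr_suml; apply: eq_bigr => x _; exact: heatS.
Qed.

(** With weight [eta] the step is compared with a fair choice between [S] and its shift; by
    translation invariance this average is one more lazy step of the kernel, so the index [j] rises
    by 1. Otherwise nothing is gained. Hence the recursion of [delay]. *)
Lemma heat_iter (e : nat -> R) : (forall j y x, heat beta d3 j y x <= e j) ->
  forall n j y A, small A ->
  iter n Pop (heat_sum j y) A <= delay eta (fun j => m.+1%:R * e j) n j.
Proof.
move=> he; elim=> [|n IH] j y A sA /=.
  rewrite /heat_sum (le_trans (ler_sum _ (fun x _ => he j y x)))//.
  by rewrite big_const_seq count_predT iter_addr_0 mulr_natl -[size _]/(#|` A|) (proj1 sA).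
have b0 : 0 <= beta by rewrite ltW// (lt_trans _ beta2).
have [Am AD] := sA.
have eta0 : 0 <= eta by apply/ltW/step_lb_gt0 => //; rewrite mulr_ge0.
have [S [sS AS AS']] := small_minorization (ax3 d3 (dir j)) sA.
set S' := translate _ S in AS'.
have sS' : small S' by exact: small_step AS'.
set g := iter n Pop (heat_sum j y); set b := delay eta _ n j.
(* [Pop_lb] requires a function that is non-negative everywhere, while the induction hypothesis only
   covers small clusters. *)
pose G B := if `[< small B >] then b - g B else 0.
have G0 B : 0 <= G B.
  by rewrite /G; case: asboolP => // sB; rewrite subr_ge0; exact: IH.
have Gsmall B : small B -> G B = b - g B by rewrite /G => sB; rewrite asboolT.
have PG : Pop G A = b - Pop g A.
  rewrite -[X in X - _](@Pop_cst R d m beta A b) ?Am//; last exact: leq_trans d3.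
  by rewrite -PopB; apply: eq_Pop => B AB; rewrite Gsmall//; exact: small_step AB.
have lbS := Pop_lb b0 (ltnSn m) Am AD AS G0.
have lbS' := Pop_lb b0 (ltnSn m) Am AD AS' G0.
rewrite -/eta Gsmall// in lbS; rewrite -/eta Gsmall// in lbS'.
have gS : (g S + g S') / 2 <= delay eta (fun j => m.+1%:R * e j) n j.+1.
  rewrite (le_trans _ (IH j.+1 y S sS))//.
  have -> : heat_sum j.+1 y = fun B => 2^-1 * (heat_sum j y B +
      heat_sum j y (translate (axis (ax3 d3 (dir j))) B)).
    by apply/funext => B; rewrite heat_sum_translate mulrC.
  by rewrite iter_PopZ iter_PopD /g /S' iter_Pop_translate mulrC.
(* The half-sum of the lower bounds at [S] and [S'] gives [Pop g A <= eta (g S + g S') / 2 + (1 -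
   eta) b]. *)
have := ler_wpM2l eta0 gS; rewrite -/b => gS'.
by rewrite PG in lbS lbS'; lra.
Qed.

Lemma small_decay : exists c : nat -> R, [/\ forall n, 0 <= c n,
  exists K : R, forall n, \sum_(i < n) c i <= K &
  forall n y A, small A -> iter n Pop (fun B => \sum_(x <- B) phi beta x y) A <= c n].
Proof.
have b0 : 0 <= beta by rewrite ltW// (lt_trans _ beta2).
have [e he [K eK]] := heat_summable d3 beta2.
have e0 j : 0 <= e j by apply: le_trans (he j 0 0); exact: heat_ge0.
have D0 : 0 <= 2 * m%:R :> R by rewrite mulr_ge0.
have eta0 : 0 < eta by exact: step_lb_gt0.
have eta1 : eta <= 1 by exact: step_lb_le1.
pose e' j := m.+1%:R * e j.
have e'0 j : 0 <= e' j by rewrite mulr_ge0.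
have [|T [Te T0 _]] := @tails R e' (m.+1%:R * K) e'0.
  by move=> n; rewrite /e' -mulr_sumr ler_wpM2l.
exists (fun n => delay eta e' n 0); split.
- by move=> n; apply: delay_ge0 => //; rewrite (ltW eta0).
- by exists (T 0%N / eta) => n; apply: delay_sum => //; rewrite eta0.
- move=> n y A sA; rewrite (le_trans _ (heat_iter he n 0 y sA))//.
  apply: (@iter_Pop_le R d m beta (fun=> True)) => // B _.
  by apply: ler_sum => x _; exact: phi_le_heat.
Qed.

End SmallCluster.

(** * At most 2m+1 sites *)

Section Pieces.
Variables (R : realType) (d m : nat) (beta : R).
Hypotheses (d0 : (0 < d)%N) (m0 : (0 < m)%N) (beta0 : 0 <= beta).
Implicit Types (C : config d) (s : seq (lattice d)) (ss : seq (seq (lattice d))).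
Local Notation Pop := (@Pop R d m beta).
Local Notation cur := (current m).

(* A connected set listed so that removing the head never disconnects it. *)
Fixpoint piece s : bool :=
  if s is x :: s' then
    (s' == [::]) || has (fun y => enorm R (x - y) == 1) s' && piece s'
  else true.

(** The lists need not be the connected components: a component may be split and empty lists are
    allowed, so [k] is only an upper bound on the number of pieces. *)
Definition pieces (k : nat) C : Prop :=
  exists ss, [/\ (size ss <= k)%N, all piece ss & perm_eq (flatten ss) C].

Lemma piece_behead x s : piece (x :: s) -> piece s.
Proof. by move=> /= /predU1P[->|/andP[]]. Qed.

Lemma piece_diam s x y : piece s -> x \in s -> y \in s ->
  enorm R (x - y) <= (size s)%:R.
Proof.
elim: s x y => // z s IH x y zs.
have ps := piece_behead zs.
have key w : w \in s -> enorm R (z - w) <= (size s).+1%:R.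
  move=> ws; move: zs => /= /predU1P[s0|/andP[/hasP[v vs /eqP zv] _]].
    by rewrite s0 in ws.
  rewrite (le_trans (enorm_triangle R v _ _))// zv -natr1 addrC lerD2r.
  exact: IH.
rewrite !inE => /predU1P[->|xs] /predU1P[->|ys] /=.
- by rewrite subrr enorm0.
- exact: key.
- by rewrite enormB key.
- by rewrite (le_trans (IH _ _ ps xs ys))// ler_nat.
Qed.

Lemma mem_piece ss x : x \in flatten ss ->
  exists s, [/\ s \in ss, x \in s & perm_eq ss (s :: rem s ss)].
Proof. by move=> /flattenP[s sss xs]; exists s; split=> //; exact: perm_to_rem. Qed.

Lemma perm_fsetU1 C y : y \notin C -> perm_eq (y |` C)%fset (y :: C).
Proof.
move=> yC; apply: uniq_perm; first exact: fset_uniq.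
  by rewrite /= yC fset_uniq.
by move=> z; rewrite in_fset1U inE.
Qed.

Lemma perm_fsetD1 C y : y \in C -> perm_eq C (y :: (C `\ y)%fset).
Proof.
move=> yC; rewrite -{1}(fsetD1K yC); apply: perm_fsetU1.
by rewrite in_fsetD1 eqxx.
Qed.

(** The new site is put at the head of a piece that it touches: it would be the first to be removed,
    so the order stays valid. *)
Lemma pieces_add k C y : pieces k C -> y \in boundary R C -> pieces k (y |` C)%fset.
Proof.
move=> [ss [sk pss sC]] /in_boundary[yC [z zC yz]].
have [s [sss zs ssE]] : exists s, [/\ s \in ss, z \in s & perm_eq ss (s :: rem s ss)].
  by apply: mem_piece; rewrite (perm_mem sC).
exists ((y :: s) :: rem s ss); split.
- by rewrite (leq_trans _ sk)// (perm_size ssE).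
- rewrite (perm_all _ ssE) /= in pss; move: pss => /andP[ps prem].
  by rewrite /= prem ps andbT; apply/orP; right; rewrite andbT; apply/hasP; exists z => //; exact/eqP.
- rewrite perm_sym (perm_trans (perm_fsetU1 yC))//= perm_cons perm_sym.
  by rewrite -(permPr sC) perm_sym (perm_flatten ssE).
Qed.

Lemma pieces_size k C : (#|` C| <= k)%N -> pieces k C.
Proof.
move=> Ck; exists [seq [:: x] | x <- C]; split; first by rewrite size_map.
  by apply/allP => _ /mapP[x _ ->].
by rewrite flatten_seq1.
Qed.

Lemma pieces_diam C : pieces 1 C -> diam R C <= #|` C|%:R.
Proof.
move=> [ss [s1 pss sC]]; apply: diam_le => // x y xC yC.
rewrite -(perm_size sC); rewrite -(perm_mem sC) in xC; rewrite -(perm_mem sC) in yC.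
case: ss s1 pss sC xC yC => [|s [|//]] //= _ /andP[ps _] _.
by rewrite cats0; exact: piece_diam.
Qed.

Definition ispieces k C : R := `[< pieces k C >]%:R.

Lemma ispieces_ge0 k C : 0 <= ispieces k C.
Proof. exact: ler0n. Qed.

Lemma op_pieces C h k J : (m < #|` C|)%N -> legal R m C h -> (m <= size h)%N ->
  pieces J (cur C h) -> 1 <= op m beta C k h (ispieces J).
Proof.
move=> Cm; elim: k h => [|k IH] h hl hm pJ /=; first by rewrite /ispieces asboolT.
have c0 := candidates_neq0 d0 Cm hl.
rewrite -(sum_cprob beta c0) big_seq [leRHS]big_seq; apply: ler_sum => y yc.
rewrite -[leLHS]mulr1 ler_wpM2l ?cprob_ge0//; apply: IH.
- exact: legal_rcons.
- by rewrite size_rcons leqW.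
- by rewrite current_rcons//; apply: pieces_add => //; rewrite -candidates_dep.
Qed.

(** A lower bound for each choice on the way to a merge: the wanted site weighs at least
    [(1 + N)^(-beta)] times any other candidate, and there are at most [N * 3 ^ d] of them. *)
Let kappa (N : nat) : R := (1 + N%:R) `^ (- beta) / (N * 3 ^ d)%:R.

Lemma cur_rcons_act C h y : (size h < m)%N -> cur C (rcons h y) = (cur C h `\ y)%fset.
Proof.
move=> hm; rewrite !current_act ?size_rcons// 1?ltnW//.
apply/fsetP => z; rewrite in_fsetD1 !in_fsetD !in_fseq mem_rcons inE negb_or.
by rewrite andbA.
Qed.

(** [s0] is the rest of the piece being activated and [k] the number of activations left. Either
    [s0] will be used up in time, or a piece has already been lost and what remains of [s0] may
    stay. Only ratios of weights intervene, so the bound ignores the distances between pieces. *)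
Lemma op_merge N J C k h x s0 ss : (m < N)%N -> #|` C| = N ->
  legal R m C (x :: h) -> (size (x :: h) + k = m)%N ->
  all piece (s0 :: ss) -> perm_eq (s0 ++ flatten ss) (cur C (x :: h)) ->
  (forall y, y \in s0 -> enorm R (last x h - y) <= N%:R) ->
  ((size s0 <= k) && (size ss <= J) || (size ss < J))%N ->
  kappa N ^+ k <= op m beta C (k + m) (x :: h) (ispieces J).
Proof.
move=> mN CN; have N0 : (0 < N)%N by apply: leq_ltn_trans mN.
have Cm : (m < #|` C|)%N by rewrite CN.
have kap0 : 0 <= kappa N by rewrite divr_ge0 ?powR_ge0.
elim: k h s0 ss => [|k IH] h s0 ss hl hk pss sC xs0 sJ.
  rewrite expr0; apply: op_pieces => //; first by rewrite -hk addn0.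
  have [s0e|s0e] := eqVneq s0 [::].
    exists ss; split.
    - by move: sJ; rewrite s0e leq0n /= => /orP[//|/ltnW].
    - by case/andP: pss.
    - by move: sC; rewrite s0e.
  exists (s0 :: ss); split=> //=.
  by move: sJ; rewrite leqn0 size_eq0 (negbTE s0e).
have hm : (size (x :: h) < m)%N by rewrite -hk addnS ltnS leq_addr.
have candE : candidates R m C (x :: h) = cur C (x :: h).
  by rewrite candidates_act// current_act// ltnW.
have sizeC : (size (s0 ++ flatten ss) <= N)%N.
  rewrite (perm_size sC) -CN fsubset_leq_card// current_act 1?ltnW//.
  exact: fsubsetDl.
have next y s ss' : perm_eq ((y :: s) ++ flatten ss') (s0 ++ flatten ss) ->
    all piece ((y :: s) :: ss') ->
    ((size s <= k) && (size ss' <= J) || (size ss' < J))%N ->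
    (forall z, z \in cur C (x :: h) ->
      (1 + N%:R) `^ (- beta) * phi beta (last x h) z <= phi beta (last x h) y) ->
    kappa N ^+ k.+1 <= op m beta C (k.+1 + m) (x :: h) (ispieces J).
  move=> perm pss' size' near.
  have yC : y \in cur C (x :: h) by rewrite -(perm_mem sC) -(perm_mem perm) mem_head.
  have yc : y \in candidates R m C (x :: h) by rewrite candE.
  rewrite addSn (le_trans _ (op_choice beta (k + m) yc (@ispieces_ge0 J)))//.
  rewrite exprS ler_pM// ?exprn_ge0//.
    apply: cprob_ge => //.
    - by move=> z; rewrite candE; exact: near.
    - by rewrite ltr0n muln_gt0 N0 expn_gt0.
    - rewrite ler_nat -CN; apply: card_candidates => //.
      by rewrite (leq_trans (ltnW hm))// leq_pmull.
  apply: (IH _ s ss').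
  - by rewrite -rcons_cons; apply: legal_rcons.
  - by rewrite -hk -rcons_cons size_rcons; lia.
  - by move: pss' => /= /andP[/(@piece_behead y s) -> ->].
  - rewrite -rcons_cons cur_rcons_act// -(perm_cons y).
    by rewrite -(permPr (perm_fsetD1 yC)) -(permPr sC).
  - move=> z zs; rewrite last_rcons.
    have ps : piece (y :: s) by case/andP: pss'.
    rewrite (le_trans (piece_diam ps (mem_head _ _) _)) ?inE ?zs ?orbT// ler_nat.
    by rewrite (leq_trans _ sizeC)// -(perm_size perm) size_cat leq_addr.
  - exact: size'.
have N1 : 1 <= 1 + N%:R :> R by rewrite lerDl.
case: s0 => [|y s] in pss sC xs0 sJ sizeC next *; last first.
  apply: (next y s ss) => //.
  move=> z _; rewrite (@le_trans _ _ ((1 + N%:R) `^ (- beta)))//.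
    by rewrite ler_piMr ?powR_ge0 ?phi_le1.
  apply: phi_lb => //; rewrite (le_trans (xs0 y (mem_head _ _)))//.
  by rewrite lerDr.
have curN0 := current_neq0 Cm hl.
(* The piece is exhausted: take a site [z] of largest weight among those left. *)
have [z zC zmax] : exists2 z, z \in enum_fset (cur C (x :: h)) &
    forall b, b \in enum_fset (cur C (x :: h)) ->
      (phi beta (last x h) b <= phi beta (last x h) z)%O.
  apply: seq_argmax; apply: contra_neq curN0 => e0.
  by apply/fsetP => w; rewrite in_fset0 -[w \in cur _ _]/(w \in enum_fset _) e0.
have [s [sss zs ssE]] : exists s, [/\ s \in ss, z \in s & perm_eq ss (s :: rem s ss)].
  by apply: mem_piece; rewrite -[flatten ss]/([::] ++ flatten ss) (perm_mem sC).
have permss := perm_flatten ssE.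
have psrem : all piece (s :: rem s ss).
  by rewrite -(perm_all _ ssE); case/andP: pss.
have sszrem := perm_size ssE.
case: s => [//|y s] in sss zs ssE permss psrem sszrem *.
(* The activation continues at the head [y] of the piece of [z], not at [z] itself, so that this
   piece stays connected; [y] is within [N] of [z], which costs at most a factor [(1 + N)^beta]. *)
apply: (next y s (rem (y :: s) ss)).
- by rewrite perm_sym.
- exact: psrem.
- apply/orP; right; rewrite /= in sszrem; rewrite -sszrem.
  by move: sJ => /= /orP[//|/ltnW].
- move=> w wC; have ps : piece (y :: s) by case/andP: psrem.
  have zy : enorm R (z - y) <= N%:R.
    rewrite (le_trans (piece_diam ps zs (mem_head _ _)))// ler_nat.
    by rewrite (leq_trans _ sizeC)// (perm_size permss) size_cat leq_addr.
  rewrite powRN mulrC ler_pdivrMr ?powR_gt0 ?(lt_le_trans ltr01 N1)//.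
  rewrite (le_trans (zmax w wC))// mulrC.
  by apply: phi_near.
Qed.

Lemma Pop_merge N J C : (m < N <= (2 * m).+1)%N -> #|` C| = N -> (0 < J)%N ->
  pieces J.+1 C -> ~ pieces J C -> kappa N ^+ m <= Pop (ispieces J) C.
Proof.
move=> /andP[mN N2] CN J0 [ss [sJ pss sC]] npJ.
have Cm : (m < #|` C|)%N by rewrite CN.
have N0 : (0 < N)%N by apply: leq_ltn_trans mN.
have ssJ : size ss = J.+1.
  apply/eqP; rewrite eqn_leq sJ ltnNge; apply/negP => sJ'.
  by apply: npJ; exists ss.
(* Two pieces of at least [m + 1] sites would make [2m + 2]: this is where the threshold enters. *)
have [s sss sm] : exists2 s, s \in ss & (size s <= m)%N.
  have [/hasP//|/hasPn big] := boolP (has (fun s => size s <= m)%N ss).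
  have : (size ss * m.+1 <= size (flatten ss))%N.
    elim: ss big {ssJ sC pss sJ} => //= s ss IH big.
    rewrite mulSn size_cat leq_add//.
      by have := big s (mem_head _ _); rewrite -ltnNge.
    by apply: IH => t tss; apply: big; rewrite inE tss orbT.
  rewrite ssJ (perm_size sC) -[size _]/(#|` C|) CN => h.
  have : (2 * m.+1 <= J.+1 * m.+1)%N by rewrite leq_mul2r ltnS J0 orbT.
  by lia.
have ssE := perm_to_rem sss.
have permss := perm_flatten ssE; have sszrem := perm_size ssE.
have psrem : all piece (s :: rem s ss) by rewrite -(perm_all _ ssE).
have sremJ : size (rem s ss) = J by move: sszrem; rewrite /= ssJ => -[].
case: s => [|x s] in sss sm ssE permss sszrem psrem sremJ *.
  case: npJ; exists (rem [::] ss); rewrite sremJ; split=> //.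
  by rewrite -(permPr sC) perm_sym.
have ps : piece (x :: s) by case/andP: psrem.
have xC : x \in C by rewrite -(perm_mem sC) (perm_mem permss) mem_head.
have c0 : candidates R m C [::] = C.
  by rewrite candidates_act//; apply/fsetP => z; rewrite in_fsetD in_fseq.
have xc : x \in candidates R m C [::] by rewrite c0.
have hl : legal R m C [:: x] by apply: (legal_rcons (legal_nil R m C)).
have m2 : (2 * m = (m.-1 + m).+1)%N by clear -m0; lia.
rewrite /Pop m2.
rewrite (le_trans _ (op_choice beta (m.-1 + m) xc (@ispieces_ge0 J)))//.
have kap0 : 0 <= kappa N by rewrite divr_ge0 ?powR_ge0.
rewrite -{1}(prednK m0) exprS ler_pM// ?exprn_ge0//.
  apply: cprob_ge => //.
  - move=> z _ /=; rewrite mulr1 powRN invf_le1 ?powR_gt0 ?ltr_pwDl//.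
    by rewrite -[leLHS](powRr0 (1 + N%:R)) ler_powR// lerDl.
  - by rewrite ltr0n muln_gt0 N0 expn_gt0.
  - by rewrite ler_nat -CN c0 leq_pmulr// expn_gt0.
apply: (@op_merge N J C m.-1 [::] x s (rem (x :: s) ss)) => //.
- by rewrite /= add1n prednK.
- by apply/andP; split; [exact: piece_behead ps|case/andP: psrem].
- rewrite -[[:: x]]/(rcons [::] x) cur_rcons_act// -(perm_cons x).
  have -> : cur C [::] = C.
    by rewrite current_act//; apply/fsetP => z; rewrite in_fsetD in_fseq.
  rewrite -(permPr (perm_fsetD1 xC)) -(permPr sC) perm_sym.
  exact: permss.
- move=> y ys; rewrite (le_trans (piece_diam ps (mem_head _ _) _)) ?inE ?ys ?orbT//.
  by rewrite ler_nat (leq_trans sm)// ltnW.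
- by rewrite sremJ leqnn andbT -ltnS (leq_trans sm)// prednK.
Qed.

End Pieces.

(** * A Lyapunov function *)

Section Moment.
Variables (R : realType) (d m : nat) (beta : R).
Hypotheses (d0 : (0 < d)%N) (m0 : (0 < m)%N) (beta0 : 0 < beta).
Implicit Types (C B : config d).
Local Notation Pop := (@Pop R d m beta).
Local Notation step := (@step_rel R d m).

Definition spread C : R := (1 + diam R C) `^ beta.

Lemma spread_ge1 C : 1 <= spread C.
Proof.
have D1 : 1 <= 1 + diam R C by rewrite lerDl diam_ge0.
by rewrite -[leLHS](powRr0 (1 + diam R C)) ler_powR// ltW.
Qed.

Lemma spread_ge0 C : 0 <= spread C.
Proof. exact: powR_ge0. Qed.

Lemma spread_le C r : 0 <= r -> diam R C <= r -> spread C <= (1 + r) `^ beta.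
Proof.
move=> r0 Cr; rewrite ge0_ler_powR ?nnegrE ?addr_ge0 ?diam_ge0 ?(ltW beta0)//.
by rewrite lerD2l.
Qed.

(* The weight of the configurations with many pieces exceeds that of those with
   fewer pieces, by less than what is gained from a possible merge. *)
Let theta (N : nat) (lam : R) C : R :=
  1 - \sum_(j < N) lam ^+ j.+1 * ispieces R j.+1 C.

Lemma pieces_le i j C : (i <= j)%N -> pieces R i C -> pieces R j C.
Proof. by move=> ij [ss [si pss sC]]; exists ss; split=> //; exact: leq_trans ij. Qed.

Lemma ispieces_le1 k C : ispieces R k C <= 1.
Proof. by rewrite /ispieces; case: `[< _ >]. Qed.

Lemma theta_bounds N lam C : 0 < lam <= 4^-1 -> 2^-1 <= theta N lam C <= 1.
Proof.
move=> /andP[l0 l1].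
have S0 : 0 <= \sum_(j < N) lam ^+ j.+1 * ispieces R j.+1 C.
  by apply: sumr_ge0 => j _; rewrite mulr_ge0 ?ispieces_ge0// exprn_ge0// ltW.
have S1 : \sum_(j < N) lam ^+ j.+1 * ispieces R j.+1 C <= 2^-1.
  apply: (@le_trans _ _ (lam * \sum_(j < N) lam ^+ j)).
    rewrite mulr_sumr; apply: ler_sum => j _; rewrite -exprS.
    by rewrite ler_piMr ?ispieces_le1// exprn_ge0// ltW.
  have l3 : 0 <= lam < 1 by apply/andP; split; lra.
  rewrite (le_trans (ler_wpM2l (ltW l0) (sum_expr_le N l3)))//.
  by rewrite ler_pdivrMr; lra.
by rewrite /theta; apply/andP; split; lra.
Qed.

(** Beyond [X0 = |K| / (t - 1)], with [t = s^(1 / beta)], the shift by [K] is absorbed by the factor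
    [t]; below it everything is bounded. *)
Lemma moment_growth (K s : R) : 1 < s -> exists X : R,
  forall x, 0 <= x -> (1 + x + K) `^ beta <= s * (1 + x) `^ beta + X.
Proof.
move=> s1; pose t := s `^ beta^-1.
have s0 : 0 < s by apply: lt_trans s1.
have t1 : 1 < t.
  have e : (1 : R) `^ beta^-1 = 1 by rewrite powR1.
  by rewrite -[ltLHS]e gt0_ltr_powR ?invr_gt0 ?nnegrE// ltW.
have ts : t `^ beta = s by rewrite /t -powRrM mulVf ?gt_eqF// powRr1 ?ltW.
pose X0 := `|K| / (t - 1).
have X00 : 0 <= X0 by rewrite divr_ge0// subr_ge0 ltW.
have KX : `|K| = X0 * (t - 1) by rewrite divfK// subr_eq0 gt_eqF.
exists ((1 + X0 + `|K|) `^ beta) => x x0.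
have [xX|Xx] := leP x X0.
  rewrite (@le_trans _ _ ((1 + X0 + `|K|) `^ beta))//; last by rewrite lerDr mulr_ge0 ?powR_ge0 ?ltW.
  have [neg|pos] := ltP (1 + x + K) 0.
    rewrite lt0_powR1// -[leLHS](powRr0 (1 + X0 + `|K|)) ler_powR ?(ltW beta0)//.
    by rewrite -addrA lerDl addr_ge0.
  apply: ge0_ler_powR; rewrite ?nnegrE ?(ltW beta0)//; first by rewrite !addr_ge0.
  by have := ler_norm K; lra.
have [neg|pos] := ltP (1 + x + K) 0.
  rewrite lt0_powR1// (@le_trans _ _ (s * 1))//; first by rewrite mulr1 ltW.
  rewrite ler_wpDr ?powR_ge0// ler_wpM2l ?(ltW s0)//.
  by rewrite -[leLHS](powRr0 (1 + x)) ler_powR ?(ltW beta0)// lerDl.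
rewrite ler_wpDr ?powR_ge0// -ts -powRM ?(ltW (lt_trans ltr01 t1)) ?addr_ge0//.
rewrite ge0_ler_powR ?nnegrE ?(ltW beta0)// ?mulr_ge0 ?addr_ge0 ?(ltW (lt_trans ltr01 t1))//.
have h1 : K <= X0 * (t - 1) by rewrite -KX ler_norm.
have h2 : X0 * (t - 1) <= (1 + x) * (t - 1).
  by rewrite ler_wpM2r ?subr_ge0 ?(ltW t1)//; lra.
have -> : t * (1 + x) = (1 + x) + (1 + x) * (t - 1) by ring.
by lra.
Qed.

(** If [C] has [j + 1] pieces and no fewer, [theta] is at least [1 - v], and its mean after a
    possible merge is at most [1 - 2 v]. As [spread] grows by a factor close to 1 up to an additive
    constant, the product contracts. With one piece the diameter is at most [N] and everything is
    bounded. *)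
Lemma Pop_spread_theta N : (m < N <= (2 * m).+1)%N -> exists lam rho K : R,
  [/\ 0 < lam <= 4^-1, 0 <= rho < 1, 0 <= K &
  forall C, #|` C| = N -> Pop (fun B => spread B * theta N lam B) C <=
     rho * (spread C * theta N lam C) + K].
Proof.
move=> hN; have /andP[mN N2] := hN; have N0 : (0 < N)%N by apply: leq_ltn_trans mN.
pose q : R := ((1 + N%:R) `^ (- beta) / (N * 3 ^ d)%:R) ^+ m.
have q0 : 0 < q by rewrite exprn_gt0// divr_gt0 ?powR_gt0 ?ltr_pwDl// ltr0n muln_gt0 N0 expn_gt0.
have q1 : q <= 1.
  have n1 : (1 : R) <= (N * 3 ^ d)%:R by rewrite ler1n muln_gt0 N0 expn_gt0.
  apply: exprn_ile1; first by rewrite divr_ge0 ?powR_ge0.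
  rewrite ler_pdivrMr ?(lt_le_trans ltr01 n1)// mul1r (le_trans _ n1)//.
  rewrite powRN invf_le1 ?powR_gt0 ?ltr_pwDl//.
  by rewrite -[leLHS](powRr0 (1 + N%:R)) ler_powR ?(ltW beta0)// lerDl.
(* [q] bounds the probability of a merge from below. With [lam = q / 4] the terms from [lam^(j+1)]
   on sum to at most half of [lam^j q], the gain of a merge; [v0] is the worst case over [j]. *)
pose lam := q / 4; pose v0 := lam ^+ N * q / 2.
have l0 : 0 < lam by rewrite /lam; lra.
have l1 : lam <= 4^-1 by rewrite /lam; lra.
have ll : lam <= 1 by lra.
have lN0 : 0 < lam ^+ N by rewrite exprn_gt0.
have lN1 : lam ^+ N <= 1 by apply: exprn_ile1 => //; exact: ltW.
have v00 : 0 < v0 by rewrite /v0 divr_gt0// mulr_gt0.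
have v01 : v0 <= 2^-1.
  by rewrite /v0 ler_pdivrMr// mulVf// (le_trans (ler_wpM2l (ltW lN0) q1))// mulr1.
(* [s] is a growth of [spread] that still leaves [s * rho0 = rho < 1]. *)
pose rho0 := 1 - v0; pose s := (1 + rho0) / (2 * rho0); pose rho := (1 + rho0) / 2.
have r0 : 0 < rho0 by rewrite /rho0; lra.
have s1 : 1 < s by rewrite /s ltr_pdivlMr ?mulr_gt0// mul1r /rho0; lra.
have [X HX] := moment_growth (2 * m%:R) s1.
have X0 : 0 <= `|X| by [].
pose Kc := (1 + N%:R + 2 * m%:R) `^ beta.
exists lam, rho, (`|X| + Kc); split.
- by rewrite l0.
- by rewrite /rho /rho0; apply/andP; split; lra.
- by rewrite addr_ge0 ?powR_ge0.
move=> C CN; set x := diam R C; set w := (1 + x + 2 * m%:R) `^ beta.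
have Cm : (m < #|` C|)%N by rewrite CN.
have x0 : 0 <= x by exact: diam_ge0.
have l01 : 0 < lam <= 4^-1 by rewrite l0.
have thB B := theta_bounds N B l01.
have Bw B : step C B -> spread B <= w.
  move=> CB; rewrite (le_trans (spread_le _ (diam_step CB)))//.
    by rewrite addr_ge0 ?diam_ge0// mulr_ge0.
  by rewrite addrA.
have w0 : 0 <= w by exact: powR_ge0.
have rho1 : 0 <= rho by rewrite /rho; lra.
have th0 : 0 <= theta N lam C by have /andP[h _] := thB C; lra.
have [p1|np1] := pselect (pieces R 1 C).
  rewrite (@le_trans _ _ Kc)//; last first.
    have A := mulr_ge0 rho1 (mulr_ge0 (spread_ge0 C) th0).
    by rewrite (le_trans _ (lerD A (lexx _)))// add0r lerDr.
  rewrite (@le_trans _ _ w)//; last first.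
    rewrite ge0_ler_powR ?nnegrE ?(ltW beta0) ?addr_ge0 ?mulr_ge0//.
    by rewrite lerD2r lerD2l (le_trans (pieces_diam p1))// CN.
  apply: Pop_le_cst => // B CB; rewrite (le_trans _ (Bw B CB))//.
  by have /andP[_ h] := thB B; rewrite ler_piMr ?spread_ge0.
have exj : exists j, `[< pieces R j C >].
  by exists N; apply/asboolP; apply: pieces_size; rewrite CN.
case: (ex_minnP exj) => -[|j] /asboolP pj jmin.
  by case: np1; exact: pieces_le pj.
have jN : (j < N)%N by apply: jmin; apply/asboolP; apply: pieces_size; rewrite CN.
have npj : ~ pieces R j C by move=> /asboolP/jmin; rewrite ltnn.
have j0 : (0 < j)%N by case: j pj npj {jmin jN}.
have merge := Pop_merge d0 m0 (ltW beta0) hN CN j0 pj npj; rewrite -/q in merge.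
have lj0 : 0 < lam ^+ j by rewrite exprn_gt0.
pose v := lam ^+ j * q / 2.
have vv : v0 <= v.
  rewrite /v0 /v ler_pdivlMr// divfK// ler_wpM2r ?(ltW q0)//.
  by rewrite ler_wiXn2l ?(ltW l0)// ltnW.
have v1 : v <= 2^-1.
  rewrite /v ler_pdivrMr// mulVf// (le_trans (ler_wpM2l (ltW lj0) q1))// mulr1.
  by rewrite exprn_ile1// ltW.
have thC : 1 - v <= theta N lam C.
  have [k Nk] : exists k, N = (j + k)%N by exists (N - j)%N; rewrite subnKC// ltnW.
  rewrite /theta lerD2l lerN2 Nk big_split_ord/= big1 ?add0r; last first.
    move=> i _; rewrite /ispieces asboolF ?mulr0// => /(@pieces_le i.+1 j C (ltn_ord i)).
    exact: npj.
  apply: (@le_trans _ _ (lam ^+ j * (lam * \sum_(i < k) lam ^+ i))).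
    rewrite !mulr_sumr; apply: ler_sum => i _; rewrite -exprS -exprD -addnS.
    by rewrite ler_piMr ?ispieces_le1// exprn_ge0// ltW.
  rewrite /v -mulrA ler_wpM2l ?(ltW lj0)//.
  have l3 : 0 <= lam < 1 by apply/andP; split; lra.
  rewrite (le_trans (ler_wpM2l (ltW l0) (sum_expr_le _ l3)))//.
  have qq : q * q <= q by rewrite ler_piMr// ltW.
  by rewrite ler_pdivrMr /lam; lra.
(* Of the sum in [theta], only the term gained by a merge into [j] pieces is retained. *)
have PV : Pop (fun B => spread B * theta N lam B) C <= w * (1 - 2 * v).
  apply: (@le_trans _ _ (Pop (fun B => w - w * lam ^+ j * ispieces R j B) C)).
    apply: Pop_le => B CB.
    rewrite (@le_trans _ _ (w * theta N lam B))//.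
      rewrite ler_wpM2r ?Bw//; by have /andP[h _] := thB B; lra.
    rewrite -[X in _ <= X - _]mulr1 -mulrA -mulrBr ler_wpM2l// /theta lerD2l lerN2.
    have jp : (j.-1 < N)%N by rewrite (leq_ltn_trans (leq_pred j)).
    rewrite (bigD1 (Ordinal jp))//= prednK// lerDl sumr_ge0// => i _.
    by rewrite mulr_ge0 ?ispieces_ge0// exprn_ge0// ltW.
  rewrite PopB PopZ Pop_cst// /v mulrBr mulr1 lerD2l lerN2.
  rewrite (_ : w * (2 * (lam ^+ j * q / 2)) = w * lam ^+ j * q); last by field.
  by rewrite ler_wpM2l// mulr_ge0// ltW.
have wX : w <= s * spread C + `|X|.
  by rewrite (le_trans (HX _ x0))// lerD2l ler_norm.
have sp0 := spread_ge0 C; have Kc0 : 0 <= Kc by exact: powR_ge0.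
rewrite (le_trans PV)//.
apply: (@le_trans _ _ (w * (rho0 * theta N lam C))).
  rewrite ler_wpM2l// (@le_trans _ _ (rho0 * (1 - v)))//.
    by rewrite /rho0; nra.
  by rewrite ler_wpM2l// ltW.
have rt0 : 0 <= rho0 * theta N lam C by rewrite mulr_ge0// ltW.
rewrite (le_trans (ler_wpM2r rt0 wX))// mulrDl.
have -> : s * spread C * (rho0 * theta N lam C) = rho * (spread C * theta N lam C).
  by rewrite /s /rho; field; rewrite gt_eqF.
rewrite lerD2l ler_wpDr// ler_piMr// mulr_ile1// ?(ltW r0)//.
  by rewrite /rho0; lra.
by have /andP[] := thB C.
Qed.

(** Iterating the contraction sums a geometric series; [theta] lies between 1/2 and 1 and [spread]
    is at least 1, which turns the result into a multiple of [spread C]. *)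
Lemma spread_moment N : (m < N <= (2 * m).+1)%N -> exists2 K : R, 0 < K &
  forall C n, #|` C| = N -> iter n Pop spread C <= K * spread C.
Proof.
move=> hN; have /andP[mN N2] := hN.
have [lam [rho [K [hl /andP[r0 r1] K0 PV]]]] := Pop_spread_theta hN.
have r1' : 0 < 1 - rho by rewrite subr_gt0.
have thB B := theta_bounds N B hl.
have it n C : #|` C| = N -> iter n Pop (fun B => spread B * theta N lam B) C <=
    spread C * theta N lam C + K / (1 - rho).
  elim: n C => [|n IH] C CN; first by rewrite lerDl divr_ge0// ltW.
  have Cm : (m < #|` C|)%N by rewrite CN.
  have c0 : 0 <= K / (1 - rho) by rewrite divr_ge0// ltW.
  have V0 : 0 <= spread C * theta N lam C.
    by rewrite mulr_ge0 ?spread_ge0//; have /andP[h _] := thB C; lra.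
  rewrite iterSr.
  rewrite (@le_trans _ _ (iter n Pop (fun B => rho * (spread B * theta N lam B) + K) C))//.
    apply: (@iter_Pop_le R d m beta (fun B => #|` B| = N)) => //.
    by move=> A B AN AB; rewrite -AN; apply: (card_step _ AB); rewrite AN.
  rewrite iter_PopD iter_PopZ.
  rewrite (le_trans (lerD (ler_wpM2l r0 (IH C CN)) (iter_Pop_cst_le m beta n C K0)))//.
  have e : K = K / (1 - rho) * (1 - rho) by rewrite divfK// gt_eqF.
  move: (spread C * _) V0 (K / (1 - rho)) c0 e => a a0 b b0 ->.
  by nra.
exists (2 * (1 + K / (1 - rho))).
  by rewrite mulr_gt0// ltr_pwDl// divr_ge0// ltW.
move=> C n CN; rewrite -mulrA.
apply: (@le_trans _ _ (iter n Pop (fun B => 2 * (spread B * theta N lam B)) C)).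
  apply: (@iter_Pop_le R d m beta (fun=> True)) => // B _.
  have := spread_ge0 B; have /andP[h _] := thB B; nra.
rewrite iter_PopZ ler_wpM2l// (le_trans (it n C CN))//.
rewrite mulrDl mul1r lerD//.
  by have /andP[_ h] := thB C; rewrite ler_piMr ?spread_ge0.
by rewrite ler_peMr ?spread_ge1// divr_ge0// ltW.
Qed.

End Moment.

(** * Decoupled clusters *)

Section FsetSums.
Variables (R : realType) (T : choiceType).
Implicit Types (A B C : {fset T}) (F : T -> R).

Lemma sum_fset_le A B F : (A `<=` B)%fset -> (forall x, 0 <= F x) ->
  \sum_(x <- A) F x <= \sum_(x <- B) F x.
Proof.
move=> AB F0; rewrite [leRHS](bigID (fun x => x \in A))/=.
rewrite [X in _ <= X + _](_ : _ = \sum_(x <- A) F x).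
  by rewrite lerDl sumr_ge0.
rewrite -big_filter; apply: perm_big; apply: uniq_perm; rewrite ?filter_uniq ?fset_uniq//.
by move=> x; rewrite mem_filter andbC; case: (boolP (x \in A)) => [/(fsubsetP AB)->|]; rewrite ?andbF.
Qed.

Lemma sum_fsetU_disj A B F : [disjoint A & B]%fset ->
  \sum_(x <- (A `|` B)%fset) F x = \sum_(x <- A) F x + \sum_(x <- B) F x.
Proof.
move=> AB; rewrite -big_cat/=; apply: perm_big; apply: uniq_perm; rewrite ?fset_uniq//.
  rewrite cat_uniq !fset_uniq andbT/=; apply/hasPn => x xB; apply/negP => xA.
  by have /fdisjointP/(_ x xA) := AB; rewrite xB.
by move=> x; rewrite mem_cat in_fsetU.
Qed.

Lemma sum_fsetU_le A B F : (forall x, 0 <= F x) ->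
  \sum_(x <- (A `|` B)%fset) F x <= \sum_(x <- A) F x + \sum_(x <- B) F x.
Proof.
move=> F0; have -> : (A `|` B = A `|` (B `\` A))%fset.
  by apply/fsetP => x; rewrite !inE; case: (x \in A).
rewrite sum_fsetU_disj.
  by rewrite lerD2l; apply: sum_fset_le => //; exact: fsubsetDl.
by apply/fdisjointP => x xA; rewrite !inE xA.
Qed.

Lemma ge_sum_fset A F x : (forall x, 0 <= F x) -> x \in A -> F x <= \sum_(y <- A) F y.
Proof.
by move=> F0 xA; rewrite (big_fsetD1 x)//= lerDl sumr_ge0.
Qed.

Lemma bernoulli_le (q : R) k : 0 <= q <= 1 -> 1 - k%:R * q <= (1 - q) ^+ k.
Proof.
move=> /andP[q0 q1]; elim: k => [|k IH]; first by rewrite mul0r subr0 expr0.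
rewrite exprS (le_trans _ (ler_wpM2l _ IH)) ?subr_ge0// -natr1.
have : 0 <= k%:R * q * q by rewrite !mulr_ge0.
by lra.
Qed.

End FsetSums.

(** * Effect of a foreign cluster on one step *)

Section Crossing.
Variables (R : realType) (d m : nat) (beta : R).
Hypotheses (d0 : (0 < d)%N) (m0 : (0 < m)%N) (beta0 : 0 < beta).
Implicit Types (A B C Y : config d) (h : seq (lattice d)).
Local Notation Pop := (@Pop R d m beta).
Local Notation cand := (candidates R m).
Local Notation cur := (current m).

Definition coupling A Y : R := \sum_(x <- A) \sum_(y <- Y) phi beta x y.

Lemma coupling_ge0 A Y : 0 <= coupling A Y.
Proof. by apply: sumr_ge0 => x _; apply: sumr_ge0 => y _; exact: phi_ge0. Qed.

Lemma sum_phi_ge0 x Y : 0 <= \sum_(y <- Y) phi beta x y.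
Proof. by apply: sumr_ge0 => y _; exact: phi_ge0. Qed.

Lemma sum_phi_le_coupling A Y x : x \in A -> \sum_(y <- Y) phi beta x y <= coupling A Y.
Proof. by move=> xA; apply: ge_sum_fset => // z; exact: sum_phi_ge0. Qed.

Lemma phi_le_coupling A Y x y : x \in A -> y \in Y -> phi beta x y <= coupling A Y.
Proof.
move=> xA yY; rewrite (le_trans _ (sum_phi_le_coupling Y xA))//.
by apply: (@ge_sum_fset R _ Y (phi beta x)) => // z; exact: phi_ge0.
Qed.

Lemma couplingC A Y : coupling A Y = coupling Y A.
Proof.
rewrite /coupling exchange_big/=; apply: eq_bigr => y _.
by apply: eq_bigr => x _; rewrite phiC.
Qed.

(** [(1 + 2m)^beta] bounds the normalisation from below through [spread A]; [N * 3 ^ d] counts the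
    candidates that [Y] adds, each within 1 of [Y] (factor [2^beta]); and the last chosen site is
    within [m] of [A] (factor [(1 + m)^beta]). *)
Definition cross_cst (N : nat) : R :=
  (1 + 2 * m%:R) `^ beta * ((N * 3 ^ d).+1%:R * (2 `^ beta * (1 + m%:R) `^ beta)).

Definition cross_loss N A Y : R := cross_cst N * (spread beta A * coupling A Y).

Let pow_ge1 (x : R) : 1 <= x -> 1 <= x `^ beta.
Proof. by move=> x1; rewrite -[leLHS](powRr0 x) ler_powR// ltW. Qed.

Lemma cross_cst_ge N : (1 + m%:R) `^ beta <= cross_cst N.
Proof.
have a1 : 1 <= (1 + 2 * m%:R : R) `^ beta by rewrite pow_ge1// lerDl mulr_ge0.
have a2 : 1 <= (N * 3 ^ d).+1%:R :> R by rewrite ler1n.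
have a3 : 1 <= (2 : R) `^ beta by rewrite pow_ge1// ler1n.
rewrite /cross_cst !mulrA ler_peMl ?powR_ge0//.
by rewrite -[leLHS]mulr1 ler_pM// -[leLHS]mulr1 ler_pM.
Qed.

Lemma cross_loss_ge0 N A Y : 0 <= cross_loss N A Y.
Proof.
by rewrite !mulr_ge0 ?powR_ge0 ?coupling_ge0 ?spread_ge0.
Qed.

(** By contraposition, a loss below 1 keeps [Y] farther than [m] from [A], out of reach of the sites
    that a step of [A] deposits. *)
Lemma cross_loss_near N A Y a y : a \in A -> y \in Y -> enorm R (a - y) <= m%:R ->
  1 <= cross_loss N A Y.
Proof.
move=> aA yY ay.
have p : (1 + m%:R : R) `^ (- beta) <= coupling A Y.
  rewrite (le_trans _ (phi_le_coupling aA yY))// (phi_lb (ltW beta0))//.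
    by rewrite lerDl.
  by rewrite (le_trans ay)// lerDr.
have c := cross_cst_ge N; have s1 := spread_ge1 beta0 A.
have P0 : 0 < (1 + m%:R : R) `^ beta by rewrite powR_gt0// ltr_pwDl.
rewrite powRN in p.
rewrite -(divff (lt0r_neq0 P0)) /cross_loss ler_pM// ?invr_ge0 ?(ltW P0)//.
by rewrite -[leLHS]mul1r ler_pM// invr_ge0 ltW.
Qed.

Section Pair.
Variables (A Y : config d) (N : nat) (q : R).
Hypotheses (Am : (m < #|` A|)%N) (YN : (#|` Y| <= N)%N) (q1 : q < 1)
  (Aq : cross_loss N A Y <= q).
Let C := (A `|` Y)%fset.

Lemma cross_disjoint : [disjoint A & Y]%fset.
Proof.
apply/fdisjointP => x xA; apply/negP => xY.
have := @cross_loss_near N A Y x x xA xY; rewrite subrr enorm0 => /(_ (ler0n _ _)).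
by rewrite leNgt (le_lt_trans Aq q1).
Qed.

Lemma cross_current h : legal R m A h -> cur C h = (cur A h `|` Y)%fset.
Proof.
move=> hl; have tl : legal R m A (take m h).
  by apply: legal_catl (_ : legal R m A (take m h ++ drop m h)); rewrite cat_take_drop.
have tm : (size (take m h) <= m)%N by rewrite size_take_min geq_minl.
have [_ tA] := legal_act tl tm.
apply/fsetP => z; rewrite /current /C !(in_fsetU, in_fsetD, in_fseq).
have [zY|zY] := boolP (z \in Y); last by rewrite !orbF.
rewrite !orbT andbT; apply/orP; left; apply/negP => /tA zA.
by have /fdisjointP/(_ z zA) := cross_disjoint; rewrite zY.
Qed.

Lemma cross_candidates h : legal R m A h -> (size h < 2 * m)%N ->
  (cand A h `<=` cand C h)%fset.
Proof.
move=> hl h2; have [hm|hm] := ltnP (size h) m.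
  by rewrite !candidates_act//; apply: fsetSD; exact: fsubsetUl.
apply/fsubsetP => z zA; have zc := zA.
rewrite candidates_dep// in zA; move/in_boundary: zA => [zn [w wA zw]].
rewrite candidates_dep//; apply/in_boundary; rewrite cross_current// in_fsetU negb_or zn.
split; last by exists w => //; rewrite in_fsetU wA.
apply/negP => zY; have [a aA za] := candidates_near hl h2 zc.
have := @cross_loss_near N A Y a z aA zY; rewrite enormB => /(_ za).
by rewrite leNgt (le_lt_trans Aq q1).
Qed.

Lemma sum_phi_boundary x : \sum_(z <- boundary R Y) phi beta x z <=
  (N * 3 ^ d)%:R * (2 `^ beta * \sum_(y <- Y) phi beta x y).
Proof.
rewrite (@le_trans _ _ (\sum_(z <- boundary R Y) 2 `^ beta * \sum_(y <- Y) phi beta x y))//.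
  rewrite big_seq [leRHS]big_seq; apply: ler_sum => z /in_boundary[_ [y yY zy]].
  have := @phi_near R d beta (ltW beta0) 1 x z y ler01; rewrite zy lexx => /(_ isT) h.
  rewrite (le_trans h)// ler_wpM2l ?powR_ge0//.
  by apply: (@ge_sum_fset R _ Y (phi beta x)) => // w; exact: phi_ge0.
rewrite big_const_seq count_predT iter_addr_0 -[leLHS]mulr_natl.
rewrite ler_wpM2r ?mulr_ge0 ?powR_ge0 ?sum_phi_ge0// ler_nat.
by rewrite (leq_trans (card_boundary R Y))// leq_mul2r YN orbT.
Qed.

(** The candidates contributed by [Y] weigh at most a multiple of [coupling A Y], while those of [A]
    alone weigh at least a multiple of [1 / spread A]; the quotient is the loss. *)
Lemma cross_weight x h : legal R m A (x :: h) -> (size (x :: h) < 2 * m)%N ->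
  \sum_(z <- cand C (x :: h)) weight beta (x :: h) z <=
  (1 + q) * \sum_(z <- cand A (x :: h)) weight beta (x :: h) z.
Proof.
move=> hl h2; set w := weight beta (x :: h); set l := last x h.
have w0 z : 0 <= w z by exact/ltW/weight_gt0.
have [a aA la] := legal_mem_near hl (ltnW h2) (mem_last x h).
set S := \sum_(y <- Y) phi beta l y.
have S0 : 0 <= S by exact: sum_phi_ge0.
have SP : S <= (1 + m%:R) `^ beta * coupling A Y.
  rewrite (@le_trans _ _ ((1 + m%:R) `^ beta * \sum_(y <- Y) phi beta a y))//.
    rewrite mulr_sumr; apply: ler_sum => y _.
    rewrite (phiC _ l) (phiC _ a); apply: phi_near => //; exact: ltW.
  by rewrite ler_wpM2l ?powR_ge0// sum_phi_le_coupling.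
have extra : \sum_(z <- cand C (x :: h)) w z <= \sum_(z <- cand A (x :: h)) w z +
    (N * 3 ^ d).+1%:R * (2 `^ beta * S).
  have two1 : 1 <= (2 : R) `^ beta by rewrite pow_ge1// ler1n.
  have [hm|hm] := ltnP (size (x :: h)) m.
    rewrite (@le_trans _ _ (\sum_(z <- (cand A (x :: h) `|` Y)%fset) w z))//.
      apply: sum_fset_le => //; rewrite !candidates_act//; apply/fsubsetP => z.
      by rewrite !(in_fsetD, in_fsetU) => /andP[->/= ->].
    rewrite (le_trans (sum_fsetU_le _ _ w0))// lerD2l.
    have SE : \sum_(y <- Y) w y = S by [].
    rewrite SE mulrA ler_peMl// -[leLHS]mulr1 ler_pM// ler1n//.
  rewrite (@le_trans _ _ (\sum_(z <- (cand A (x :: h) `|` boundary R Y)%fset) w z))//.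
    apply: sum_fset_le => //; rewrite !candidates_dep//; apply/fsubsetP => z.
    rewrite in_fsetU => /in_boundary; rewrite cross_current// in_fsetU negb_or.
    move=> [/andP[zA zY] [v + zv]]; rewrite in_fsetU => /orP[vA|vY]; apply/orP.
      by left; apply/in_boundary; split=> //; exists v.
    by right; apply/in_boundary; split=> //; exists v.
  rewrite (le_trans (sum_fsetU_le _ _ w0))// lerD2l.
  rewrite (le_trans (sum_phi_boundary l))// ler_wpM2r ?mulr_ge0 ?powR_ge0// ler_nat.
  by [].
rewrite (le_trans extra)// mulrDl mul1r lerD2l.
have ZA : (1 + 2 * m%:R) `^ (- beta) * (spread beta A)^-1 <= \sum_(z <- cand A (x :: h)) w z.
  have /fset0Pn[z zc] := candidates_neq0 d0 Am hl.
  rewrite (le_trans _ (ge_sum_fset w0 zc))// (le_trans _ (weight_lb (ltW beta0) hl h2 zc (lexx _)))//.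
  have r0 : 0 < reach m (diam R A) by rewrite (lt_le_trans ltr01)// reach_ge1// diam_ge0.
  have n0 : 0 < 1 + 2 * m%:R :> R by rewrite ltr_pwDl// mulr_ge0.
  have n1 : 0 < 1 + diam R A by rewrite ltr_pwDl// diam_ge0.
  rewrite !powRN -invfM lef_pV2 ?posrE ?mulr_gt0 ?powR_gt0//.

  rewrite -powRM ?addr_ge0 ?diam_ge0 ?mulr_ge0//.
  have D0 := diam_ge0 R A; have mm : 0 <= m%:R :> R by [].
  apply: ge0_ler_powR; rewrite ?nnegrE ?(ltW beta0) ?(ltW r0)//.
    by rewrite mulr_ge0 ?(ltW n0)// addr_ge0.
  by rewrite /reach; nra.
have M0 : 0 < (1 + 2 * m%:R : R) `^ beta by rewrite powR_gt0// ltr_pwDl// mulr_ge0.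
have sA0 : 0 < spread beta A by apply: lt_le_trans (spread_ge1 beta0 A).
rewrite (le_trans _ (ler_wpM2l (le_trans (cross_loss_ge0 N A Y) Aq) ZA))//.
rewrite (le_trans _ (ler_wpM2r _ Aq))//; last first.
  by rewrite mulr_ge0 ?powR_ge0 ?invr_ge0 ?(ltW sA0).
have -> : cross_loss N A Y * ((1 + 2 * m%:R) `^ (- beta) * (spread beta A)^-1) =
    (N * 3 ^ d).+1%:R * (2 `^ beta * ((1 + m%:R) `^ beta * coupling A Y)).
  by rewrite /cross_loss /cross_cst powRN; field; rewrite !gt_eqF.
by rewrite ler_wpM2l// ler_wpM2l ?powR_ge0.
Qed.

(** In the presence of [Y] each choice keeps at least [1 / (1 + q) >= 1 - q] of its probability, and
    the additional candidates are dropped. Hence a lower bound only. The first choice, which is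
    uniform, is treated apart. *)
Lemma op_cross x h k f : legal R m A (x :: h) -> (size (x :: h) + k <= 2 * m)%N ->
  (forall B, 0 <= f B) ->
  (1 - q) ^+ k * op m beta A k (x :: h) (fun B => f (B `|` Y)%fset) <=
  op m beta C k (x :: h) f.
Proof.
have q0 : 0 <= q by apply: le_trans Aq; exact: cross_loss_ge0.
have q1' : 0 <= 1 - q by rewrite subr_ge0 ltW.
move=> + + f0; elim: k h => [|k IH] h hl hk /=.
  by rewrite expr0 mul1r cross_current.
have h2 : (size (x :: h) < 2 * m)%N by apply: leq_trans hk; rewrite addnS ltnS leq_addr.
pose F y := choice_prob m beta C (x :: h) y * op m beta C k (rcons (x :: h) y) f.
have F0 y : 0 <= F y by rewrite mulr_ge0 ?cprob_ge0 ?op_ge0.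
rewrite (le_trans _ (sum_fset_le (cross_candidates hl h2) F0))// mulr_sumr.
rewrite big_seq [leRHS]big_seq; apply: ler_sum => y yc.
rewrite exprS mulrACA ler_pM//.
- by rewrite mulr_ge0 ?cprob_ge0.
- by rewrite mulr_ge0 ?exprn_ge0// op_ge0.
- rewrite /choice_prob mulrCA ler_wpM2l//; first exact/ltW/weight_gt0.
  have ZA : 0 < \sum_(z <- cand A (x :: h)) weight beta (x :: h) z.
    by apply: sum_weight_gt0; exact: candidates_neq0.
  have ZC : 0 < \sum_(z <- cand C (x :: h)) weight beta (x :: h) z.
    by apply: sum_weight_gt0; apply/fset0Pn; exists y; exact: (fsubsetP (cross_candidates hl h2)).
  rewrite ler_pdivrMr// mulrC ler_pdivlMr//.
  rewrite (le_trans (ler_wpM2l q1' (cross_weight hl h2)))// mulrA ler_piMl ?(ltW ZA)//.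
  by nra.
- apply: (IH (rcons h y)); first by rewrite -rcons_cons; exact: legal_rcons.
  by rewrite -rcons_cons size_rcons; lia.
Qed.

End Pair.

End Crossing.

Section Cover.
Variables (R : realType) (T : choiceType).
Implicit Types (A B : {fset T}) (s : seq {fset T}) (F : T -> R).

Definition cluster_union s : {fset T} := foldr (fun A B => A `|` B)%fset fset0 s.

Definition upd s i A := set_nth fset0 s i A.

Lemma mem_cluster_union s x : (x \in cluster_union s) = has (fun A => x \in A) s.
Proof. by elim: s => [|A s IH] /=; rewrite ?in_fset0// in_fsetU IH. Qed.

Lemma cluster_unionP s x : reflect (exists2 i, (i < size s)%N & x \in nth fset0 s i) (x \in cluster_union s).
Proof. by rewrite mem_cluster_union; exact: has_nthP. Qed.

Lemma size_upd s i A : (i < size s)%N -> size (upd s i A) = size s.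
Proof. by move=> si; rewrite size_set_nth; apply/maxn_idPr. Qed.

Lemma nth_upd s i A j : nth fset0 (upd s i A) j = if j == i then A else nth fset0 s j.
Proof. by rewrite nth_set_nth /=. Qed.

(** Entry [i] is emptied rather than removed, which leaves the indices of the other clusters
    unchanged. *)
Definition others s i := cluster_union (upd s i fset0).

Lemma cluster_union_upd s i A : (i < size s)%N -> cluster_union (upd s i A) = (A `|` others s i)%fset.
Proof.
move=> si; apply/fsetP => x; rewrite in_fsetU; apply/cluster_unionP/orP.
- rewrite size_upd// => -[j js]; rewrite nth_upd; case: eqP => [_ xA|ji xj]; first by left.
  right; apply/cluster_unionP; exists j; first by rewrite size_upd.
  by rewrite nth_upd; case: eqP ji.
- case=> [xA|/cluster_unionP[j]].
    by exists i; rewrite ?size_upd// nth_upd eqxx.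
  rewrite size_upd// => js; rewrite nth_upd; case: eqP => [_|ji xj].
    by rewrite in_fset0.
  by exists j; rewrite ?size_upd// nth_upd; case: eqP ji.
Qed.

Lemma cluster_union_others s i : (i < size s)%N -> cluster_union s = (nth fset0 s i `|` others s i)%fset.
Proof.
move=> si; rewrite -cluster_union_upd//; congr cluster_union; symmetry.
apply: (@eq_from_nth _ fset0) => [|j _]; first exact: size_upd.
by rewrite nth_upd; case: eqP => [->|].
Qed.

Lemma sum_cluster_union_le s F : (forall x, 0 <= F x) ->
  \sum_(x <- cluster_union s) F x <= \sum_(i < size s) \sum_(x <- nth fset0 s i) F x.
Proof.
move=> F0; elim: s => [|A s IH]; first by rewrite big_seq_fset0 big_ord0.
by rewrite big_ord_recl/= (le_trans (sum_fsetU_le _ _ F0))// lerD2l.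
Qed.

Lemma sum_others_le s i F : (i < size s)%N -> (forall x, 0 <= F x) ->
  \sum_(x <- others s i) F x <=
  \sum_(j < size s | val j != i) \sum_(x <- nth fset0 s j) F x.
Proof.
move=> si F0; rewrite (le_trans (sum_cluster_union_le _ F0))// size_upd//.
rewrite [leRHS]big_mkcond; apply: ler_sum => j _; rewrite nth_upd.
by case: eqP => //= _; rewrite big_seq_fset0.
Qed.

Lemma card_cluster_union_le s : (#|` cluster_union s| <= \sum_(i < size s) #|` nth fset0 s i|)%N.
Proof.
elim: s => [|A s IH]; first by rewrite big_ord0.
rewrite big_ord_recl (leq_trans _ (leq_add (leqnn _) IH))//=.
by rewrite -cardfsUI leq_addr.
Qed.

Lemma card_others_le s i : (i < size s)%N ->
  (#|` others s i| <= \sum_(j < size s) #|` nth fset0 s j|)%N.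
Proof.
move=> si; rewrite (leq_trans _ (card_cluster_union_le s))// (fsubset_leq_card)//.
by rewrite (cluster_union_others si) fsubsetUr.
Qed.

Lemma sum_cluster_union_disj s F :
  (forall i, (i < size s)%N -> [disjoint nth fset0 s i & others s i]%fset) ->
  \sum_(x <- cluster_union s) F x = \sum_(i < size s) \sum_(x <- nth fset0 s i) F x.
Proof.
elim: s => [|A s IH] dis; first by rewrite big_seq_fset0 big_ord0.
rewrite big_ord_recl/= sum_fsetU_disj.
  congr (_ + _); apply: IH => i si; apply/fdisjointP => x xi; apply/negP => xo.
  have /fdisjointP/(_ x xi)/negP := dis i.+1 si; apply.
  have -> : others (A :: s) i.+1 = (A `|` others s i)%fset by [].
  by rewrite in_fsetU xo orbT.
have /fdisjointP D := dis 0%N isT.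
apply/fdisjointP => x xA; have := D x xA.
have -> : others (A :: s) 0 = (fset0 `|` cluster_union s)%fset by [].
by rewrite in_fsetU in_fset0.
Qed.

End Cover.

Section Decoupled.
Variables (R : realType) (d m : nat) (beta : R).
Hypotheses (d0 : (0 < d)%N) (m0 : (0 < m)%N) (beta0 : 0 < beta).
Implicit Types (A B C : config d) (s : seq (config d)).
Local Notation Pop := (@Pop R d m beta).
Local Notation nths s i := (nth fset0 s i).

(* One cluster, chosen proportionally to its size, moves and ignores the others. *)
Definition Pdec N (f : seq (config d) -> R) s : R :=
  \sum_(i < size s) (#|` nths s i|%:R / N%:R) * Pop (fun B => f (upd s i B)) (nths s i).

(** The loss carries [spread A] when [A] moves and [spread B] when [B] moves; as both are at least
    1, their product covers both cases. *)
Definition interaction A B : R := spread beta A * spread beta B * coupling beta A B.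

Definition total_interaction s : R :=
  \sum_(i < size s) \sum_(j < size s | val j != val i) interaction (nths s i) (nths s j).

Definition sizes s := (\sum_(i < size s) #|` nths s i|)%N.

Lemma interaction_ge0 A B : 0 <= interaction A B.
Proof. by rewrite !mulr_ge0 ?spread_ge0 ?coupling_ge0. Qed.

Lemma interactionC A B : interaction A B = interaction B A.
Proof. by rewrite /interaction couplingC [X in X * _]mulrC. Qed.

Lemma total_interaction_ge0 s : 0 <= total_interaction s.
Proof. by apply: sumr_ge0 => i _; apply: sumr_ge0 => j _; exact: interaction_ge0. Qed.

Lemma Pop_first C f : C != fset0 ->
  Pop f C = (\sum_(x <- C) op m beta C (2 * m).-1 [:: x] f) / #|` C|%:R.
Proof.
move=> C0; rewrite /Pop -[X in op _ _ _ X](@prednK (2 * m)) ?muln_gt0//=.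
have -> : candidates R m C [::] = C.
  by rewrite candidates_act//; apply/fsetP => z; rewrite in_fsetD in_fseq.
rewrite mulr_suml; apply: eq_bigr => x _.
rewrite /choice_prob (_ : candidates R m C [::] = C) /=; last first.
  by rewrite candidates_act//; apply/fsetP => z; rewrite in_fsetD in_fseq.
by rewrite big_const_seq count_predT iter_addr_0 mul1r mulrC.
Qed.

Lemma coupling_others s i : (i < size s)%N -> coupling beta (nths s i) (others s i) <=
  \sum_(j < size s | val j != i) coupling beta (nths s i) (nths s j).
Proof.
move=> si; rewrite /coupling [leRHS]exchange_big/=; apply: ler_sum => x _.
by apply: sum_others_le => // y; exact: phi_ge0.
Qed.

Lemma cross_loss_others N s (i : 'I_(size s)) :
  cross_loss m beta N (nths s i) (others s i) <= cross_cst d m beta N * total_interaction s.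
Proof.
have c0 : 0 <= cross_cst d m beta N.
  by rewrite (le_trans _ (cross_cst_ge d m beta0 N))// powR_ge0.
rewrite /cross_loss ler_wpM2l// /total_interaction (bigD1 i)//=.
rewrite -[leLHS]addr0 lerD//; last first.
  by apply: sumr_ge0 => k _; apply: sumr_ge0 => j _; exact: interaction_ge0.
rewrite (le_trans (ler_wpM2l (spread_ge0 beta _) (coupling_others (ltn_ord i))))//.
rewrite mulr_sumr; apply: ler_sum => j _; rewrite /interaction.
by rewrite ler_wpM2r ?coupling_ge0// ler_peMr ?spread_ge0 ?spread_ge1.
Qed.

Lemma Pdec_ge0 N f s : (forall t, 0 <= f t) -> 0 <= Pdec N f s.
Proof.
by move=> f0; apply: sumr_ge0 => i _; rewrite mulr_ge0 ?divr_ge0// Pop_ge0.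
Qed.

Definition cross_rate N := (2 * m)%:R * cross_cst d m beta N.

(** The first site is uniform on the union, so it falls in each cluster with a probability
    proportional to its size, as in [Pdec]. The remaining [2m - 1] choices lose a factor
    [(1 - q)^(2m-1)], at least [1 - 2 m q]. *)
Lemma cross_lb N s g : (forall i, (i < size s)%N -> m < #|` nths s i|)%N ->
  sizes s = N -> (0 < N)%N ->
  cross_rate N * total_interaction s < 1 -> (forall B, 0 <= g B) ->
  (1 - cross_rate N * total_interaction s) * Pdec N (fun t => g (cluster_union t)) s <=
  Pop g (cluster_union s).
Proof.
move=> sm sN N0 Q1 g0.
pose q := cross_cst d m beta N * total_interaction s.
have c0 : 0 <= cross_cst d m beta N.
  by rewrite (le_trans _ (cross_cst_ge d m beta0 N))// powR_ge0.
have q0 : 0 <= q by rewrite mulr_ge0// total_interaction_ge0.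
have m2 : 1 <= (2 * m)%:R :> R by rewrite ler1n muln_gt0.
have Qq : cross_rate N * total_interaction s = (2 * m)%:R * q by rewrite /cross_rate -mulrA.
rewrite Qq in Q1 *.
have q1 : q < 1 by apply: le_lt_trans Q1; rewrite ler_peMl.
have lossq (i : 'I_(size s)) := cross_loss_others N i.
have oN i : (i < size s)%N -> (#|` others s i| <= N)%N.
  by move=> si; rewrite -sN; exact: card_others_le.
have dis i : (i < size s)%N -> [disjoint nths s i & others s i]%fset.
  by move=> si; apply: (cross_disjoint beta0 q1 (lossq (Ordinal si))).
have sumE (F : lattice d -> R) := sum_cluster_union_disj F dis.
have cN : #|` cluster_union s| = N.
  have := sumE (fun=> 1); rewrite big_const_seq count_predT iter_addr_0.
  under eq_bigr do rewrite big_const_seq count_predT iter_addr_0.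
  by rewrite -natr_sum => /eqP; rewrite eqr_nat => /eqP ->; exact: sN.
have fs0 : cluster_union s != fset0 by rewrite -cardfs_gt0 cN.
rewrite Pop_first// cN sumE mulr_suml /Pdec mulr_sumr.
apply: ler_sum => i _.
have sim := sm i (ltn_ord i).
have si0 : nths s i != fset0 by rewrite -cardfs_gt0 (leq_ltn_trans _ sim).
have n0 : (#|` nths s i|%:R : R) != 0 by rewrite pnatr_eq0 cardfs_eq0.
have -> : #|` nths s i|%:R / N%:R * Pop (fun B => g (cluster_union (upd s i B))) (nths s i) =
    (\sum_(x <- nths s i) op m beta (nths s i) (2 * m).-1 [:: x]
      (fun B => g (B `|` others s i)%fset)) / N%:R.
  rewrite Pop_first// mulrC mulrA divfK//; congr (_ / _).
  apply: eq_bigr => x _; apply: eq_op_ext => B; by rewrite cluster_union_upd.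
rewrite mulrA ler_wpM2r ?invr_ge0// mulr_sumr big_seq [leRHS]big_seq.
apply: ler_sum => x xi.
have xl : legal R m (nths s i) [:: x].
  apply: (legal_rcons (legal_nil R m _)).
  by rewrite candidates_act// in_fsetD in_fseq xi.
have := @op_cross R d m beta d0 m0 beta0 (nths s i) (others s i) N q sim (oN i (ltn_ord i))
  q1 (lossq i) x [::] (2 * m).-1 g xl.
rewrite -(cluster_union_others (ltn_ord i)) /= add1n prednK ?muln_gt0// => /(_ (leqnn _) g0).
apply: le_trans; rewrite ler_wpM2r//; first exact: op_ge0.
rewrite (le_trans _ (bernoulli_le _ _)) ?q0 ?(ltW q1)// lerD2l lerN2.
by rewrite ler_wpM2r// ler_nat leq_pred.
Qed.

Lemma sum_cluster_weights N s : sizes s = N -> (0 < N)%N ->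
  \sum_(i < size s) (#|` nths s i|%:R / N%:R) = 1 :> R.
Proof.
by move=> sN N0; rewrite -mulr_suml -natr_sum -/(sizes s) sN divff// pnatr_eq0 -lt0n.
Qed.

(** The lower bound [cross_lb] applied to [kappa - f] becomes an upper bound for [f]. When the error
    rate reaches 1, [f <= kappa] is enough. *)
Lemma cross_le N s f kappa : (forall i, (i < size s)%N -> m < #|` nths s i|)%N ->
  sizes s = N -> (0 < N)%N -> (forall B, 0 <= f B <= kappa) ->
  Pop f (cluster_union s) <= Pdec N (fun t => f (cluster_union t)) s +
    kappa * (cross_rate N * total_interaction s).
Proof.
move=> sm sN N0 fk; set Q := cross_rate N * _.
have k0 : 0 <= kappa by have /andP[] := fk fset0; exact: le_trans.
have D0 : 0 <= Pdec N (fun t => f (cluster_union t)) s.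
  by apply: Pdec_ge0 => t; case/andP: (fk (cluster_union t)).
have c0 : 0 <= cross_cst d m beta N.
  by rewrite (le_trans _ (cross_cst_ge d m beta0 N))// powR_ge0.
have Q0 : 0 <= Q by rewrite mulr_ge0 ?total_interaction_ge0// mulr_ge0.
have [Q1|Q1] := leP 1 Q.
  rewrite (@le_trans _ _ kappa)//; last by rewrite -[leLHS]add0r lerD// ler_peMr.
  by apply: Pop_le_cst => // B _; case/andP: (fk B).
have g0 B : 0 <= kappa - f B by rewrite subr_ge0; case/andP: (fk B).
have := cross_lb sm sN N0 Q1 g0; rewrite -/Q.
have -> : Pdec N (fun t => kappa - f (cluster_union t)) s = kappa - Pdec N (fun t => f (cluster_union t)) s.
  rewrite -[X in X - _]mul1r -(sum_cluster_weights sN N0) mulr_suml /Pdec -sumrB.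
  by apply: eq_bigr => i _; rewrite PopB Pop_cst ?sm// mulrBr.
have : Pop (fun B => kappa - f B) (cluster_union s) <= kappa - Pop f (cluster_union s).
  rewrite PopB lerD2r; exact: Pop_le_cst.
nra.
Qed.

End Decoupled.

(** * Interaction of two decoupled clusters *)

Section PairEstimate.
Variables (R : realType) (d m : nat) (beta : R).
Hypotheses (d3 : (3 <= d)%N) (m0 : (0 < m)%N) (beta2 : 2 < beta).
Implicit Types (A B : config d) (s t : seq (config d)).
Local Notation Pop := (@Pop R d m beta).
Local Notation step := (@step_rel R d m).
Local Notation nths s i := (nth fset0 s i).

Let d0 : (0 < d)%N. Proof. exact: leq_trans d3. Qed.
Let beta0 : 0 < beta. Proof. exact: lt_trans beta2. Qed.

Variable N : nat.
Hypothesis N0 : (0 < N)%N.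
Local Notation Pdec := (@Pdec R d m beta N).
Local Notation interaction := (@interaction R d beta).

Lemma Pdec_le f g s :
  (forall i B, (i < size s)%N -> step (nths s i) B -> f (upd s i B) <= g (upd s i B)) ->
  Pdec f s <= Pdec g s.
Proof.
move=> fg; apply: ler_sum => i _; rewrite ler_wpM2l ?divr_ge0//.
by apply: Pop_le => B; exact: fg.
Qed.

Lemma PdecD f g s : Pdec (fun t => f t + g t) s = Pdec f s + Pdec g s.
Proof.
rewrite -big_split/=; apply: eq_bigr => i _.
by rewrite -mulrDr -PopD.
Qed.

Lemma PdecZ c f s : Pdec (fun t => c * f t) s = c * Pdec f s.
Proof.
by rewrite /Pdec mulr_sumr; apply: eq_bigr => i _; rewrite PopZ mulrCA.
Qed.

Lemma iter_PdecD n f g s :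
  iter n Pdec (fun t => f t + g t) s = iter n Pdec f s + iter n Pdec g s.
Proof.
by elim: n s => //= n IH s; rewrite -PdecD; congr (Pdec _ _); apply/funext.
Qed.

Lemma iter_PdecZ n c f s : iter n Pdec (fun t => c * f t) s = c * iter n Pdec f s.
Proof.
by elim: n s => //= n IH s; rewrite -PdecZ; congr (Pdec _ _); apply/funext.
Qed.

Lemma iter_Pdec_ge0 n f s : (forall t, 0 <= f t) -> 0 <= iter n Pdec f s.
Proof. by move=> f0; elim: n s => //= n IH s; exact: Pdec_ge0. Qed.

Definition has_sizes (nu : seq nat) s := map (fun A : config d => #|` A|) s = nu.

Lemma has_sizes_nth nu s i : has_sizes nu s -> (i < size s)%N ->
  #|` nths s i| = nth 0%N nu i.
Proof. by move=> <- si; rewrite (nth_map fset0). Qed.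

Lemma has_sizes_upd nu s i B : all (leq m.+1) nu -> has_sizes nu s -> (i < size s)%N ->
  step (nths s i) B -> has_sizes nu (upd s i B).
Proof.
move=> num hs si sB; rewrite -hs /has_sizes.
apply: (@eq_from_nth _ 0%N); rewrite !size_map ?size_upd// => j js.
rewrite !(nth_map fset0) ?size_upd// nth_upd; case: eqP => // ->.
apply: (card_step _ sB); rewrite (has_sizes_nth hs si).
by apply: (allP num); rewrite mem_nth// -hs size_map.
Qed.

Lemma iter_Pdec_le nu n f g s : all (leq m.+1) nu ->
  (forall t, has_sizes nu t -> f t <= g t) -> has_sizes nu s ->
  iter n Pdec f s <= iter n Pdec g s.
Proof.
move=> num fg; elim: n s => [|n IH] s hs; first exact: fg.
by apply: Pdec_le => i B si sB; apply: IH; exact: has_sizes_upd sB.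
Qed.

Lemma eq_iter_Pdec nu n f g s : all (leq m.+1) nu ->
  (forall t, has_sizes nu t -> f t = g t) -> has_sizes nu s ->
  iter n Pdec f s = iter n Pdec g s.
Proof.
move=> num fg hs; apply/eqP; rewrite eq_le.
by rewrite !(iter_Pdec_le (nu := nu))// => t /fg ->.
Qed.

Definition Gab (a b : nat) A B : R :=
  iter a Pop (fun X => iter b Pop (interaction X) B) A.

Section TwoClusters.
Variables (nu : seq nat) (i j : nat).
Hypotheses (num : all (leq m.+1) nu) (nuN : sumn nu = N)
  (inu : (i < size nu)%N) (jnu : (j < size nu)%N) (ij : i != j).
Let alpha : R := (nth 0%N nu i)%:R / N%:R.
Let gam : R := (nth 0%N nu j)%:R / N%:R.

Lemma size_has_sizes s : has_sizes nu s -> size s = size nu.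
Proof. by move=> <-; rewrite size_map. Qed.

Lemma sizes_has_sizes s : has_sizes nu s -> sizes s = N.
Proof.
move=> hs; rewrite -nuN -hs sumnE big_map /sizes [RHS](big_nth fset0) big_mkord.
by [].
Qed.

(** A decoupled step advances one of the two counters or neither, so the family [Gab a b] is closed
    under it; when the second cluster moves, Fubini takes its step past those of the first. *)
Lemma Pdec_Gab a b s : has_sizes nu s ->
  Pdec (fun t => Gab a b (nths t i) (nths t j)) s =
  alpha * Gab a.+1 b (nths s i) (nths s j) + gam * Gab a b.+1 (nths s i) (nths s j)
  + (1 - alpha - gam) * Gab a b (nths s i) (nths s j).
Proof.
move=> hs; have ss := size_has_sizes hs.
have si : (i < size s)%N by rewrite ss.
have sj : (j < size s)%N by rewrite ss.
have sw := @sum_cluster_weights R d N s (sizes_has_sizes hs) N0.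
have bigm k : (k < size s)%N -> (m < #|` nths s k|)%N.
  by move=> sk; rewrite (has_sizes_nth hs sk); apply: (allP num); rewrite mem_nth// -ss.
pose i' := Ordinal si; pose j' := Ordinal sj.
have ji' : j' != i' by rewrite -val_eqE eq_sym.
rewrite (bigD1 i')//= (bigD1 j')//= in sw.
rewrite /Pdec /= (bigD1 i')//= (bigD1 j')//= addrA; congr (_ * _ + _ * _ + _).
- by rewrite /alpha (has_sizes_nth hs si).
- by apply: eq_Pop => B _; rewrite !nth_upd eqxx eq_sym (negbTE ij).
- by rewrite /gam (has_sizes_nth hs sj).
- rewrite (@eq_Pop R d m beta _ _ (fun B => Gab a b (nths s i) B)); last first.
    by move=> B _; rewrite !nth_upd eqxx (negbTE ij).
  by rewrite /Gab Pop_iter_comm.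
rewrite (eq_bigr (fun k : 'I_(size s) => #|` nths s k|%:R / N%:R *
    Gab a b (nths s i) (nths s j))); last first.
  move=> k /andP[ki kj]; congr (_ * _).
  rewrite -[RHS](@Pop_cst R d m beta (nths s k)) ?bigm//.
  apply: eq_Pop => B _; rewrite !nth_upd.
  by rewrite ![_ == val k]eq_sym (negbTE (ki : val k != i)) (negbTE (kj : val k != j)).
rewrite -mulr_suml; congr (_ * _).
by move: sw; rewrite (has_sizes_nth hs si) (has_sizes_nth hs sj) -/alpha -/gam; lra.
Qed.

Lemma alpha_bounds : 0 < alpha <= 1.
Proof.
have ni : (0 < nth 0%N nu i)%N by have := allP num _ (mem_nth 0%N inu); apply: leq_trans.
rewrite divr_gt0 ?ltr0n//= ler_pdivrMr ?ltr0n// mul1r ler_nat -nuN.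
by rewrite sumnE (big_nth 0%N) big_mkord (bigD1 (Ordinal inu))//= leq_addr.
Qed.

Lemma alpha_gam : alpha + gam <= 1.
Proof.
rewrite -mulrDl ler_pdivrMr ?ltr0n// mul1r -natrD ler_nat -nuN.
rewrite sumnE (big_nth 0%N) big_mkord (bigD1 (Ordinal inu))//= leq_add2l.
by rewrite (bigD1 (Ordinal jnu))//= ?leq_addr// -val_eqE eq_sym.
Qed.

Lemma gam_ge0 : 0 <= gam.
Proof. exact: divr_ge0. Qed.

Variables (s : seq (config d)) (c T : nat -> R).
Hypotheses (hs : has_sizes nu s)
  (Gc : forall a b, Gab a b (nths s i) (nths s j) <= c a)
  (Tc : forall a, T a = c a + T a.+1) (T0 : forall a, 0 <= T a).

(** The bound [c a] is uniform in [b], so only the moves of cluster [i] are counted, and these wait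
    a geometric time of mean [1 / alpha]. *)
Lemma sum_iter_Gab S a b :
  \sum_(k < S) iter k Pdec (fun t => Gab a b (nths t i) (nths t j)) s <= T a / alpha.
Proof.
have /andP[al0 al1] := alpha_bounds; have ag := alpha_gam; have g0 := gam_ge0.
elim: S a b => [|S IH] a b; first by rewrite big_ord0 divr_ge0// ltW.
rewrite big_ord_recl/=.
under eq_bigr => k _.
  rewrite -iterS iterSr (eq_iter_Pdec k num (@Pdec_Gab a b) hs).
  rewrite iter_PdecD iter_PdecD !iter_PdecZ.
  over.
rewrite !big_split/= -!mulr_sumr.
have k0 : 0 <= 1 - alpha - gam by lra.
have al0' := ltW al0.
have I1 := ler_wpM2l al0' (IH a.+1 b); have I2 := ler_wpM2l g0 (IH a b.+1).
have I3 := ler_wpM2l k0 (IH a b).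
apply: (le_trans (lerD (Gc a b) (lerD (lerD I1 I2) I3))).
by rewrite (Tc a) le_eqVlt; apply/orP; left; apply/eqP; field; rewrite gt_eqF.
Qed.

(** By time [n] the counter of cluster [i] has grown, so that only a late tail of [c] remains. *)
Lemma sum_iter_Gab_delay S n a b :
  \sum_(k < S) iter (n + k) Pdec (fun t => Gab a b (nths t i) (nths t j)) s <=
  delay alpha (fun a => T a / alpha) n a.
Proof.
have /andP[al0 al1] := alpha_bounds; have ag := alpha_gam; have g0 := gam_ge0.
elim: n a b => [|n IH] a b; first exact: sum_iter_Gab.
under eq_bigr => k _.
  rewrite addSn iterSr (eq_iter_Pdec (n + k) num (@Pdec_Gab a b) hs).
  rewrite iter_PdecD iter_PdecD !iter_PdecZ.
  over.
rewrite !big_split/= -!mulr_sumr.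
have k0 : 0 <= 1 - alpha - gam by lra.
have al0' := ltW al0.
have I1 := ler_wpM2l al0' (IH a.+1 b); have I2 := ler_wpM2l g0 (IH a b.+1).
have I3 := ler_wpM2l k0 (IH a b).
apply: (le_trans (lerD (lerD I1 I2) I3)).
by rewrite /=; lra.
Qed.

End TwoClusters.

End PairEstimate.

(** * Summability of the interaction of a pair *)

Section Smallness.
Variables (R : realType) (d m : nat) (beta : R).
Hypotheses (d3 : (3 <= d)%N) (m0 : (0 < m)%N) (beta2 : 2 < beta).
Implicit Types (A B C : config d) (s t : seq (config d)).
Local Notation Pop := (@Pop R d m beta).
Local Notation step := (@step_rel R d m).
Local Notation nths s i := (nth fset0 s i).
Local Notation spread := (@spread R d beta).
Local Notation small := (@small R d m).

Let d0 : (0 < d)%N. Proof. exact: leq_trans d3. Qed.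
Let beta0 : 0 < beta. Proof. exact: lt_trans beta2. Qed.

Variable N : nat.
Hypothesis N0 : (0 < N)%N.
Local Notation Pdec := (@Pdec R d m beta N).
Local Notation interaction := (@interaction R d beta).

Lemma spread_step A B : step A B -> spread B <= (1 + 2 * m%:R) `^ beta * spread A.
Proof.
move=> AB; have D0 := diam_ge0 R A; have mm : 0 <= m%:R :> R by [].
rewrite (le_trans (spread_le beta0 _ (diam_step AB))) ?addr_ge0 ?mulr_ge0//.
rewrite /spread -powRM ?addr_ge0 ?mulr_ge0//.
apply: ge0_ler_powR; rewrite ?nnegrE ?(ltW beta0)//.
- by rewrite !addr_ge0// mulr_ge0.
- by rewrite mulr_ge0// addr_ge0// mulr_ge0.
- by nra.
Qed.

Lemma coupling_step A A' B : (#|` A'| <= N)%N -> step A A' ->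
  coupling beta A' B <= N%:R * ((1 + m%:R) `^ beta * coupling beta A B).
Proof.
move=> AN AA'; rewrite {1}/coupling.
rewrite (@le_trans _ _ (\sum_(x <- A') (1 + m%:R) `^ beta * coupling beta A B))//.
  rewrite big_seq [leRHS]big_seq; apply: ler_sum => x /(step_near AA')[a aA xa].
  rewrite (le_trans _ (ler_wpM2l (powR_ge0 _ _) (sum_phi_le_coupling beta B aA)))//.
  rewrite mulr_sumr; apply: ler_sum => y _.
  by rewrite (phiC _ x) (phiC _ a); apply: phi_near => //; exact: ltW.
rewrite big_const_seq count_predT iter_addr_0 -[leLHS]mulr_natl.
by rewrite ler_wpM2r ?mulr_ge0 ?powR_ge0 ?coupling_ge0// ler_nat.
Qed.

Definition growth : R := (1 + 2 * m%:R) `^ beta * (N%:R * (1 + m%:R) `^ beta).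

Lemma growth_ge1 : 1 <= growth.
Proof.
have p x : 1 <= x -> 1 <= x `^ beta by move=> x1; rewrite -[leLHS](powRr0 x) ler_powR// ltW.
have n1 : 1 <= N%:R :> R by rewrite ler1n.
have a1 : 1 <= (1 + 2 * m%:R : R) `^ beta by rewrite p// lerDl mulr_ge0.
have a2 : 1 <= (1 + m%:R : R) `^ beta by rewrite p// lerDl.
by rewrite /growth -[leLHS]mulr1 ler_pM// -[leLHS]mulr1 ler_pM.
Qed.

Lemma interaction_step A A' B : (#|` A'| <= N)%N -> step A A' ->
  interaction A' B <= growth * interaction A B.
Proof.
move=> AN AA'; rewrite /interaction /growth.
have -> : (1 + 2 * m%:R) `^ beta * (N%:R * (1 + m%:R) `^ beta) *
   (spread A * spread B * coupling beta A B) = (1 + 2 * m%:R) `^ beta * spread A * spread B *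
   (N%:R * ((1 + m%:R) `^ beta * coupling beta A B)) by ring.
rewrite ler_pM ?mulr_ge0 ?spread_ge0 ?coupling_ge0 ?coupling_step//.
by rewrite ler_wpM2r ?spread_ge0 ?spread_step.
Qed.

Lemma spread_moment_unif : exists2 K : R, 0 < K &
  forall C n, (m < #|` C| <= (2 * m).+1)%N -> iter n Pop spread C <= K * spread C.
Proof.
have /choice[K HK] : forall k, exists K : R, 0 < K /\ ((m < k <= (2 * m).+1)%N ->
    forall C n, #|` C| = k -> iter n Pop spread C <= K * spread C).
  move=> k; have [hk|hk] := boolP (m < k <= (2 * m).+1)%N; last by exists 1.
  by have [K K0 HK] := spread_moment d0 m0 beta0 hk; exists K; split=> // _; exact: HK.
have K0 k : 0 < K k by case: (HK k).
exists (\sum_(k < (2 * m).+2) K k).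
  by rewrite big_ord_recl/= ltr_pwDl// sumr_ge0// => k _; exact: ltW.
move=> C n hC; rewrite (le_trans ((HK #|` C|).2 hC C n erefl))//.
have hk : (#|` C| < (2 * m).+2)%N by rewrite ltnS; case/andP: hC.
rewrite ler_wpM2r ?spread_ge0// (bigD1 (Ordinal hk))//= lerDl sumr_ge0// => k _.
exact: ltW.
Qed.

(** The [a] moves of [A] bring the mean of [phi] down to [c a] uniformly in the other endpoint, so
    the position of [B] is forgotten; what is left is the mean [spread] of [B], bounded since [B]
    has at most [2m + 1] sites. *)
Lemma Gab_bound : exists c : nat -> R, [/\ forall n, 0 <= c n,
  exists K : R, forall n, \sum_(i < n) c i <= K &
  forall a b A B, small A -> (m < #|` B| <= (2 * m).+1)%N -> (#|` B| <= N)%N ->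
    Gab m beta a b A B <= c a * spread B].
Proof.
have [K K0 HK] := spread_moment_unif.
have [c [c0 [Kc cK] Hc]] := small_decay d3 m0 beta2.
pose M : R := (1 + 2 * m%:R) `^ beta * N%:R.
have M0 : 0 <= M by rewrite mulr_ge0 ?powR_ge0.
have m2 : 0 <= 2 * m%:R :> R by rewrite mulr_ge0.
exists (fun a => M * K * c a); split.
- by move=> n; rewrite !mulr_ge0// ltW.
- exists (M * K * Kc) => n; rewrite -mulr_sumr ler_wpM2l// mulr_ge0// ltW//.
move=> a b A B sA hB BN; rewrite /Gab iter_Pop_comm.
apply: (@le_trans _ _ (iter b Pop (fun Y => M * c a * spread Y) B)); last first.
  rewrite iter_PopZ (le_trans (ler_wpM2l (mulr_ge0 M0 (c0 a)) (HK B b hB)))//.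
  by rewrite le_eqVlt; apply/orP; left; apply/eqP; ring.
apply: (@iter_Pop_le R d m beta (fun Y => #|` Y| = #|` B|)); last exact: erefl.
  have /andP[mB _] := hB.
  by move=> Y Y' YB YY'; rewrite -YB; apply: (card_step _ YY'); rewrite YB.
move=> Y YB.
apply: (@le_trans _ _ (iter a Pop (fun X => (1 + 2 * m%:R) `^ beta * spread Y *
    \sum_(y <- Y) \sum_(x <- X) phi beta x y) A)).
  apply: (@iter_Pop_le R d m beta small); last exact: sA.
    by move=> X X' [Xm _]; exact: small_step.
  move=> X [_ XD]; rewrite /interaction /coupling exchange_big/= ler_wpM2r//.
    by apply: sumr_ge0 => x _; apply: sumr_ge0 => y _; exact: phi_ge0.
  by rewrite ler_wpM2r ?spread_ge0// spread_le.
rewrite iter_PopZ iter_Pop_sum.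
rewrite (@le_trans _ _ ((1 + 2 * m%:R) `^ beta * spread Y * (N%:R * c a)))//; last first.
  by rewrite le_eqVlt; apply/orP; left; apply/eqP; rewrite /M; ring.
rewrite ler_wpM2l ?mulr_ge0 ?powR_ge0 ?spread_ge0//.
rewrite (le_trans (ler_sum _ (fun y _ => Hc a y A sA)))//.
rewrite big_const_seq count_predT iter_addr_0 -[leLHS]mulr_natl.
by rewrite ler_wpM2r// ler_nat -[size _]/(#|` Y|) YB.
Qed.

Section Growth.
Variables (nu : seq nat) (i j : nat).
Hypotheses (num : all (leq m.+1) nu) (nuN : sumn nu = N)
  (inu : (i < size nu)%N) (jnu : (j < size nu)%N) (ij : i != j).

Lemma has_sizes_leN s k : has_sizes nu s -> (k < size s)%N -> (#|` nths s k| <= N)%N.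
Proof.
move=> hs ks; rewrite -(sizes_has_sizes nuN hs) /sizes (bigD1 (Ordinal ks))//=.
exact: leq_addr.
Qed.

Lemma Pdec_growth s : has_sizes nu s ->
  Pdec (fun t => interaction (nths t i) (nths t j)) s <=
  growth * interaction (nths s i) (nths s j).
Proof.
move=> hs; have ss := size_has_sizes hs.
have g1 := growth_ge1; have I0 := interaction_ge0 beta (nths s i) (nths s j).
have gI0 : 0 <= growth * interaction (nths s i) (nths s j).
  by rewrite mulr_ge0// (le_trans _ g1).
rewrite /Pdec.
have sw := sum_cluster_weights R (sizes_has_sizes nuN hs) N0.
rewrite -[leRHS]mul1r -[X in _ <= X * _]sw mulr_suml; apply: ler_sum => k _.
rewrite ler_wpM2l ?divr_ge0//; apply: Pop_le_cst => // B sB.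
have BN : (#|` B| <= N)%N.
  have hs' := has_sizes_upd num hs (ltn_ord k) sB.
  have := @has_sizes_leN _ k hs'; rewrite size_upd// nth_upd eqxx; apply.
  exact: ltn_ord.
rewrite !nth_upd; have [ki|ki] := eqVneq i k.
  rewrite -ki in sB *; rewrite eq_sym (negbTE ij).
  exact: interaction_step.
have [kj|kj] := eqVneq j k.
  rewrite -kj in sB *; rewrite ![interaction (nths s i) _]interactionC.
  exact: interaction_step.
by rewrite ler_peMl.
Qed.

Lemma iter_Pdec_growth n s : has_sizes nu s ->
  iter n Pdec (fun t => interaction (nths t i) (nths t j)) s <=
  growth ^+ n * interaction (nths s i) (nths s j).
Proof.
elim: n s => [|n IH] s hs; first by rewrite mul1r.
rewrite iterSr (le_trans (iter_Pdec_le beta N n num Pdec_growth hs))// iter_PdecZ exprS -mulrA.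
by rewrite ler_wpM2l ?IH// (le_trans _ growth_ge1).
Qed.

End Growth.

(** The sum over times after [n] is small by decay, wherever the clusters start; the first [n] terms
    are at most powers of [growth] times the initial interaction, which is then taken small. *)
Lemma pair_small (r eps : R) : 0 < eps -> 0 <= r -> exists2 eps', 0 < eps' &
  forall nu s i j, all (leq m.+1) nu -> sumn nu = N -> has_sizes nu s ->
    (i < size s)%N -> (j < size s)%N -> i != j -> small (nths s i) ->
    (#|` nths s j| <= (2 * m).+1)%N -> spread (nths s j) <= r ->
    interaction (nths s i) (nths s j) <= eps' ->
  forall S, \sum_(k < S) iter k Pdec (fun t => interaction (nths t i) (nths t j)) s <= eps.
Proof.
move=> eps0 r0; have [c [c0 [K cK] Hc]] := Gab_bound.
pose c' a := c a * r.
have c'0 a : 0 <= c' a by rewrite mulr_ge0.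
have [|T [Tc T0 Tcvg]] := @tails R c' (K * r) c'0.
  by move=> n; rewrite /c' -mulr_suml ler_wpM2r.
(* The small cluster has [m + 1] of the [N] sites: this is the rate at which it moves. *)
pose alpha : R := m.+1%:R / N%:R.
have [Nm|mN] := ltnP N m.+1.
  exists 1 => // nu s i j num nuN hs si sj ij [sm _] *.
  exfalso; have := @has_sizes_leN nu nuN s i hs si.
  by rewrite sm leqNgt Nm.
have al : 0 < alpha <= 1.
  by rewrite divr_gt0 ?ltr0n//= ler_pdivrMr ?ltr0n// mul1r ler_nat.
have al0 : 0 < alpha by case/andP: al.
have Tle a : T a <= T 0%N.
  elim: a => // a IH; apply: le_trans IH.
  by rewrite [leRHS]Tc lerDr.
have [||||n Hn] := @delay_cvg0 R alpha (fun a => T a / alpha) (eps / 2) al.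
- by move=> a; rewrite divr_ge0// ltW.
- by exists (T 0%N / alpha) => a; rewrite ler_wpM2r ?invr_ge0 ?(ltW al0).
- move=> e e0; have [a0 Ha0] := Tcvg _ (mulr_gt0 e0 al0); exists a0 => a /Ha0 h.
  by rewrite ler_pdivrMr.
- by rewrite divr_gt0.
have g1 := growth_ge1; have g0 : 0 < growth by apply: lt_le_trans g1.
pose L := \sum_(k < n) growth ^+ k.
have L0 : 0 <= L by apply: sumr_ge0 => k _; rewrite exprn_ge0// ltW.
exists (eps / 2 / (L + 1)).
  by rewrite !divr_gt0// ltr_wpDl.
move=> nu s i j num nuN hs si sj ij sm jm sr Ge S.
have ss := size_has_sizes hs.
have inu : (i < size nu)%N by rewrite -ss.
have jnu : (j < size nu)%N by rewrite -ss.
have jm' : (m < #|` nths s j|)%N.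
  by rewrite (has_sizes_nth hs sj); apply: (allP num); rewrite mem_nth.
have Gc a b : Gab m beta a b (nths s i) (nths s j) <= c' a.
  rewrite (le_trans (Hc a b _ _ sm _ _))// ?jm' ?jm//.
    exact: (has_sizes_leN nuN hs).
  by rewrite ler_wpM2l.
have ai : nth 0%N nu i = m.+1 by rewrite -(has_sizes_nth hs si); case: sm.
have tail := sum_iter_Gab_delay d3 N0 num nuN inu jnu ij hs Gc Tc T0 S n 0 0.
rewrite ai -/alpha in tail.
have F0 k : 0 <= iter k Pdec (fun t => interaction (nths t i) (nths t j)) s.
  by apply: iter_Pdec_ge0 => t; exact: interaction_ge0.
apply: (@le_trans _ _ (\sum_(k < n + S) iter k Pdec (fun t => interaction (nths t i) (nths t j)) s)).
  by rewrite addnC big_split_ord/= lerDl sumr_ge0.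
rewrite big_split_ord/= [leRHS](_ : eps = eps / 2 + eps / 2); last by field.
rewrite lerD//; last by rewrite (le_trans tail).
apply: (@le_trans _ _ (L * interaction (nths s i) (nths s j))).
  rewrite /L mulr_suml; apply: ler_sum => k _.
  exact: (iter_Pdec_growth num nuN ij).
have L1 : 0 < L + 1 by rewrite ltr_wpDl.
rewrite (le_trans (ler_wpM2l L0 Ge))// mulrA ler_pdivrMr// mulrC ler_wpM2l//.
  by rewrite divr_ge0// ltW.
by rewrite lerDl.
Qed.

End Smallness.

(** * Expected number of visits *)

Section Visits.
Variables (R : realType) (d m : nat) (beta : R).
Hypotheses (d3 : (3 <= d)%N) (m0 : (0 < m)%N) (beta2 : 2 < beta).
Implicit Types (A B C : config d) (s t : seq (config d)).
Local Notation Pop := (@Pop R d m beta).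
Local Notation nths s i := (nth fset0 s i).
Local Notation spread := (@spread R d beta).
Local Notation small := (@small R d m).

Let d0 : (0 < d)%N. Proof. exact: leq_trans d3. Qed.
Let beta0 : 0 < beta. Proof. exact: lt_trans beta2. Qed.

Variable N : nat.
Hypothesis N0 : (0 < N)%N.
Local Notation Pdec := (@Pdec R d m beta N).
Local Notation interaction := (@interaction R d beta).
Local Notation total_interaction := (@total_interaction R d beta).

(** [i.+1 < size s] singles out all clusters but the last, whose shape is controlled only through
    [spread]. *)
Definition good (e r : R) s : Prop :=
  [/\ sizes s = N, forall i, (i < size s)%N -> (m < #|` nths s i| <= (2 * m).+1)%N,
   forall i, (i.+1 < size s)%N -> small (nths s i),
   forall i, (i < size s)%N -> spread (nths s i) <= r &
   forall i j, (i < size s)%N -> (j < size s)%N -> i != j ->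
     interaction (nths s i) (nths s j) <= e].

Lemma iter_Pdec_sum n (I : Type) (l : seq I) (Pr : pred I) (F : I -> seq (config d) -> R) s :
  iter n Pdec (fun t => \sum_(i <- l | Pr i) F i t) s = \sum_(i <- l | Pr i) iter n Pdec (F i) s.
Proof.
have iter0 : iter n Pdec (fun=> 0) s = 0.
  rewrite -[RHS](mul0r (iter n Pdec (fun=> 0) s)) -iter_PdecZ.
  by congr (iter _ _ _ _); apply/funext => t; rewrite mul0r.
elim: l => [|i l IH].
  by under eq_fun do rewrite big_nil; rewrite big_nil.
under eq_fun do rewrite big_cons; rewrite big_cons.
by case: (Pr i) => //; rewrite iter_PdecD IH.
Qed.

Lemma total_small (eps r : R) : 0 < eps -> 0 <= r -> exists2 e, 0 < e &
  forall s, good e r s -> forall S, \sum_(k < S) iter k Pdec total_interaction s <= eps.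
Proof.
move=> eps0 r0.
have NN0 : 0 < (N * N)%:R :> R by rewrite ltr0n muln_gt0 N0.
have [e e0 He] := pair_small d3 m0 beta2 N0 (divr_gt0 eps0 NN0) r0.
exists e => // s [sN sm ssm sr sG] S.
pose nu := [seq #|` A| | A : config d <- s].
have hs : has_sizes nu s by [].
have num : all (leq m.+1) nu.
  apply/allP => _ /mapP[A As ->]; have := sm (index A s).
  by rewrite index_mem nth_index// => /(_ As)/andP[].
have nuN : sumn nu = N.
  by rewrite -sN sumnE big_map /sizes [LHS](big_nth fset0) big_mkord.
have sN' : (size s <= N)%N.
  rewrite -sN /sizes -[X in (X <= _)%N]card_ord -sum1_card; apply: leq_sum => i _.
  by have /andP[h _] := sm i (ltn_ord i); rewrite (leq_ltn_trans _ h).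
pose n := size s.
have E k : iter k Pdec total_interaction s = \sum_(i < n) \sum_(j < n | val j != val i)
    iter k Pdec (fun t => interaction (nths t i) (nths t j)) s.
  rewrite (@eq_iter_Pdec R d m beta N nu k _ (fun t => \sum_(i < n) \sum_(j < n | val j != val i)
    interaction (nths t i) (nths t j)) s num)//.
    by rewrite iter_Pdec_sum; apply: eq_bigr => i _; rewrite iter_Pdec_sum.
  move=> t ht; have tn : size t = n by rewrite (size_has_sizes ht) size_map.
  by rewrite /total_interaction tn.
under eq_bigr do rewrite E.
rewrite exchange_big/=; under eq_bigr do rewrite exchange_big/=.
apply: (@le_trans _ _ (\sum_(i < n) \sum_(j < n | val j != val i) eps / (N * N)%:R)).
  apply: ler_sum => i _; apply: ler_sum => j ji.
  have [iN|iN] := ltnP i.+1 (size s).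
    apply: (He nu) => //; [by rewrite eq_sym|exact: ssm| | |].
    - by have /andP[] := sm j (ltn_ord j).
    - exact: sr.
    - by apply: sG => //; rewrite eq_sym.
  (* Here [i] is the last cluster; then [j] is not, and the symmetry of [interaction] exchanges
     them. *)
  have jN : (j.+1 < size s)%N.
    by move: ji (ltn_ord i) (ltn_ord j) iN; rewrite /n; lia.
  under eq_bigr => k _.
    rewrite (_ : (fun t => interaction (nths t i) (nths t j)) =
                 (fun t => interaction (nths t j) (nths t i))); last first.
      by apply/funext => t; rewrite interactionC.
    over.
  apply: (He nu) => //; [exact: ssm| | |].
  - by have /andP[] := sm i (ltn_ord i).
  - exact: sr.
  - exact: sG.
apply: (@le_trans _ _ (\sum_(i < n) \sum_(j < n) eps / (N * N)%:R)).
  apply: ler_sum => i _; rewrite [leLHS]big_mkcond; apply: ler_sum => j _.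
  by case: ifP => // _; rewrite divr_ge0// ltW.
rewrite !sumr_const !card_ord -mulrnA -[leLHS]mulr_natr.
rewrite mulrAC ler_pdivrMr// ler_wpM2l ?(ltW eps0)// ler_nat.
exact: leq_mul.
Qed.

Variable r : R.
Hypotheses (r0 : 0 <= r) (mN : (m < N)%N).

Definition near_set C : R := (`[< diam R C <= r >] && (#|` C| == N))%:R.

Definition visits n C : R := \sum_(t < n) iter t Pop near_set C.

(** [cross_le] asks for a bound valid on all configurations, while the induction bounds [visits] at
    cardinality [N] only. *)
Let cut n C : R := if #|` C| == N then visits n C else 0.

Lemma near_set_ge0 C : 0 <= near_set C. Proof. exact: ler0n. Qed.

Lemma visits_ge0 n C : 0 <= visits n C.
Proof.
by apply: sumr_ge0 => t _; apply: iter_Pop_ge0; exact: near_set_ge0.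
Qed.

Lemma visitsS n C : visits n.+1 C = near_set C + Pop (visits n) C.
Proof. by rewrite /visits big_ord_recl/= Pop_sum. Qed.

Lemma visits_cut n C : #|` C| = N -> Pop (visits n) C = Pop (cut n) C.
Proof.
move=> CN; apply: eq_Pop => B CB; rewrite /cut (card_step _ CB) ?CN ?eqxx//.
Qed.

(** Two clusters within diameter [r] interact by at least [(1 + r)^(-beta)], so a visit is paid for
    by the interaction. *)
Lemma near_set_le s : (1 < size s)%N -> (forall i, (i < size s)%N -> (0 < #|` nths s i|)%N) ->
  near_set (cluster_union s) <= (1 + r) `^ beta * total_interaction s.
Proof.
move=> s2 sm; have Q0 := total_interaction_ge0 beta s.
rewrite /near_set; case: asboolP => [D|_]; last by rewrite mulr_ge0 ?powR_ge0.
case: eqP => _; last by rewrite mulr_ge0 ?powR_ge0.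
have s1 : (0 < size s)%N by exact: ltnW.
have /fset0Pn[x xA] : nths s 0 != fset0 by rewrite -cardfs_gt0 sm.
have /fset0Pn[y yA] : nths s 1 != fset0 by rewrite -cardfs_gt0 sm.
have xs : x \in cluster_union s by apply/cluster_unionP; exists 0%N.
have ys : y \in cluster_union s by apply/cluster_unionP; exists 1%N.
have p : (1 + r) `^ (- beta) <= phi beta x y.
  apply: phi_lb; [exact: ltW|by rewrite lerDl|].
  by rewrite (le_trans (enorm_le_diam R xs ys))// (le_trans D)// lerDr.
have q : phi beta x y <= total_interaction s.
  rewrite /total_interaction (bigD1 (Ordinal s1))//= (bigD1 (Ordinal s2))//=.
  rewrite -addrA ler_wpDr//.
    apply: addr_ge0; first by apply: sumr_ge0 => k _; exact: interaction_ge0.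
    by apply: sumr_ge0 => k _; apply: sumr_ge0 => l _; exact: interaction_ge0.
  rewrite (le_trans (phi_le_coupling beta xA yA))// /interaction.
  rewrite ler_peMl ?coupling_ge0// -[leLHS]mulr1 ler_pM// spread_ge1//.
have P0 : 0 < (1 + r) `^ beta by rewrite powR_gt0// ltr_pwDl.
rewrite powRN in p; rewrite /= -[leLHS](divff (lt0r_neq0 P0)) ler_wpM2l ?(ltW P0)//.
exact: le_trans p q.
Qed.

(** Induction on [n], replacing one step by a decoupled one: the error is [kappa] times the loss at
    the current clusters, and the visit at time 0 is bounded by their interaction as well. The
    errors then add up along the decoupled chain. *)
Lemma visits_decoupled nu kappa n s : all (leq m.+1) nu -> sumn nu = N -> (1 < size nu)%N ->
  0 <= kappa -> (forall k C, (k <= n)%N -> #|` C| = N -> visits k C <= kappa) ->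
  has_sizes nu s ->
  cut n (cluster_union s) <= ((1 + r) `^ beta + kappa * cross_rate d m beta N) *
    \sum_(t < n) iter t Pdec total_interaction s.
Proof.
move=> num nuN nu2 k0; set M := _ + _.
have c0 : 0 <= cross_rate d m beta N.
  by rewrite mulr_ge0// (le_trans _ (cross_cst_ge d m beta0 N))// powR_ge0.
have M0 : 0 <= M by rewrite addr_ge0 ?powR_ge0// mulr_ge0.
elim: n s => [|n IH] s Hk hs.
  by rewrite /cut /visits !big_ord0 mulr0; case: eqP.
have ss : size s = size nu by exact: size_has_sizes hs.
have bigm i : (i < size s)%N -> (m < #|` nths s i|)%N.
  by move=> si; rewrite (has_sizes_nth hs si); apply: (allP num); rewrite mem_nth// -ss.
have S0 : 0 <= \sum_(t < n.+1) iter t Pdec total_interaction s.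
  by apply: sumr_ge0 => k _; apply: iter_Pdec_ge0 => t; exact: total_interaction_ge0.
rewrite {1}/cut; case: eqP => [CN|_]; last by rewrite mulr_ge0.
have cutk B : 0 <= cut n B <= kappa.
  rewrite /cut; case: eqP => [BN|_]; last by rewrite lexx.
  by rewrite visits_ge0 Hk.
rewrite visitsS visits_cut//.
have cr := cross_le d0 m0 beta0 bigm (sizes_has_sizes nuN hs) N0 cutk.
have nr : near_set (cluster_union s) <= (1 + r) `^ beta * total_interaction s.
  apply: near_set_le; first by rewrite ss.
  by move=> i si; rewrite (leq_ltn_trans _ (bigm i si)).
have dec : Pdec (fun t => cut n (cluster_union t)) s <=
    M * \sum_(k < n) iter k.+1 Pdec total_interaction s.
  rewrite (@le_trans _ _ (Pdec (fun t => M * \sum_(k < n) iter k Pdec total_interaction t) s))//.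
    apply: Pdec_le => i B si sB; apply: IH; last exact: has_sizes_upd sB.
    by move=> k C kn; apply: Hk; exact: leqW.
  rewrite PdecZ ler_wpM2l//.
  have e := @iter_Pdec_sum 1 _ (index_enum 'I_n) xpredT (fun k => iter k Pdec total_interaction) s.
  by rewrite (e : Pdec (fun t => \sum_(k < n) iter k Pdec total_interaction t) s =
    \sum_(k < n) iter k.+1 Pdec total_interaction s).
rewrite big_ord_recl [M * (_ + _)]mulrDr (le_trans (lerD nr cr))// addrCA addrC.
rewrite lerD//= /M mulrDl lerD//; by rewrite mulrA.
Qed.

(** A lower bound [delta] on the [k]-step probability from [C] to [B], stated against all
    non-negative functions so that it applies to [kappa - cut n]. *)
Definition leads (k : nat) (delta : R) C B : Prop :=
  forall f : config d -> R, (forall X, 0 <= f X) -> delta * f B <= iter k Pop f C.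

Lemma near_set_le1 C : near_set C <= 1.
Proof. by rewrite /near_set; case: (_ && _). Qed.

Lemma visits_mono n C : visits n C <= visits n.+1 C.
Proof.
rewrite /visits big_ord_recr/= lerDl; apply: iter_Pop_ge0; exact: near_set_ge0.
Qed.

Lemma visits_iter n k C : #|` C| = N ->
  visits n.+1 C <= k.+1%:R + iter k.+1 Pop (visits n) C.
Proof.
elim: k C => [|k IH] C CN; first by rewrite visitsS lerD2r near_set_le1.
rewrite (le_trans (IH C CN))// -[k.+2%:R]natr1 -addrA lerD2l.
rewrite [iter k.+2 Pop _]iterSr.
apply: (@le_trans _ _ (iter k.+1 Pop (fun B => 1 + Pop (visits n) B) C)).
  apply: (@iter_Pop_le R d m beta (fun B => #|` B| = N)) => //.
    by move=> A B AN AB; rewrite (card_step _ AB) AN.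
  move=> B BN; rewrite (le_trans (visits_mono n B))// visitsS.
  by rewrite lerD2r near_set_le1.
by rewrite iter_PopD lerD2r iter_Pop_cst_le.
Qed.

(** A bootstrap on the horizon [n]. From diameter at most [r], separated clusters are reached with
    probability at least [delta], and from there at most [(kappa + 1) / 2] visits are expected.
    Hence at most [T + kappa - delta (kappa - 1) / 2] visits, which is [kappa] by choice. *)
Lemma visits_bounded :
  (exists2 r', 0 <= r' & forall e, 0 < e -> exists T : nat, exists2 delta : R, 0 < delta &
    forall C, #|` C| = N -> diam R C <= r -> exists k s,
    [/\ (0 < k <= T)%N, good e r' s, (1 < size s)%N & leads k delta C (cluster_union s)]) ->
  exists K : R, forall n C, #|` C| = N -> visits n C <= K.
Proof.
move=> [r' r'0 reach].
have cr0 : 0 <= cross_rate d m beta N.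
  by rewrite mulr_ge0// (le_trans _ (cross_cst_ge d m beta0 N))// powR_ge0.
set cr := cross_rate d m beta N in cr0 *; set c := (1 + r) `^ beta.
have c0 : 0 <= c by exact: powR_ge0.
(* [eps] makes [(c + kappa * cr) * eps] at most [(kappa + 1) / 2] for every [kappa >= 0]. It must
   not depend on [kappa], which is chosen from [delta], itself obtained from [eps]. *)
pose eps : R := (2 * (c + cr + 1))^-1.
have eps0 : 0 < eps by rewrite invr_gt0; lra.
have epsE : eps * (c + cr + 1) = 2^-1 by rewrite /eps; field; lra.
have [e e0 He] := total_small eps0 r'0.
have [T [delta delta0 HT]] := reach e e0.
pose kappa := 2 * T%:R / delta + 1.
have kd : delta * (kappa - 1) / 2 = T%:R by rewrite /kappa; field; rewrite gt_eqF.
have k0 : 0 <= kappa by rewrite addr_ge0// divr_ge0// ?mulr_ge0// ltW.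
exists kappa => n; suff H : forall j, (j <= n)%N -> forall C, #|` C| = N -> visits j C <= kappa.
  by move=> C; exact: H.
elim: n => [|n IH] j; first by rewrite leqn0 => /eqP -> C _; rewrite /visits big_ord0.
rewrite leq_eqVlt ltnS => /predU1P[->|/IH//] C CN.
(* Outside diameter [r] the initial time is not counted, and one step later the horizon is [n]. *)
have [D|D] := leP (diam R C) r; last first.
  rewrite visitsS /near_set asboolF ?add0r; last by apply/negP; rewrite -ltNge.
  apply: Pop_le_cst => // B CB; apply: (IH n) => //.
  by rewrite (card_step _ CB) CN.
have [k [s [/andP[k1 kT] sgood s2 lead]]] := HT C CN D.
have [sN sm _ _ _] := sgood.
case: k k1 kT lead => // k _ kT lead.
rewrite (le_trans (visits_iter n k CN))//.
have cutk B : 0 <= cut n B <= kappa.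
  rewrite /cut; case: eqP => [BN|_]; last by rewrite lexx.
  by rewrite visits_ge0 (IH n).
have -> : iter k.+1 Pop (visits n) C = iter k.+1 Pop (cut n) C.
  apply/eqP; rewrite eq_le; apply/andP; split;
    apply: (@iter_Pop_le R d m beta (fun B => #|` B| = N)) => //;
    try by move=> A B AN AB; rewrite (card_step _ AB) AN.
    by move=> B BN; rewrite /cut BN eqxx.
  by move=> B BN; rewrite /cut BN eqxx.
have lb := lead (fun B => kappa - cut n B).
have {lb} lb : delta * (kappa - cut n (cluster_union s)) <= kappa - iter k.+1 Pop (cut n) C.
  rewrite (le_trans (lb _))//; first by move=> X; rewrite subr_ge0; case/andP: (cutk X).
  by rewrite iter_PopB lerD2r iter_Pop_cst_le.
pose nu := [seq #|` A| | A : config d <- s].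
have hs : has_sizes nu s by [].
have num : all (leq m.+1) nu.
  apply/allP => _ /mapP[A As ->]; have := sm (index A s).
  by rewrite index_mem nth_index// => /(_ As)/andP[].
have nuN : sumn nu = N.
  by rewrite -sN sumnE big_map /sizes [LHS](big_nth fset0) big_mkord.
have nu2 : (1 < size nu)%N by rewrite size_map.
have ub := @visits_decoupled nu kappa n s num nuN nu2 k0 (fun k C kn => IH k kn C) hs.
have h1 := He s sgood n.
have M0 : 0 <= c + kappa * cr by rewrite addr_ge0// mulr_ge0.
have {ub} ub : cut n (cluster_union s) <= (kappa + 1) / 2.
  rewrite (le_trans ub)// (le_trans (ler_wpM2l M0 h1))//.
  have : kappa * (eps * (c + cr + 1)) + eps * (c + cr + 1) = (kappa + 1) / 2.
    by rewrite epsE; field.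
  have : 0 <= kappa * eps * c by rewrite !mulr_ge0// ltW.
  have : 0 <= kappa * eps by rewrite mulr_ge0// ltW.
  have : 0 <= eps * cr by rewrite mulr_ge0// ltW.
  by lra.
have kTR : k.+1%:R <= T%:R :> R by rewrite ler_nat.
have : delta * ((kappa - 1) / 2) <= delta * (kappa - cut n (cluster_union s)).
  by rewrite ler_wpM2l ?(ltW delta0)//; lra.
by lra.
Qed.

End Visits.

(** * Reaching separated clusters *)

Section Moves.
Variables (R : realType) (d m : nat) (beta : R).
Hypotheses (d3 : (3 <= d)%N) (m0 : (0 < m)%N) (beta2 : 2 < beta).
Implicit Types (A B C E Y : config d) (a x y z : lattice d).
Local Notation Pop := (@Pop R d m beta).
Local Notation step := (@step_rel R d m).
Let beta0 : 0 < beta. Proof. exact: lt_trans beta2. Qed.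
Variables (N : nat) (D : R).
Hypotheses (mN : (m < N)%N) (D0 : 0 <= D).

(** The source of every step has diameter at most [D], so that each step has probability at least
    [step_lb]; the end point is left free. *)
Fixpoint moves (k : nat) C B : Prop :=
  if k is k'.+1 then
    exists E, [/\ #|` C| = N, diam R C <= D, step C E & moves k' E B]
  else C = B.

Lemma moves_cat k l C B E : moves k C B -> moves l B E -> moves (k + l) C E.
Proof.
elim: k C => [|k IH] C /=; first by move=> ->.
by move=> [F [CN CD CF FB]] BE; exists F; split=> //; exact: IH.
Qed.

Lemma moves_leads k T C B : (k <= T)%N -> moves k C B ->
  leads m beta k (step_lb d m beta N D ^+ T) C B.
Proof.
have N0 : (0 < N)%N by apply: leq_trans mN.
have lb0 : 0 <= step_lb d m beta N D by apply/ltW/step_lb_gt0.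
move=> kT CB f f0; apply: (@le_trans _ _ (step_lb d m beta N D ^+ k * f B)).
  rewrite ler_wpM2r// ler_wiXn2l//; exact: step_lb_le1.
elim: k C CB {kT} => [|k IH] C /=; first by move=> ->; rewrite mul1r.
move=> [E [CN CD CE EB]]; rewrite exprS -mulrA.
rewrite (le_trans (ler_wpM2l lb0 (IH E EB)))//.
by apply: (Pop_lb (ltW beta0) mN CN CD CE) => X; exact: iter_Pop_ge0.
Qed.

Variable C0 : config d.
Variable H : nat.
Let i0 : 'I_d := ax3 d3 ord0.
Local Notation e := (axis i0).

(** All sites met in the construction lie above sites of [C0], by at most [H]; this alone bounds
    every diameter by [D]. *)
Definition tube B := forall z, z \in B ->
  exists2 c, c \in C0 & exists2 t : nat, (t <= H)%N & z = c + t%:Z *: e.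

Lemma tube_diam B : tube B -> diam R C0 + H%:R <= D -> diam R B <= D.
Proof.
move=> tB rD; apply: diam_le => // x y /tB[c cC [t tH ->]] /tB[c' c'C [t' t'H ->]].
rewrite opprD addrACA -scalerBl (le_trans (enormD _ _ _))//.
rewrite enorm_axis (le_trans _ rD)// lerD//; first exact: enorm_le_diam.
by rewrite -intr_norm -[H%:R]/((H%:Z)%:~R) ler_int; clear -tH t'H; lia.
Qed.

Definition line a : config d := (a |` [fset x in ray i0 a m])%fset.

Lemma lineP a x : reflect (exists2 t : nat, (t <= m)%N & x = a + t%:Z *: e) (x \in line a).
Proof.
rewrite in_fset1U in_fseq; apply: (iffP orP).
- case=> [/eqP ->|/rayP[t /andP[_ tm] ->]]; last by exists t.
  by exists 0%N => //; rewrite scale0r addr0.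
- move=> [[|t] tm ->]; first by left; rewrite scale0r addr0.
  by right; apply/rayP; exists t.+1.
Qed.

Lemma ray_inj a (t t' : int) : a + t *: e = a + t' *: e -> t = t'.
Proof. by move=> /addrI/rowP/(_ i0); rewrite !mxE !eqxx !mulr1. Qed.

Lemma uniq_ray a n : uniq (ray i0 a n).
Proof.
elim: n a => //= n IH a; rewrite IH andbT; apply/rayP => -[k /andP[k0 _]].
by rewrite -[X in X = _]addr0 -(scale0r e) => /ray_inj; clear -k0; lia.
Qed.

Lemma card_line a : #|` line a| = m.+1.
Proof.
rewrite cardfsU1 in_fseq card_fseq undup_id ?uniq_ray// size_ray.
case: rayP => // -[k /andP[k0 _]].
by rewrite -[X in X = _]addr0 -(scale0r e) => /ray_inj; clear -k0; lia.
Qed.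

Lemma tubeU A B : tube A -> tube B -> tube (A `|` B)%fset.
Proof. by move=> tA tB z; rewrite in_fsetU => /orP[/tA|/tB]. Qed.

Lemma tube_line c (t : nat) : c \in C0 -> (t + m <= H)%N -> tube (line (c + t%:Z *: e)).
Proof.
move=> cC tH z /lineP[k km ->]; exists c => //; exists (t + k)%N; first by rewrite (leq_trans _ tH)// leq_add2l.
by rewrite -addrA -scalerDl.
Qed.

Hypothesis C0D : diam R C0 + H%:R <= D.

Lemma step_ray C Y a : (Y `<=` C)%fset -> #|` C| = (#|` Y| + m)%N -> a \in Y ->
  (forall t : nat, (0 < t <= m)%N -> a + t%:Z *: e \notin Y) ->
  step C (Y `|` line a)%fset.
Proof.
move=> YC CY aY dis.
have -> : (Y `|` line a = Y `|` [fset x in ray i0 a m])%fset.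
  apply/fsetP => x; rewrite /line !in_fsetU in_fset1 orbA; case: eqP => [->|]; rewrite ?aY ?orbF//.
apply: step_rebuild => //; first exact: size_ray.
by apply: attachable_ray => // x /rayP[t tm ->]; exact: dis.
Qed.

(** A line advances by [m] in one step: its top site is kept and becomes the foot of the next line,
    and the other [m] sites are redeposited above it. *)
Lemma walk w Y c (t0 : nat) : c \in C0 -> tube Y -> (t0 + w * m + m <= H)%N ->
  (#|` Y| + m.+1)%N = N ->
  (forall t : nat, (t0 <= t <= t0 + w * m + m)%N -> c + t%:Z *: e \notin Y) ->
  moves w (Y `|` line (c + t0%:Z *: e))%fset (Y `|` line (c + (t0 + w * m)%:Z *: e))%fset.
Proof.
move=> cC tY; elim: w t0 => [|w IH] t0 tH YN dis; first by rewrite mul0n addn0.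
set a := c + t0%:Z *: e.
have disYl : [disjoint Y & line a]%fset.
  apply/fdisjointP_sym => x /lineP[t tm ->]; rewrite -addrA -scalerDl -PoszD.
  by apply: dis; rewrite mulSn; lia.
have cN : #|` (Y `|` line a)%fset| = N.
  by rewrite cardfsU (eqP disYl) cardfs0 subn0 card_line.
have tb : tube (Y `|` line a)%fset by apply: tubeU => //; apply: tube_line => //; lia.
exists (Y `|` line (c + (t0 + m)%:Z *: e))%fset; split=> //.
- exact: tube_diam.
- set b := c + (t0 + m)%:Z *: e.
  have -> : (Y `|` line b = (b |` Y) `|` line b)%fset.
    by apply/fsetP => x; rewrite /line !(in_fsetU, in_fset1); case: (x == b); rewrite ?orbT.
  have bY : b \notin Y by apply: dis; rewrite mulSn; lia.
  have ba : b = a + m%:Z *: e by rewrite /b /a -addrA -scalerDl -PoszD.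
  apply: step_ray.
  + apply/fsubsetP => x; rewrite in_fset1U in_fsetU => /predU1P[->|->//].
    by apply/orP; right; apply/lineP; exists m.
  + by rewrite cN cardfsU1 bY -YN; lia.
  + by rewrite in_fset1U eqxx.
  + move=> t /andP[t0' tm]; rewrite in_fset1U negb_or; apply/andP; split.
      by apply/eqP; rewrite -[X in _ = X]addr0 -(scale0r e) => /ray_inj; lia.
    rewrite /b -addrA -scalerDl -PoszD; apply: dis; rewrite mulSn; lia.
- rewrite (_ : t0 + w.+1 * m = (t0 + m) + w * m)%N; last by rewrite mulSn addnA.
  apply: IH => //; first by move: tH; rewrite mulSn; lia.
  by move=> t ht; apply: dis; rewrite mulSn; lia.
Qed.

End Moves.

(** * Extraction of separated clusters *)

Section Separation.
Variables (R : realType) (d m : nat) (beta : R).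
Hypotheses (d3 : (3 <= d)%N) (m0 : (0 < m)%N) (beta2 : 2 < beta).
Implicit Types (A B C E : config d) (s ls : seq (config d)) (a x y z : lattice d).
Local Notation nths s i := (nth fset0 s i).
Local Notation cover := (@cluster_union _).
Let beta0 : 0 < beta. Proof. exact: lt_trans beta2. Qed.
Let d0 : (0 < d)%N. Proof. exact: leq_trans d3. Qed.
Let i0 : 'I_d := ax3 d3 ord0.
Local Notation e := (axis i0).
Local Notation line := (line m d3).

Definition height x : int := x ord0 i0.

Lemma height_axis x (t : int) : height (x + t *: e) = height x + t.
Proof. by rewrite /height !mxE !eqxx mulr1. Qed.

Definition apart (g : nat) A B := forall x y, x \in A -> y \in B ->
  g%:Z <= `|height x - height y|.

Lemma apartC g A B : apart g A B -> apart g B A.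
Proof. by move=> AB x y xB yA; rewrite distrC; exact: AB. Qed.

Fixpoint separated (g : nat) ls : Prop :=
  if ls is A :: ls' then (forall B, B \in ls' -> apart g A B) /\ separated g ls' else True.

Lemma separated_rcons g ls B : separated g ls -> (forall A, A \in ls -> apart g A B) ->
  separated g (rcons ls B).
Proof.
elim: ls => [|A ls IH] //= [Als sls] lsB; split; last first.
  by apply: IH => // E Els; apply: lsB; rewrite inE Els orbT.
move=> E; rewrite mem_rcons inE => /predU1P[->|]; last exact: Als.
by apply: lsB; rewrite mem_head.
Qed.

Lemma separated_nth g ls i j : separated g ls -> (i < size ls)%N -> (j < size ls)%N ->
  i != j -> apart g (nths ls i) (nths ls j).
Proof.
elim: ls i j => //= A ls IH [|i] [|j]//= [Als sls] il jl ij.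
- by apply: Als; rewrite mem_nth.
- by apply: apartC; apply: Als; rewrite mem_nth.
- exact: IH.
Qed.

Lemma coupling_apart g A B : (0 < g)%N -> apart g A B ->
  coupling beta A B <= (#|` A| * #|` B|)%:R * g%:R `^ (- beta).
Proof.
move=> g0 AB; have g1 : 1 <= g%:R :> R by rewrite ler1n.
have gp : 0 < g%:R :> R by rewrite ltr0n.
have key x y : x \in A -> y \in B -> phi beta x y <= g%:R `^ (- beta).
  move=> xA yB; rewrite phiE !powRN lef_pV2 ?posrE ?powR_gt0 ?far_gt0//.
  rewrite ge0_ler_powR ?nnegrE ?(ltW gp) ?(ltW (far_gt0 _ _ _)) ?(ltW beta0)//.
  rewrite le_max; apply/orP; left.
  rewrite (le_trans _ (coord_le_enorm R (x - y) i0))//.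
  rewrite -intr_norm -[g%:R]/((g%:Z)%:~R) ler_int (le_trans (AB x y xA yB))//.
  by rewrite /height !mxE.
rewrite /coupling (@le_trans _ _ (\sum_(x <- A) #|` B|%:R * g%:R `^ (- beta)))//.
  rewrite big_seq [leRHS]big_seq; apply: ler_sum => x xA.
  rewrite (@le_trans _ _ (\sum_(y <- B) g%:R `^ (- beta)))//.
    by rewrite big_seq [leRHS]big_seq; apply: ler_sum => y yB; exact: key.
  by rewrite big_const_seq count_predT iter_addr_0 mulr_natl.
by rewrite big_const_seq count_predT iter_addr_0 natrM -mulrA -[leLHS]mulr_natl.
Qed.

Lemma exists_subset (A : config d) k : (k <= #|` A|)%N ->
  exists2 M, (M `<=` A)%fset & #|` M| = k.
Proof.
move=> kA; exists [fset x in take k (enum_fset A)]%fset.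
  by apply/fsubsetP => x; rewrite in_fseq => /mem_take.
by rewrite card_fseq undup_id ?take_uniq ?fset_uniq// size_takel.
Qed.

Variables (C : config d) (N nl q1 rho W : nat) (b : int) (D : R).
Hypotheses (CN : #|` C| = N) (hN : N = (m.+1 * q1 + nl)%N)
  (hC : forall x, x \in C -> b - (2 * rho)%:Z <= height x <= b).
Variable g : nat.
Hypotheses (g0 : (0 < g)%N) (hW : (2 * rho + m + g <= W * m)%N)
  (hD : diam R C + (q1 * W * m + m)%N%:R <= D).
Let H := (q1 * W * m + m)%N.
(** The cluster after which [j] others are still to be taken walks [(j + 1) W] steps: it ends
    between [base j.+1] and [base j.+1 + 2 rho + m], at least [g] below [base j.+2]. The first one
    extracted goes farthest, so none has to pass another. *)
Let base (j : nat) : int := b - (2 * rho)%:Z + (j * W * m)%:Z.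
Local Notation tube := (tube d3 C H).

(* The invariant of the extraction of clusters: j clusters are still to be taken
   from what rest retains of C, and those of ls lie at heights that leave room
   for the next one. *)
Definition stage (j : nat) rest ls : Prop :=
  [/\ (rest `<=` C)%fset, #|` rest| = (m.+1 * j + nl)%N,
      forall A, A \in ls -> [/\ exists a, A = line a, tube A &
         forall x, x \in A -> base j.+1 <= height x],
      separated g ls & #|` (rest `|` cover ls)%fset| = N].

Lemma baseS j : base j.+1 = base j + (W * m)%:Z.
Proof. by rewrite /base !mulSn mulnDl; clear; lia. Qed.

Lemma tube_cover ls : (forall A, A \in ls -> tube A) -> tube (cover ls).
Proof.
move=> lst z /cluster_unionP[i il zi]; apply: lst zi; exact: mem_nth.
Qed.

Lemma sub_tube A : (A `<=` C)%fset -> tube A.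
Proof.
move=> AsC z zA; exists z; first exact: (fsubsetP AsC).
by exists 0%N => //; rewrite scale0r addr0.
Qed.

Lemma disjoint_rest j rest ls : stage j rest ls -> [disjoint rest & cover ls]%fset.
Proof.
move=> [rC _ hls _ _]; apply/fdisjointP => x xr; apply/negP => /cluster_unionP[i il xi].
have [_ _ /(_ x xi)] := hls _ (mem_nth fset0 il).
have /andP[_ xb] := hC (fsubsetP rC x xr).
by rewrite baseS /base; move: hW g0 xb; clear; lia.
Qed.

(** The column above the highest site [p] is free up to the clusters already placed. One step
    activates [m] other sites [M] and raises a line from [p]; then [(j + 1) W] steps carry the line
    to its place. *)
Lemma stage_step j rest ls : (0 < nl)%N -> (j < q1)%N -> stage j.+1 rest ls ->
  exists rest' a, stage j rest' (line a :: ls) /\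
    moves m N D (j.+1 * W).+1 (rest `|` cover ls)%fset (rest' `|` cover (line a :: ls))%fset.
Proof.
move=> nl0 jq st; have dis := disjoint_rest st; have [rC cr hls sls cN] := st.
have r0 : rest != fset0 by rewrite -cardfs_gt0 cr addn_gt0 nl0 orbT.
have [p pr pmax] : exists2 p, p \in enum_fset rest & forall x, x \in enum_fset rest ->
    (height x <= height p)%O.
  apply: seq_argmax; apply: contra_neq r0 => e0.
  by apply/fsetP => w; rewrite in_fset0 -[w \in rest]/(w \in enum_fset _) e0.
have {}pr : p \in rest by [].
have {}pmax x : x \in rest -> height x <= height p by exact: pmax.
have c1 : #|` (rest `\ p)%fset| = (m.+1 * j.+1 + nl).-1.
  by have := cardfsD1 p rest; rewrite pr cr; clear; lia.
have [M Mr Mm] : exists2 M, (M `<=` rest `\ p)%fset & #|` M| = m.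
  by apply: exists_subset; rewrite c1 mulnS; clear -nl0; lia.
pose rest' := ((rest `\ p) `\` M)%fset.
have cr' : #|` rest'| = (m.+1 * j + nl)%N.
  by rewrite cardfsDS// c1 Mm mulnS; clear; lia.
have r'r : (rest' `<=` rest)%fset.
  by apply: fsubset_trans (fsubsetDl _ _) _; exact: fsubsetDl.
have pr' : p \notin rest' by rewrite !in_fsetD in_fset1 eqxx andbF.
pose Y0 := (rest' `|` cover ls)%fset.
have cls : (#|` rest| + #|` cover ls|)%N = N.
  by rewrite -cN cardfsU (eqP dis) cardfs0 subn0.
have dis' : [disjoint rest' & cover ls]%fset by exact: fdisjointWl dis.
have cY0 : (#|` Y0| + m.+1)%N = N.
  by rewrite cardfsU (eqP dis') cardfs0 subn0 cr' -cls cr mulnS; clear; lia.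
have /andP[plo phi] := hC (fsubsetP rC p pr).
have above (t : nat) : (t <= j.+1 * W * m + m)%N -> p + t%:Z *: e \notin Y0.
  move=> tH; rewrite in_fsetU negb_or; apply/andP; split.
    case: t tH => [|t] _; first by rewrite scale0r addr0.
    by apply/negP => /(fsubsetP r'r)/pmax; rewrite height_axis; clear; lia.
  apply/negP => /cluster_unionP[i il xi].
  have [_ _ /(_ _ xi)] := hls _ (mem_nth fset0 il).
  by rewrite height_axis baseS /base; move: hW g0 phi tH; clear; lia.
have pC : p \in C by exact: (fsubsetP rC).
have tcov : tube (cover ls) by apply: tube_cover => A /hls[].
have tY0 : tube Y0 by apply: tubeU => //; apply: sub_tube; exact: fsubset_trans rC.
pose w := (j.+1 * W)%N.
have wH : (w * m + m <= H)%N by rewrite /w /H leq_add2r !leq_mul2r jq !orbT.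
pose a := p + (w * m)%:Z *: e.
have linea x : x \in line a -> exists2 t : nat, (w * m <= t <= w * m + m)%N & x = p + t%:Z *: e.
  move=> /lineP[t tm ->]; exists (w * m + t)%N; first by rewrite leq_addr leq_add2l.
  by rewrite -addrA -scalerDl.
have coverE : (rest' `|` cover (line a :: ls))%fset = (Y0 `|` line a)%fset.
  by rewrite /= fsetUCA fsetUC.
have D0 : 0 <= D by rewrite (le_trans _ hD)// addr_ge0 ?diam_ge0.
have mN : (m < N)%N by rewrite -cY0 addnS ltnS leq_addl.
exists rest', a; split; last first.
  rewrite coverE; exists (Y0 `|` line p)%fset; split=> //.
  - apply: (tube_diam D0 _ hD).
    by apply: tubeU => //; exact: sub_tube.
  - have -> : (Y0 `|` line p = (p |` Y0) `|` line p)%fset.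
      by apply/fsetP => x; rewrite /line !(in_fsetU, in_fset1); case: (x == p); rewrite ?orbT.
    have pY0 : p \notin Y0 by have := above 0%N; rewrite scale0r addr0; apply.
    apply: step_ray.
    + apply/fsubsetP => x; rewrite in_fset1U in_fsetU => /predU1P[->|]; first by rewrite pr.
      by rewrite in_fsetU => /orP[/(fsubsetP r'r)->//|->]; rewrite orbT.
    + by rewrite cN cardfsU1 pY0 -[LHS]cY0 addnS -addSn.
    + by rewrite in_fset1U eqxx.
    + move=> t /andP[t0 tm]; rewrite in_fset1U negb_or above ?andbT; last by rewrite (leq_trans tm)// leq_addl.
      by apply/eqP; rewrite -[X in _ = X]addr0 -(scale0r e) => /ray_inj; clear -t0; lia.
  - have := @walk R d m beta d3 m0 beta2 N D mN D0 C H hD w Y0 p 0 pC tY0.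
    by rewrite scale0r addr0 add0n; apply => // t /andP[_]; exact: above.
split=> //.
- exact: fsubset_trans rC.
- move=> A; rewrite inE => /predU1P[->|/hls[lA tA bA]]; last first.
    by split=> // x /bA; rewrite baseS; clear; lia.
  split; [by exists a|by apply: tube_line|].
  by move=> x /linea[t ht ->]; rewrite height_axis /base; move: plo ht; rewrite /w; clear; lia.
- split=> // B /hls[_ _ bB] x y /linea[t ht ->] /bB.
  by rewrite height_axis baseS /base; move: phi ht hW; rewrite /w; clear; lia.
- have disl : [disjoint Y0 & line a]%fset.
    by apply/fdisjointP_sym => x /linea[t /andP[_ ht] ->]; exact: above.
  by rewrite coverE cardfsU (eqP disl) cardfs0 subn0 card_line.
Qed.

Lemma extract j rest ls : (0 < nl)%N -> (j <= q1)%N -> stage j rest ls ->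
  exists k rest' ls', [/\ (j <= k <= j * (q1 * W).+1)%N, stage 0 rest' ls',
    size ls' = (size ls + j)%N &
    moves m N D k (rest `|` cover ls)%fset (rest' `|` cover ls')%fset].
Proof.
move=> nl0; elim: j rest ls => [|j IH] rest ls jq st.
  by exists 0%N, rest, ls; split=> //; rewrite addn0.
have [rest1 [a [st1 mv1]]] := stage_step nl0 jq st.
have [k [rest2 [ls2 [/andP[jk kj] st2 sz2 mv2]]]] := IH _ _ (ltnW jq) st1.
exists ((j.+1 * W).+1 + k)%N, rest2, ls2; split=> //.
- have jW : (j.+1 * W <= q1 * W)%N by rewrite leq_mul2r jq orbT.
  apply/andP; split; first by rewrite addSn ltnS (leq_trans jk)// leq_addl.
  by rewrite [leqRHS]mulSn leq_add// ltnS.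
- by rewrite sz2 /= addSnnS.
- exact: moves_cat mv1 mv2.
Qed.

End Separation.

Section Reach.
Variables (R : realType) (d m : nat) (beta : R).
Hypotheses (d3 : (3 <= d)%N) (m0 : (0 < m)%N) (beta2 : 2 < beta).
Implicit Types (C : config d) (s : seq (config d)).
Local Notation nths s i := (nth fset0 s i).
Let beta0 : 0 < beta. Proof. exact: lt_trans beta2. Qed.

Lemma small_line a : small R m (line m d3 a).
Proof.
split; first exact: card_line.
apply: diam_le; first by rewrite mulr_ge0.
move=> x y /lineP[t tm ->] /lineP[t' tm' ->].
rewrite opprD addrACA subrr add0r -scalerBl enorm_axis.
rewrite -intr_norm (_ : 2 * m%:R = (2 * m)%N%:Z%:~R); last by rewrite -natrM.
by rewrite ler_int; clear -tm tm'; lia.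
Qed.

Lemma reach_separated N (r : R) : (2 * m + 2 <= N)%N -> 0 <= r ->
  exists2 r' : R, 0 <= r' & forall e : R, 0 < e -> exists T : nat, exists2 delta : R, 0 < delta &
    forall C, #|` C| = N -> diam R C <= r -> exists k s,
    [/\ (0 < k <= T)%N, good m beta N e r' s, (1 < size s)%N &
      leads m beta k delta C (cluster_union s)].
Proof.
move=> mN r0.
(* The division is applied to [N - (m + 1)] so that the last cluster keeps between [m + 1] and
   [2m + 1] sites; as [N >= 2m + 2], there is at least one other cluster. *)
pose q1 := ((N - m.+1) %/ m.+1)%N; pose nl := (m.+1 + (N - m.+1) %% m.+1)%N.
have hN : N = (m.+1 * q1 + nl)%N.
  by rewrite /q1 /nl addnCA mulnC -divn_eq; clear -mN; lia.
have q10 : (0 < q1)%N by rewrite divn_gt0//; clear -mN; lia.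
have nlm : (m < nl <= (2 * m).+1)%N.
  by rewrite /nl; have := ltn_pmod (N - m.+1) (ltn0Sn m); clear; lia.
have mN' : (m < N)%N by clear -mN; lia.
have N0 : (0 < N)%N by apply: leq_ltn_trans mN'.
pose r' := (1 + 2 * m%:R) `^ beta + (1 + r) `^ beta.
have r'0 : 0 <= r' by rewrite addr_ge0 ?powR_ge0.
exists r' => // e e0.
(* At gap [g] the interaction is at most [r'^2 N^2 g^(-beta)], and [g^(-beta) <= 1 / g]; so a gap of
   at least [X] suffices. *)
pose X := r' * r' * (N * N)%:R / e.
have X0 : 0 <= X by rewrite divr_ge0 ?(ltW e0)// !mulr_ge0.
pose g := (Num.bound X).+1; pose rho := Num.bound r.
have gX : X <= g%:R by rewrite (le_trans (ltW (archi_boundP X0)))// ler_nat.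
have rrho : r <= rho%:R by exact/ltW/archi_boundP.
pose W := (2 * rho + m + g)%N.
have hW : (2 * rho + m + g <= W * m)%N by rewrite leq_pmulr.
pose D := r + (q1 * W * m + m)%N%:R.
have D0 : 0 <= D by rewrite addr_ge0.
exists (q1 * (q1 * W).+1)%N, (step_lb d m beta N D ^+ (q1 * (q1 * W).+1)).
  by rewrite exprn_gt0// step_lb_gt0.
move=> C CN Cr.
have /fset0Pn[x0 x0C] : C != fset0 by rewrite -cardfs_gt0 CN.
pose b := height d3 x0 + rho%:Z.
have hC x : x \in C -> b - (2 * rho)%N%:Z <= height d3 x <= b.
  move=> xC; have : `|height d3 x - height d3 x0| <= rho%:Z.
    rewrite -(ler_int R) intr_norm (le_trans _ rrho)// (le_trans _ Cr)//.
    rewrite (le_trans _ (enorm_le_diam R xC x0C))//.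
    by have := coord_le_enorm R (x - x0) (ax3 d3 ord0); rewrite !mxE.
  by rewrite /b; clear; lia.
have hD : diam R C + (q1 * W * m + m)%N%:R <= D by rewrite lerD2r.
have st : stage m d3 C N nl q1 rho W b g q1 C [::].
  split=> //; first by rewrite CN hN.
  by rewrite /= fsetU0.
have nl0 : (0 < nl)%N by case/andP: nlm => /(leq_ltn_trans (leq0n _)).
have [k [rest [ls [/andP[qk kq] [rC cr hls sls cN] sz mv]]]] :=
  extract m0 beta2 hC (ltn0Sn _) hW hD nl0 (leqnn q1) st.
rewrite muln0 add0n in cr; rewrite add0n in sz.
exists k, (rcons ls rest); split.
- by rewrite kq andbT (leq_trans q10).
- have nthE i : nths (rcons ls rest) i =
      if (i < q1)%N then nths ls i else if i == q1 then rest else fset0.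
    by rewrite nth_rcons sz.
  have lsE i : (i < q1)%N -> exists a, nths ls i = line m d3 a.
    by move=> iq; have [//|] := hls (nths ls i); rewrite ?mem_nth ?sz.
  have cardE i : (i < q1.+1)%N -> (m < #|` nths (rcons ls rest) i| <= (2 * m).+1)%N.
    rewrite nthE ltnS leq_eqVlt => /predU1P[->|iq]; first by rewrite ltnn eqxx cr.
    rewrite iq; have [a ->] := lsE i iq; by rewrite card_line; clear -m0; lia.
  have spE i : (i < q1.+1)%N -> spread beta (nths (rcons ls rest) i) <= r'.
    rewrite nthE ltnS leq_eqVlt => /predU1P[->|iq].
      rewrite ltnn eqxx (le_trans (spread_le beta0 r0 _)) ?lerDr ?powR_ge0//.
      apply: diam_le => // x y xr yr; rewrite (le_trans _ Cr)//.
      by apply: enorm_le_diam; exact: (fsubsetP rC).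
    rewrite iq; have [a ->] := lsE i iq.
    have [_ sD] := small_line a.
    by rewrite (le_trans (spread_le beta0 _ sD)) ?mulr_ge0// lerDl powR_ge0.
  have sizesE : sizes (rcons ls rest) = N.
    rewrite /sizes size_rcons sz big_ord_recr/= nthE ltnn eqxx cr [RHS]hN; congr (_ + _)%N.
    rewrite (eq_bigr (fun=> m.+1)); first by rewrite sum_nat_const card_ord mulnC.
    by move=> i _; rewrite nthE ltn_ord; have [a ->] := lsE i (ltn_ord i); rewrite card_line.
  have sep : separated d3 g (rcons ls rest).
    apply: separated_rcons => // A /hls[_ _ bA] x y /bA + /(fsubsetP rC)/hC/andP[_].
    by move: hW; clear; lia.
  rewrite /good size_rcons sz; split=> //.
  + move=> i; rewrite ltnS => iq; rewrite nthE iq; have [a ->] := lsE i iq.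
    exact: small_line.
  move=> i j iq jq ij.
  have ap : apart d3 g (nths (rcons ls rest) i) (nths (rcons ls rest) j).
    by apply: separated_nth sep _ _ ij; rewrite size_rcons sz.
  rewrite /interaction (@le_trans _ _ (r' * r' * ((N * N)%:R * g%:R^-1)))//.
    rewrite ler_pM ?mulr_ge0 ?spread_ge0 ?coupling_ge0//.
      by rewrite ler_pM ?spread_ge0 ?spE.
    rewrite (le_trans (coupling_apart beta2 _ ap))// ler_pM ?powR_ge0//.
      rewrite ler_nat leq_mul// -sizesE /sizes size_rcons sz.
        by rewrite (bigD1 (Ordinal iq))//= leq_addr.
      by rewrite (bigD1 (Ordinal jq))//= leq_addr.
    by rewrite -[leRHS]powR_inv1// ler_powR ?ler1n// lerN2 ltW// (lt_trans _ beta2)// ltr1n.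
  rewrite mulrA ler_pdivrMr ?ltr0n//.
  by rewrite [e * _]mulrC; move: gX; rewrite /X ler_pdivrMr.
- by rewrite size_rcons sz.
- have -> : cluster_union (rcons ls rest) = (rest `|` cluster_union ls)%fset.
    by apply/fsetP => x; rewrite in_fsetU !mem_cluster_union has_rcons.
  apply: (moves_leads beta2 mN' D0 kq); by move: mv; rewrite /= fsetU0.
Qed.

End Reach.

(** * Trajectories *)

Section Marginals.
Local Open Scope classical_set_scope.
Variables (R : realType) (d m : nat) (beta : R) (C : config d).
Variable mu : probability (trajectory d) R.
Hypothesis law : markov_law (cat_step m beta) C mu.
Implicit Types (A B : config d) (H : set (config d)) (w : trajectory d).
Local Notation Pop := (@Pop R d m beta).

Lemma measurable_coord t A : measurable [set w : trajectory d | w t = A].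
Proof. by apply: sub_sigma_algebra; exists t, A. Qed.

Let code : config d -> nat := @choice.pickle (config d : countType).

(** The test keeps a single number for each configuration, so that the enumeration has no
    repetition. *)
Definition enum_config (n : nat) : option (config d) :=
  obind (fun A => if code A == n then Some A else None)
    (@choice.unpickle (config d : countType) n).

Lemma enum_configK A : enum_config (code A) = Some A.
Proof. by rewrite /enum_config /code choice.pickleK /= eqxx. Qed.

Lemma enum_config_inj n A : enum_config n = Some A -> n = code A.
Proof.
by rewrite /enum_config; case: choice.unpickle => //= B; case: eqP => // <- [->].
Qed.

Lemma measurable_at t H : measurable [set w : trajectory d | H (w t)].
Proof.
rewrite (_ : [set w | _] = \bigcup_n
  [set w : trajectory d | exists2 A, enum_config n = Some A & H A /\ w t = A]).
  apply: bigcup_measurable => n _; case E : (enum_config n) => [A|].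
    have [HA|nHA] := pselect (H A).
      rewrite (_ : [set w | _] = [set w | w t = A]); first exact: measurable_coord.
      apply/seteqP; split=> w /=; first by move=> [B [<-] [_ ->]].
      by move=> wA; exists A.
    rewrite (_ : [set w | _] = set0) //.
    by apply/seteqP; split=> w //= -[B [<-] []].
  rewrite (_ : [set w | _] = set0) //.
  by apply/seteqP; split=> w //= -[B].
apply/seteqP; split=> w /=.
  by move=> Hw; exists (code (w t)) => //=; exists (w t) => //; exact: enum_configK.
by move=> [n _ /= [A _ [HA ->]]].
Qed.

Definition prefix (k : nat) w0 : set (trajectory d) :=
  [set w | forall s, (s <= k)%N -> w s = w0 s].

Lemma measurable_prefix k w0 : measurable (prefix k w0).
Proof.
rewrite (_ : prefix k w0 = \bigcap_(s in [set s | (s <= k)%N]) [set w : trajectory d | w s = w0 s]).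
  by apply: bigcap_measurable => [|s _]; [exists 0%N|exact: measurable_coord].
by apply/seteqP; split=> w.
Qed.

Lemma sum_cat_step_le (l : seq (config d)) A (f : config d -> R) : uniq l ->
  (forall X, 0 <= f X) -> \sum_(B <- l) cat_step m beta A B * f B <= Pop f A.
Proof.
move=> ul f0.
rewrite (eq_bigr (fun B => Pop (fun X => f B * (X == B)%:R) A)); last first.
  by move=> B _; rewrite PopZ cat_stepE mulrC.
rewrite -Pop_sum; apply: Pop_le => X _.
have [Xl|Xl] := boolP (X \in l).
  rewrite (bigD1_seq X)//= eqxx mulr1 big1 ?addr0// => B BX.
  by rewrite eq_sym (negbTE BX) mulr0.
rewrite big_seq big1// => B Bl; case: eqP Xl => [->|_]; last by rewrite mulr0.
by rewrite Bl.
Qed.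

(** The Markov property on cylinders: the set is split according to the state at time [k + 1]. As
    only an upper bound is claimed, countable subadditivity suffices. *)
Lemma prefix_bound n k w0 H :
  (mu (prefix k w0 `&` [set w | H (w (k + n)%N)]) <=
   mu (prefix k w0) * (iter n Pop (fun X => `[< H X >]%:R) (w0 k))%:E)%E.
Proof.
have f0 (X : config d) : 0 <= (`[< H X >]%:R : R) by [].
elim: n k w0 => [|n IH] k w0.
  rewrite addn0 /=; have [Hk|Hk] := pselect (H (w0 k)).
    rewrite asboolT// mule1; apply: le_measure; rewrite ?inE.
    - by apply: measurableI; [exact: measurable_prefix|exact: measurable_at].
    - exact: measurable_prefix.
    - exact: subIsetl.
  rewrite asboolF// mule0 (_ : _ `&` _ = set0) ?measure0//.
  by apply/seteqP; split=> w //= -[/(_ k (leqnn k)) ->].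
pose w1 B : trajectory d := fun s => if s == k.+1 then B else w0 s.
have w1k B s : (s <= k)%N -> w1 B s = w0 s.
  by move=> sk; rewrite /w1; case: eqP => // e; move: sk; rewrite e ltnn.
have w1S B : w1 B k.+1 = B by rewrite /w1 eqxx.
pose F i : set (trajectory d) := if enum_config i is Some B then
  prefix k.+1 (w1 B) `&` [set w | H (w (k.+1 + n)%N)] else set0.
have mF i : measurable (F i).
  rewrite /F; case: enum_config => // B.
  by apply: measurableI; [exact: measurable_prefix|exact: measurable_at].
have cover : prefix k w0 `&` [set w | H (w (k + n.+1)%N)] `<=` \bigcup_i F i.
  move=> w [wk Hw]; exists (code (w k.+1)) => //.
  rewrite /F enum_configK; split; last by rewrite /= addSnnS.
  move=> s; rewrite leq_eqVlt => /predU1P[->|sk]; first by rewrite w1S.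
  by rewrite w1k// wk.
have mA : measurable (prefix k w0 `&` [set w | H (w (k + n.+1)%N)]).
  by apply: measurableI; [exact: measurable_prefix|exact: measurable_at].
have sub : (mu (prefix k w0 `&` [set w | H (w (k + n.+1)%N)]) <= \sum_(i <oo) mu (F i))%E.
  exact: measure_sigma_subadditive.
apply: (le_trans sub).
have muF i : (mu (F i) <= if enum_config i is Some B then
    mu (prefix k w0) * (cat_step m beta (w0 k) B *
      iter n Pop (fun X => `[< H X >]%:R) B)%:E else 0)%E.
  rewrite /F; case: enum_config => [B|]; last by rewrite measure0.
  rewrite (le_trans (IH k.+1 (w1 B)))// w1S EFinM muleA.
  have [_ lawS] := law; have := lawS k (w1 B); rewrite w1S w1k// => e.
  rewrite [X in (X * _ <= _)%E](_ : _ = mu (prefix k w0) * (cat_step m beta (w0 k) B)%:E)%E//.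
  rewrite /prefix e; congr (mu _ * _)%E.
  by apply/seteqP; split=> w /= ws s sk; rewrite ws// w1k.
apply: (le_trans (lee_nneseries (fun i _ _ => measure_ge0 _ _) (fun i _ => muF i))).
have p_fin : mu (prefix k w0) \is a fin_num by apply: fin_num_measure; exact: measurable_prefix.
set p := mu (prefix k w0) in p_fin *; pose r := fine p.
have pE : p = r%:E by rewrite fineK.
have r0 : 0 <= r by rewrite fine_ge0// measure_ge0.
pose G B := cat_step m beta (w0 k) B * iter n Pop (fun X => `[< H X >]%:R) B.
have G0 B : 0 <= G B.
  rewrite mulr_ge0//; last exact: iter_Pop_ge0.
  by rewrite cat_stepE; apply: Pop_ge0.
rewrite pE; apply: lime_le.
  apply: is_cvg_nneseries => i _ _; case: enum_config => // B.
  by rewrite lee_fin mulr_ge0//; exact: G0.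
apply: nearW => M; rewrite (_ : (\sum_(0 <= i < M) _)%E =
    (r * \sum_(B <- pmap enum_config (iota 0 M)) G B)%:E); last first.
  rewrite big_pmap mulr_sumr -sumEFin /index_iota subn0; apply: eq_bigr => i _.
  by case: enum_config => [B|] //=; rewrite mulr0.
rewrite lee_fin ler_wpM2l// iterS; apply: sum_cat_step_le.
  apply: (@pmap_uniq _ _ _ code) (iota_uniq _ _) => i.
  by case E : (enum_config i) => [B|] //=; rewrite (enum_config_inj E).
by move=> X; exact: iter_Pop_ge0.
Qed.

Lemma marginal_bound t H :
  (mu [set w | H (w t)] <= (iter t Pop (fun X => `[< H X >]%:R) C)%:E)%E.
Proof.
have [start _] := law.
pose w0 : trajectory d := fun=> C.
have p0 : prefix 0 w0 = [set w | w 0%N = C].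
  apply/seteqP; split=> w /=; first by apply.
  by move=> w00 s; rewrite leqn0 => /eqP ->.
have := prefix_bound t 0 w0 H; rewrite p0 start mul1e add0n; apply: le_trans.
have nul : mu (~` [set w : trajectory d | w 0%N = C]) = 0%E.
  by rewrite probability_setC ?start ?subee//; exact: measurable_coord.
rewrite -[X in (_ <= X)%E]adde0 -nul.
rewrite (le_trans _ (measureU2 _ _ _))//; first apply: le_measure; rewrite ?inE.
- exact: measurable_at.
- apply: measurableU; last by apply: measurableC; exact: measurable_coord.
  by apply: measurableI; [exact: measurable_coord|exact: measurable_at].
- by move=> w Hw; have [h|h] := pselect (w 0%N = C); [left|right].
- by apply: measurableI; [exact: measurable_coord|exact: measurable_at].
- by apply: measurableC; exact: measurable_coord.
Qed.

End Marginals.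

(** * Recurrence and transience *)

Section Conclusion.
Local Open Scope classical_set_scope.
Variables (R : realType) (d m : nat) (beta : R).
Hypotheses (d3 : (3 <= d)%N) (m0 : (0 < m)%N) (beta2 : 2 < beta).
Local Notation Pop := (@Pop R d m beta).
Let d0 : (0 < d)%N. Proof. exact: leq_trans d3. Qed.
Let beta0 : 0 < beta. Proof. exact: lt_trans beta2. Qed.

Lemma diam_to_infinityE : @diam_to_infinity R d =
  \bigcap_k \bigcup_T \bigcap_(t in [set t | (T <= t)%N])
    [set w : trajectory d | k%:R <= diam R (w t)].
Proof.
apply/seteqP; split=> w.
  move=> /cvgryPge h k _; have [T _ HT] := h k%:R.
  by exists T => // t; exact: HT.
move=> h; apply/cvgryPge => A.
have [T _ HT] := h (Num.bound `|A|) I.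
near=> t; rewrite (le_trans (ler_norm A))// (le_trans (ltW (archi_boundP (normr_ge0 A))))//.
by apply: HT => /=; near: t; exact: nbhs_infty_ge.
Unshelve. all: by end_near. Qed.

Lemma measurable_diam_to_infinity : measurable (@diam_to_infinity R d).
Proof.
rewrite diam_to_infinityE; apply: bigcap_measurable => // k _.
apply: bigcup_measurable => T _; apply: bigcap_measurable => [|t _]; first by exists T => /=.
exact: (measurable_at t [set X | k%:R <= diam R X]).
Qed.

Variables (C : config d) (mu : probability (trajectory d) R).
Hypothesis law : markov_law (cat_step m beta) C mu.
Hypothesis mC : (m < #|` C|)%N.

Lemma card_conserved : {ae mu, forall w, forall t, #|` w t| = #|` C|}.
Proof.
have neg : mu.-negligible (\bigcup_t [set w : trajectory d | #|` w t| <> #|` C|]).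
  apply: negligible_bigcup => t; have mt := measurable_at t [set X | #|` X| <> #|` C|].
  apply/negligibleP => //; apply/eqP; rewrite eq_le measure_ge0 andbT.
  rewrite (le_trans (marginal_bound law t [set X | #|` X| <> #|` C|]))// lee_fin.
  apply: (@iter_Pop_le_cst R d m beta (fun X => #|` X| = #|` C|)) => //.
    by move=> A B AsC AB; rewrite (card_step _ AB) AsC.
  by move=> B BC; rewrite asboolF// => /(_ BC).
apply: negligibleS neg => w /= h.
by apply: contrapT => h2; apply: h => t; apply: contrapT => h3; apply: h2; exists t.
Qed.

(** Markov's inequality bounds the probability of [diam >= k] at time [T], uniformly in [T], by a
    constant over [k + 1]; the increasing union of the events [F T] inherits the bound, and [k] is
    arbitrary. *)
Lemma recurrent_case : (#|` C| < 2 * m + 2)%N -> mu (@diam_to_infinity R d) = 0%E.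
Proof.
move=> C2; have hC : (m < #|` C| <= (2 * m).+1)%N.
  by rewrite mC /=; move: C2; rewrite addn2 ltnS.
have [K K0 HK] := spread_moment d0 m0 beta0 hC.
have s1 := spread_ge1 beta0 C.
have tail (k : nat) : (mu (@diam_to_infinity R d) <= (K * spread beta C / k.+1%:R)%:E)%E.
  pose F T := \bigcap_(t in [set t | (T <= t)%N])
    [set w : trajectory d | k%:R <= diam R (w t)].
  have mF T : measurable (F T).
    apply: bigcap_measurable => [|t _]; first by exists T => /=.
    exact: (measurable_at t [set X | k%:R <= diam R X]).
  have mUF : measurable (\bigcup_T F T) by exact: bigcup_measurable.
  have incF : {homo F : n p / (n <= p)%N >-> (n <= p)%O}.
    move=> n p np; apply/subsetPset => w h t /= pt; apply: h => /=.
    exact: leq_trans pt.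
  apply: (@le_trans _ _ (mu (\bigcup_T F T))).
    apply: le_measure; rewrite ?inE//; first exact: measurable_diam_to_infinity.
    by rewrite diam_to_infinityE => w; apply.
  have cv := nondecreasing_cvg_mu (mu := mu) mF mUF incF.
  rewrite -(cvg_lim _ cv)//; apply: lime_le; first by apply/cvg_ex; exists (mu (\bigcup_T F T)).
  apply: nearW => T /=.
  apply: (@le_trans _ _ (mu [set w : trajectory d | k%:R <= diam R (w T)])).
    apply: le_measure; rewrite ?inE//.
      exact: (measurable_at T [set X | k%:R <= diam R X]).
    by move=> w /(_ T (leqnn T)).
  rewrite (le_trans (marginal_bound law T [set X | k%:R <= diam R X]))// lee_fin.
  rewrite (@le_trans _ _ (iter T Pop (fun X => k.+1%:R^-1 * spread beta X) C))//.
    apply: (@iter_Pop_le R d m beta (fun=> True)) => // X _.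
    case: asboolP => /= kX; last by rewrite mulr_ge0 ?spread_ge0// invr_ge0.
    have kX1 : k.+1%:R <= 1 + diam R X by rewrite -natr1 addrC lerD2l.
    have b1 : 1 <= beta by apply: ltW; apply: lt_trans beta2; rewrite ltr1n.
    have diam1 : 1 <= 1 + diam R X by rewrite lerDl; exact: diam_ge0.
    clear -kX1 b1 diam1.
    by rewrite ler_pdivlMl ?ltr0n// mulr1 (le_trans kX1)// le1r_powR.
  rewrite iter_PopZ mulrC ler_wpM2r ?invr_ge0//.
  exact: HK.
apply/eqP; rewrite eq_le measure_ge0 andbT; apply/lee_addgt0Pr => eps eps0.
rewrite add0e; pose a := K * spread beta C.
have a0 : 0 <= a by rewrite mulr_ge0 ?spread_ge0// ltW.
have ae0 : 0 <= a / eps by apply: divr_ge0 => //; exact: ltW.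
apply: (le_trans (tail (Num.bound (a / eps)))); rewrite lee_fin.
have h : a / eps <= (Num.bound (a / eps)).+1%:R.
  by apply: (le_trans (ltW (archi_boundP ae0))); rewrite ler_nat.
rewrite ler_pdivrMr ?ltr0n// -ler_pdivrMl//.
by rewrite [_ * a]mulrC.
Qed.

Lemma transient_case : (2 * m + 2 <= #|` C|)%N -> mu (@diam_to_infinity R d) = 1%E.
Proof.
move=> C2; set N := #|` C| in C2.
have N0 : (0 < N)%N by apply: leq_ltn_trans mC.
pose E (r t : nat) := [set w : trajectory d | diam R (w t) <= r%:R].
have mE r t : measurable (E r t) by exact: (measurable_at t [set X | diam R X <= r%:R]).
have BC r : mu (lim_sup_set (E r)) = 0%E.
  apply: lim_sup_set_cvg0 => //.
  have r0 : 0 <= r%:R :> R by [].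
  have [K HK] := visits_bounded d3 m0 beta2 N0 r0 mC (reach_separated d3 m0 beta2 C2 r0).
  apply: (@le_lt_trans _ _ K%:E); last exact: ltry.
  apply: lime_le; first by apply: is_cvg_nneseries => i _ _; exact: measure_ge0.
  apply: nearW => n; apply: (@le_trans _ _ (visits m beta N r%:R n C)%:E); last first.
    by rewrite lee_fin HK.
  rewrite /visits -sumEFin big_mkord; apply: lee_sum => t _.
  rewrite (le_trans (marginal_bound law t [set X | diam R X <= r%:R]))// lee_fin.
  apply: (@iter_Pop_le R d m beta (fun X => #|` X| = N)) => //.
    by move=> A B AN AB; rewrite (card_step _ AB) AN.
  by move=> X XN; rewrite /near_set XN eqxx andbT.
have comp : mu (~` @diam_to_infinity R d) = 0%E.
  (* If the diameter does not tend to infinity, then for some integer [r] it is at most [r]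
     infinitely often. *)
  have neg : mu.-negligible (\bigcup_r lim_sup_set (E r)).
    apply: negligible_bigcup => r; apply/negligibleP; last exact: BC.
    apply: bigcap_measurable => // n _; apply: bigcup_measurable => t _; exact: mE.
  apply/negligibleP; first by apply: measurableC; exact: measurable_diam_to_infinity.
  apply: negligibleS neg => w; rewrite diam_to_infinityE => nw.
  apply: contrapT => h; apply: nw => k _; apply: contrapT => nk; apply: h.
  exists k => // n _; apply: contrapT => nn; apply: nk; exists n => // t /= nt.
  rewrite leNgt; apply/negP => lt; apply: nn; exists t => //=.
  exact: ltW.
have mD := measurable_diam_to_infinity.
by rewrite -(setCK (@diam_to_infinity R d)) probability_setC ?comp ?sube0//; exact: measurableC.
Qed.

End Conclusion.

Theorem theorem1p1 (R : realType) (d m : nat) (beta : R)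
    (P : config d -> probability (trajectory d) R)
    (hd : (3 <= d)%N) (hm : (1 <= m)%N) (hbeta : 2 < beta)
    (hP : forall C : config d, cat_state m C ->
            markov_law (cat_step m beta) C (P C)) :
  critical_numerosity (cat_state m) P (@diam_to_infinity R d) (2 * m + 2).
Proof.
split.
- by rewrite addn2.
- by move=> C SC; exact: card_conserved (hP C SC) SC.
- exact: measurable_diam_to_infinity.
- move=> C SC; split => hC.
    exact: recurrent_case (hP C SC) SC hC.
  exact: transient_case (hP C SC) SC hC.
Qed.
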